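(* Let $(K_{s,t}:-\infty<s\leq t<\infty)$ be the family of random kernels constructed from a Feller convolution semigroup $(\nu_t:t\geq0)$ as described in the context, and for $t\in\mathbb{R}$ and $j\geq 1$ let $t_j=\max\{s\in D_{n_j}:s\leq t\}$. (1) For all real $s\leq t$ and all $\varkappa\in\mathcal{P}(M)$, $$\lim_{j\to\infty}\varkappa K_{s_j,t_j}=\varkappa K_{s,t}\quad\text{a.s.}$$ (2) For all real $s\leq t$ the law of $K_{s,t}$ coincides with $\nu_{t-s}$.
   Context: Basic notation. $(M,\rho)$ is a locally compact separable metric space in which all $\rho$-bounded sets are relatively compact; $\hat M$ is its one-point compactification. $\mathcal{P}(M)\subset\mathcal{P}(\hat M)$ are the spaces of Borel probability measures with the topologies of weak convergence; $\hat d$ is a metric on the compact space $\mathcal{P}(\hat M)$ and $d$ a complete metric on $\mathcal{P}(M)$, both compatible with weak convergence. $C_0(X)$ denotes continuous functions on $X$ vanishing at infinity. A kernel is a measurable map $K:M\to\mathcal{P}(M)$; $E$ is the set of kernels and $\mathcal{E}$ the smallest $\sigma$-field on $E$ making all maps $K\mapsto K(x)$, $x\in M$, measurable. For kernels, $K_1K_2(x)=\int_MK_2(y)K_1(x,dy)$, $Kf(x)=\int f(y)K(x,dy)$, and for $\mu\in\mathcal{P}(M)$, $\mu K(B)=\int_MK(x,B)\mu(dx)$. Feller convolution semigroup. A probability measure $\nu$ on $(E,\mathcal{E})$ is regular if it has a measurable presentation, i.e. a map $\mathfrak{q}:E\to E$ with $(K,x)\mapsto\mathfrak{q}(K)(x)$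 measurable and, for each $x$, $\mathfrak{q}(K)(x)=K(x)$ $\nu$-a.s. For regular $\nu_1,\nu_2$, $\nu_1*\nu_2$ is the law of $K_1\mathfrak{q}(K_2)$ under $\nu_1\otimes\nu_2$, with $\mathfrak{q}$ any measurable presentation of $\nu_2$. $(\nu_t:t\geq0)$ is a family of regular probability measures on $(E,\mathcal{E})$ with: $\nu_t*\nu_s=\nu_{t+s}$; $\lim_{t\to0+}\sup_{x}\nu_t\{|Kf(x)-f(x)|\geq\varepsilon\}=0$; $\lim_{y\to x}\nu_t\{|Kf(y)-Kf(x)|\geq\varepsilon\}=0$ and $\lim_{y\to\infty}\nu_t\{|Kf(y)|\geq\varepsilon\}=0$ (for all $f\in C_0(M)$, $\varepsilon>0$, $t\geq 0$, $x\in M$). Put $\mathsf{P}^{(n)}_t(x,B)=\int_E(\otimes_{i=1}^nK(x_i))(B)\nu_t(dK)$, $x\in M^n$. Spatial construction. For $n\geq1$, $x\in M^n$, $t\geq0$, $\Pi^{(n)}_t(x)$ is the unique Borel probability measure on $\mathcal{P}(\hat M)^n$ with $\int\big(\int_{\hat M^N}f\,d(\mu_{i_1}\otimes\ldots\otimes\mu_{i_N})\big)\Pi^{(n)}_t(x,d\mu)=\int_{M^N}f(y)\mathsf{P}^{(N)}_t((x_{i_1},\ldots,x_{i_N}),dy)$ for all $N\geq1$, $f\in C(\hat M^N)$, $(i_1,\ldots,i_N)\in\{1,\ldots,n\}^N$; it is concentrated on $\mathcal{P}(M)^n$. Fix compacts $L_j$, $j\geq1$, with $M=\bigcup_jL_j$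 and $L_j$ contained in the interior of $L_{j+1}$; fix positive $\varepsilon_j$ strictly decreasing to $0$ such that $(t,x,y)\in[0,j]\times L_j^2$, $\rho(x,y)\leq\varepsilon_j$ imply $\Pi^{(2)}_t((x,y),\{(\mu_1,\mu_2)\in\mathcal{P}(M)^2:d(\mu_1,\mu_2)\geq2^{-j}\})\leq2^{-j}$. Let $Z\subset M$ be an at most countable dense set and $m\mapsto z_m$ a bijection from $I\subset\mathbb{N}$ onto $Z$. Put $m^x_j=\inf\{m\in I:\rho(x,z_m)<\varepsilon_j/2\}$. Fix a measurable $\ell:\mathcal{P}(M)^{\mathbb{N}}\to\mathcal{P}(M)$ such that $\ell(\mu)$ is a limit point of $\mu$ for every relatively compact sequence $\mu$. Define $i:\mathcal{P}(M)^I\to E$, $i(\mu)(x)=\ell((\mu_{m^x_j}:j\geq1))$; $e:E\to\mathcal{P}(M)^I$, $e(K)=(K(z_m):m\in I)$; $\mathfrak{p}=i\circ e$; $\Phi_n(\mu^1,\ldots,\mu^n)=i(\mu^1)\cdots i(\mu^n)\in E$ for $\mu^1,\ldots,\mu^n\in\mathcal{P}(M)^I$. Let $\Pi_t$ be the unique probability measure on $\mathcal{P}(M)^I$ with $\Pi_t\{\mu:\mu|_J\in B\}=\Pi^{(|J|)}_t((z_m)_{m\in J},B)$ for all finite $J\subset I$ and Borel $B$. Then $\nu_t=\Pi_t\circ i^{-1}$. Dyadic construction. For $n\geq0$ let $(S_n,\mathcal{S}_n,\mathsf{P}_n)=(\mathcal{P}(M)^I,\mathcal{B}(\mathcal{P}(M))^{\otimes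 I},\Pi_{2^{-n}})^{\otimes\mathbb{Z}}$, $D_n=2^{-n}\mathbb{Z}$, $D=\bigcup_nD_n$. For $n\geq 1$ let $\pi_{n-1,n}:S_n\to S_{n-1}$, $\pi_{n-1,n}(\omega^n)=(e(i(\omega^n_{2l})i(\omega^n_{2l+1})))_{l\in\mathbb{Z}}$. Let $\Omega=\{(\omega^n)_{n\geq0}\in\prod_nS_n:\pi_{n-1,n}(\omega^n)=\omega^{n-1}\ \forall n\geq1\}$, $\mathcal{A}$ the $\sigma$-field generated by the projections $\pi_n(\omega)=\omega^n$, and $\mathsf{P}$ the unique probability measure on $(\Omega,\mathcal{A})$ with $\mathsf{P}\circ\pi_n^{-1}=\mathsf{P}_n$ for all $n$. For $(s,t)\in D_n^2$, $s<t$, put ${}^DK^{(n)}_{s,t}(\omega)=\Phi_{(t-s)2^n}(\omega^n_{s2^n},\ldots,\omega^n_{t2^n-1})$. For $(s,t)\in D^2$, $s<t$, put ${}^DK_{s,t}=\mathfrak{p}({}^DK^{(n)}_{s,t})$ with $n\geq0$ minimal such that $(s,t)\in D_n^2$; and ${}^DK_{t,t}(x)=\delta_x$ for $t\in D$, $x\in M$. Flow for real times. Fix a strictly increasing sequence of positive integers $(n_j:j\geq1)$ (one exists) such that for each $j\geq1$ and all $(s,t,u,v,\mu,\nu)\in(D\cap[-j,j])^4\times\mathcal{P}(L_j)^2$ with $s\leq t$, $u\leq v$, $|s-u|\leq2^{-n_j}$, $|t-v|\leq2^{-n_j}$, $d(\mu,\nu)\leq2^{-n_j}$ one has $\mathsf{P}\{\hat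 d(\mu\,{}^DK_{s,t},\nu\,{}^DK_{u,v})\geq2^{-j}\}\leq2^{-j}$. For $t\in\mathbb{R}$ put $t_j=\max\{s\in D_{n_j}:s\leq t\}$. Fix a measurable $\hat\ell:\mathcal{P}(\hat M)^{\mathbb{N}}\to\mathcal{P}(\hat M)$ such that $\hat\ell(\mu)$ is a limit point of $\mu$ for every sequence $\mu$, and fix $x_0\in M$. Define $\Phi:E^{\mathbb{N}}\to E$ by $\Phi(K)(x)=\hat\ell((\mathfrak{p}(K_n)(x):n\geq1))$ if this measure gives mass $1$ to $M$, and $\Phi(K)(x)=\delta_{x_0}$ otherwise. For real $s\leq t$ put $\tilde K_{s,t}=\Phi(({}^DK_{s_j,t_j}:j\geq1))$ and $K_{s,t}=\mathfrak{p}(\tilde K_{s,t})$. (For $(s,t)\in D^2$, $s\leq t$, one has $K_{s,t}={}^DK_{s,t}$.) *)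

(* Defs.v *)
From HB Require Import structures.
From mathcomp Require Import all_boot all_order all_algebra.
From mathcomp Require Import all_classical all_reals all_analysis.

Set Implicit Arguments.
Unset Strict Implicit.
Unset Printing Implicit Defensive.

Import Order.TTheory GRing.Theory Num.Theory.
Import numFieldNormedType.Exports.

Local Open Scope classical_set_scope.
Local Open Scope ring_scope.

(* Measurable types of the library are pointed; the metric spaces considered
   here are nonempty. *)
#[short(type="pmetricType")]
HB.structure Definition PointedMetric (K : numDomainType) :=
  {M of Pointed M & Metric K M}.

Definition borel (X : ptopologicalType) := g_sigma_algebraType (@open X).

HB.instance Definition _ (I : Type) (T : I -> ptopologicalType) :=
  Pointed.copy (prod_topology T) (forall i, T i).

(* The measures of the library are functions on all subsets, with unspecified
   values on nonmeasurable ones.  Fixing these values to be 0 makes Leibniz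
   equality coincide with equality of measures, see [pmeasP]. *)
Record pmeas (X : ptopologicalType) (R : realType) := PMeas {
  pmeas_val :> probability (borel X) R;
  pmeas_off : forall A : set (borel X), ~ measurable A -> pmeas_val A = 0%E }.

Section canonical.
Context (X : ptopologicalType) (R : realType).
Local Open Scope ereal_scope.

Section trim.
Variable P : probability (borel X) R.

Definition trim_fun (A : set (borel X)) : \bar R :=
  if `[< measurable A >] then P A else 0.

Let trim0 : trim_fun set0 = 0.
Proof. by rewrite /trim_fun asboolT// measure0. Qed.

Let trim_ge0 A : 0 <= trim_fun A.
Proof. by rewrite /trim_fun; case: ifP. Qed.

Let trim_sigma_additive : semi_sigma_additive trim_fun.
Proof.
move=> F mF tF mUF; rewrite {2}/trim_fun asboolT//.
rewrite [X in X @ _ --> _](_ : _ = fun n => \sum_(0 <= i < n) P (F i)).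
  exact: measure_semi_sigma_additive.
by apply/funext => n; apply: eq_bigr => i _; rewrite /trim_fun asboolT.
Qed.

HB.instance Definition _ := isMeasure.Build _ _ _ trim_fun
  trim0 trim_ge0 trim_sigma_additive.

Let trimT : trim_fun setT = 1.
Proof. by rewrite /trim_fun asboolT// probability_setT. Qed.

HB.instance Definition _ := Measure_isProbability.Build _ _ _ trim_fun trimT.

Definition trim : pmeas X R.
Proof.
by apply: (@PMeas _ _ trim_fun) => A nA; rewrite /= /trim_fun asboolF.
Defined.

End trim.

Lemma trimE (P : probability (borel X) R) A : measurable A -> trim P A = P A.
Proof. by move=> mA; rewrite /= /trim_fun asboolT. Qed.

Lemma pmeasP (mu nu : pmeas X R) :
  (forall A, measurable A -> mu A = nu A) -> mu = nu.
Proof.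
move: mu nu => [P P0] [Q Q0] /= PQ.
have {}PQ : (P : set _ -> _) = Q.
  by apply/funext => A; have [/PQ//|nA] := pselect (measurable A); rewrite P0 ?Q0.
have {}PQ : P = Q.
  move: P Q PQ {P0 Q0} => [P [[p1 p2] [p3] [p4] [p5] [p6] [p7] [p8]]].
  move=> [Q [[+ +] [+] [+] [+] [+] [+] [+]]] /= PQ.
  rewrite -{}PQ => q1 q2 q3 q4 q5 q6 q7 q8.
  by rewrite (Prop_irrelevance q1 p1) (Prop_irrelevance q2 p2)
    (Prop_irrelevance q3 p3) (Prop_irrelevance q4 p4) (Prop_irrelevance q5 p5)
    (Prop_irrelevance q6 p6) (Prop_irrelevance q7 p7) (Prop_irrelevance q8 p8).
by subst Q; congr PMeas; exact: Prop_irrelevance.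
Qed.

End canonical.

HB.instance Definition _ (X : ptopologicalType) (R : realType) :=
  gen_eqMixin (pmeas X R).
HB.instance Definition _ (X : ptopologicalType) (R : realType) :=
  gen_choiceMixin (pmeas X R).
HB.instance Definition _ (X : ptopologicalType) (R : realType) :=
  isPointed.Build (pmeas X R) (trim (dirac (point : borel X))).

Section weak_topology.
Context (X : ptopologicalType) (R : realType).

Definition bcontinuous : set (X -> R) :=
  [set f | continuous f /\ exists B, forall x, `|f x| <= B].

Definition weak_eval (mu : pmeas X R) :
    prod_topology (fun _ : set_type bcontinuous => R) :=
  fun f => \int[mu]_x \val f x.

HB.instance Definition _ :=
  Topological.copy (pmeas X R) (initial_topology weak_eval).

End weak_topology.

Section constructions.
Context (X : ptopologicalType) (R : realType).

(* the probability measure with values [m] on Borel sets; total, with an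
   unspecified value if there is none *)
Definition prob_of (m : set (borel X) -> \bar R) : pmeas X R :=
  xget point [set mu : pmeas X R | forall A, measurable A -> mu A = m A].

Lemma prob_ofE (m : set (borel X) -> \bar R) (P : probability (borel X) R) :
  (forall A, measurable A -> P A = m A) ->
  forall A, measurable A -> prob_of m A = m A.
Proof.
move=> Pm; rewrite /prob_of.
by case: xgetP => [_ -> //|/(_ (trim P))] []; move=> A mA; rewrite trimE// Pm.
Qed.

Definition pdirac (x : X) : pmeas X R := trim (dirac (x : borel X)).

Definition prod_pmeas n (mu : 'I_n -> pmeas X R) :
    pmeas {ptws 'I_n -> X} R :=
  xget point [set m : pmeas {ptws 'I_n -> X} R | forall B : 'I_n -> set (borel X),
    (forall k, measurable (B k)) ->
    m [set y | forall k, B k (y k)] = (\prod_(k < n) mu k (B k))%E].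

End constructions.

Arguments pdirac {X R} x.

Section power_space.
Context (J : Type) d (T : measurableType d).

Definition cylinder : set_system (J -> T) :=
  [set A | exists j, exists2 B, measurable B & A = (fun f => f j) @^-1` B].

Definition power_space := g_sigma_algebraType cylinder.

End power_space.

Definition is_power_measure (R : realType) (J : eqType) d
    (T : measurableType d) (Q : probability T R) (P : probability (power_space J T) R) :=
  forall (F : seq J) (B : J -> set T), uniq F -> (forall j, measurable (B j)) ->
    P [set f | forall j, j \in F -> B j (f j)] = (\prod_(j <- F) Q (B j))%E.

Record metrizes (R : realType) (T : topologicalType) (d : T -> T -> R) : Prop :=
  Metrizes {
    metrizes_eq0 : forall x y, d x y = 0 <-> x = y;
    metrizes_sym : forall x y, d x y = d y x;
    metrizes_triangle : forall x y z, d x z <= d x y + d y z;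
    metrizes_nbhs : forall x (A : set T),
      nbhs x A <-> exists2 e : R, 0 < e & [set y | d x y < e] `<=` A }.

Definition complete_metric (R : realType) (T : topologicalType)
    (d : T -> T -> R) :=
  forall u : nat -> T,
    (forall e : R, 0 < e ->
      exists N, forall m n, (N <= m)%N -> (N <= n)%N -> d (u m) (u n) < e) ->
    exists l : T, u @ \oo --> l.

Definition at_infinity (T : topologicalType) : set_system T :=
  filter_from compact (fun C => ~` C).
Arguments at_infinity T : clear implicits.

Definition vanishing_continuous (R : realType) (T : topologicalType) :
    set (T -> R) :=
  [set f | continuous f /\ f x @[x --> at_infinity T] --> (0 : R)].

(* 0 if [A] is empty *)
Definition least (A : set nat) : nat :=
  xget 0%N [set n | A n /\ forall m, A m -> (n <= m)%N].

Definition pair2 T (x y : T) : 'I_2 -> T := fun k => if val k == 0%N then x else y.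

Definition proper_metric (R : realType) (M : pmetricType R) :=
  [/\ locally_compact [set: M],
      (exists2 Z : set M, countable Z & dense Z) &
      forall A : set M, (exists x r, forall y, A y -> mdist x y <= r) ->
        precompact A].

(* When [M] is compact, [None] is an isolated point. *)
Notation compactify M := (one_point_compactification M).

Section kernels.
Context (R : realType) (M : pmetricType R).
Local Notation PM := (pmeas M R).
Local Notation PMhat := (pmeas (compactify M) R).

Record kern := Kern {
  kern_val :> M -> PM;
  kern_meas : measurable_fun [set: borel M] (kern_val : borel M -> borel PM) }.

HB.instance Definition _ := gen_eqMixin kern.
HB.instance Definition _ := gen_choiceMixin kern.
HB.instance Definition _ :=
  isPointed.Build kern (@Kern (cst point) (measurable_cst _)).

Definition kern_evals : set_system kern :=
  [set A | exists x, exists2 B : set (borel PM), measurable B &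
    A = [set K : kern | B (K x)]].

Definition kern_space := g_sigma_algebraType kern_evals.

(* [f] as a kernel; unspecified if [f] is not measurable *)
Definition kern_of (f : M -> PM) : kern :=
  xget point [set K : kern | K =1 f].

Lemma kern_ofE (f : M -> PM) :
  measurable_fun [set: borel M] (f : borel M -> borel PM) -> kern_of f =1 f.
Proof.
by move=> mf; rewrite /kern_of; case: xgetP => [_ -> //|/(_ (Kern mf))[]].
Qed.

Definition kdelta : kern := kern_of pdirac.

Definition kern_comp (K1 K2 : kern) : kern :=
  kern_of (fun x => prob_of (fun B => \int[K1 x]_y K2 y B)%E).

Definition kapp (K : kern) (f : M -> R) (x : M) : R := \int[K x]_y f y.

Definition kact (mu : PM) (K : kern) : PM :=
  prob_of (fun B => \int[mu]_x K x B)%E.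

Definition presentation (nu : probability kern_space R) (q : kern -> kern) :=
  measurable_fun [set: kern_space * borel M]
    (fun Kx => q Kx.1 Kx.2 : borel PM) /\
  forall x, \forall K \ae nu, q K x = K x.

Definition regular (nu : probability kern_space R) := exists q, presentation nu q.

(* law of [K1 q(K2)] under [nu1 \x nu2], where [q] is to be a presentation of
   [nu2] *)
Definition convolution (nu1 nu2 : probability kern_space R) (q : kern -> kern)
    (A : set kern_space) : \bar R :=
  (nu1 \x nu2)%E [set K | A (kern_comp K.1 (q K.2))].

Record feller_convolution_semigroup (nu : R -> probability kern_space R) :
    Prop := FellerConvolutionSemigroup {
  fcs_regular : forall t : R, 0 <= t -> regular (nu t);
  fcs_convolution : forall (t s : R) q, 0 <= t -> 0 <= s ->
    presentation (nu s) q -> forall A : set kern_space, measurable A ->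
    convolution (nu t) (nu s) q A = nu (t + s) A;
  fcs_time : forall (f : M -> R) (eps : R),
    vanishing_continuous f -> 0 < eps ->
    ereal_sup (range (fun x =>
      nu t [set K : kern_space | eps <= `|kapp K f x - f x| ]))
    @[t --> 0^'+] --> 0%E;
  fcs_space : forall (f : M -> R) (eps t : R) x,
    vanishing_continuous f -> 0 < eps -> 0 <= t ->
    nu t [set K : kern_space | eps <= `|kapp K f y - kapp K f x| ]
    @[y --> x] --> 0%E;
  fcs_infinity : forall (f : M -> R) (eps t : R),
    vanishing_continuous f -> 0 < eps -> 0 <= t ->
    nu t [set K : kern_space | eps <= `|kapp K f y| ]
    @[y --> at_infinity M] --> 0%E }.

Definition npoint (nu : R -> probability kern_space R) n (t : R)
    (x : 'I_n -> M) : pmeas {ptws 'I_n -> M} R :=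
  prob_of (fun B => \int[nu t]_K prod_pmeas (fun k => K (x k)) B)%E.

Definition embed (mu : PM) : PMhat :=
  prob_of (fun B : set (compactify M) => mu (Some @^-1` B)).

(* [mu] as a measure on [M] if [mu] is carried by [M], [pdirac x0] otherwise *)
Definition unembed (x0 : M) (mu : PMhat) : PM :=
  if `[< mu (range Some) = 1%E >] then prob_of (fun B => mu (Some @` B))
  else pdirac x0.

Definition npoint_space n := borel {ptws 'I_n -> PMhat}.

Definition is_spatial_law (nu : R -> probability kern_space R)
    (Pi : forall n, R -> ('I_n -> M) -> probability (npoint_space n) R) :=
  forall n (t : R) (x : 'I_n -> M), (0 < n)%N -> 0 <= t ->
  forall N (f : {ptws 'I_N -> compactify M} -> R)
    (i : 'I_N -> 'I_n), (0 < N)%N -> continuous f ->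
  (\int[Pi n t x]_mu \int[prod_pmeas (fun k => mu (i k))]_y (f y)%:E =
   \int[npoint nu t (fun k => x (i k))]_y (f (fun k => Some (y k)))%:E)%E.

Definition is_exhaustion (L : nat -> set M) :=
  [/\ forall j, (0 < j)%N -> compact (L j),
      [set: M] = \bigcup_(j in [set j | (0 < j)%N]) L j &
      forall j, (0 < j)%N -> L j `<=` (L j.+1)^°].

Definition is_modulus (d : PM -> PM -> R) (L : nat -> set M)
    (Pi : forall n, R -> ('I_n -> M) -> probability (npoint_space n) R)
    (eps : nat -> R) :=
  [/\ forall j, (0 < j)%N -> 0 < eps j,
      forall j, (0 < j)%N -> eps j.+1 < eps j,
      eps @ \oo --> 0 &
      forall j (t : R) (x y : M), (0 < j)%N -> 0 <= t <= j%:R -> L j x -> L j y ->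
        mdist x y <= eps j ->
        (Pi 2%N t (pair2 x y)
          [set v | exists mu1 mu2, (2 ^- j <= d mu1 mu2)%R /\
            v = pair2 (embed mu1) (embed mu2)] <= (2 ^- j)%:E)%E].

Definition limit_selection (ell : (nat -> PM) -> PM) :=
  measurable_fun [set: power_space nat (borel PM)]
    (ell : power_space nat (borel PM) -> borel PM) /\
  forall mu : nat -> PM, precompact (range mu) -> cluster (mu @ \oo) (ell mu).

Definition limit_selection_hat (ellhat : (nat -> PMhat) -> PMhat) :=
  measurable_fun [set: power_space nat (borel PMhat)]
    (ellhat : power_space nat (borel PMhat) -> borel PMhat) /\
  forall mu : nat -> PMhat, cluster (mu @ \oo) (ellhat mu).

End kernels.

Section spatial.
Context (R : realType) (M : pmetricType R).
Local Notation PM := (pmeas M R).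
Context (I : set nat) (z : I -> M) (eps : nat -> R) (ell : (nat -> PM) -> PM).

Definition seq_space := power_space I (borel PM).

Definition first_index (x : M) (j : nat) : nat :=
  least [set \val m | m in [set m : I | mdist x (z m) < eps j / 2]].

(* The sequences indexed by j >= 1 are fed to [ell] shifted by one. *)
Definition ikern (mu : I -> PM) : kern M :=
  kern_of (fun x => ell (fun j => oapp mu point (insub (first_index x j.+1)))).

Definition ekern (K : kern M) : I -> PM := fun m => K (z m).

Definition pkern (K : kern M) : kern M := ikern (ekern K).

Definition is_seq_law
    (Pi : forall n, R -> ('I_n -> M) -> probability (npoint_space M n) R)
    (PiI : R -> probability seq_space R) :=
  forall t : R, 0 <= t -> forall n (J : 'I_n -> I), (0 < n)%N -> injective J ->
  forall B : set (borel {ptws 'I_n -> PM}), measurable B ->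
    PiI t [set mu : seq_space | B (fun k => mu (J k))] =
    Pi n t (fun k => z (J k)) [set (fun k => embed (mu k)) | mu in B].

Definition level_space := power_space int seq_space.

Record dyadic_system := DyadicSystem {
  dyadic_val :> nat -> int -> I -> PM;
  dyadic_compat : forall n l, dyadic_val n l =
    ekern (kern_comp (ikern (dyadic_val n.+1 (2 * l)))
                 (ikern (dyadic_val n.+1 (2 * l + 1)))) }.

HB.instance Definition _ := gen_eqMixin dyadic_system.
HB.instance Definition _ := gen_choiceMixin dyadic_system.

(* The point [w0] is only needed because measurable types are pointed. *)
Definition pointed_system (w0 : dyadic_system) : Type := dyadic_system.

Section omega.
Variable w0 : dyadic_system.

HB.instance Definition _ := Choice.on (pointed_system w0).
HB.instance Definition _ := isPointed.Build (pointed_system w0) w0.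

Definition level_sets : set_system (pointed_system w0) :=
  [set A | exists n, exists2 B : set level_space, measurable B &
    A = [set w : dyadic_system | B (w n)]].

Definition omega := g_sigma_algebraType level_sets.

End omega.

Definition is_dyadic_law (PiI : R -> probability seq_space R)
    (Plev : nat -> probability level_space R)
    (w0 : dyadic_system) (P : probability (omega w0) R) :=
  (forall n, is_power_measure (PiI (2 ^- n)) (Plev n)) /\
  forall n (B : set level_space), measurable B ->
    P [set w : omega w0 | B (dyadic_val w n)] = Plev n B.

Definition dyadic n : set R := [set s | exists k : int, s = k%:~R / 2 ^+ n].

Definition dyadics : set R := \bigcup_n dyadic n.

(* For [s], [t] in [dyadic n] the two floors below are exact. *)
Definition DKlevel (w : dyadic_system) n (s t : R) : kern M :=
  \big[@kern_comp R M / kdelta M]_(k < `|Num.floor ((t - s) * 2 ^+ n)|%N)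
    ikern (w n (Num.floor (s * 2 ^+ n) + k%:Z)).

Definition DK (w : dyadic_system) (s t : R) : kern M :=
  if s == t then kdelta M
  else pkern (DKlevel w (least [set n | dyadic n s /\ dyadic n t]) s t).

Definition dyadic_floor n (t : R) : R := (Num.floor (t * 2 ^+ n))%:~R / 2 ^+ n.

Lemma dyadic_floorP n t : [/\ dyadic n (dyadic_floor n t), dyadic_floor n t <= t &
  forall s, dyadic n s -> s <= t -> s <= dyadic_floor n t].
Proof.
have n0 : 0 < 2 ^+ n :> R by rewrite exprn_gt0.
split; first by exists (Num.floor (t * 2 ^+ n)).
  by rewrite ler_pdivrMr// floor_le.
move=> _ [k ->]; rewrite ler_pdivrMr// => kt.
by rewrite ler_pM2r ?invr_gt0// ler_int floor_ge_int.
Qed.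

Definition is_time_modulus (d : PM -> PM -> R)
    (dhat : pmeas (compactify M) R -> pmeas (compactify M) R -> R)
    (L : nat -> set M) (w0 : dyadic_system) (P : probability (omega w0) R)
    (n_ : nat -> nat) :=
  [/\ forall j, (0 < j)%N -> (0 < n_ j)%N,
      forall j, (0 < j)%N -> (n_ j < n_ j.+1)%N &
      forall j (s t u v : R) (mu nu : PM), (0 < j)%N ->
        [/\ dyadics s, dyadics t, dyadics u & dyadics v] ->
        [/\ `|s| <= j%:R, `|t| <= j%:R, `|u| <= j%:R & `|v| <= j%:R] ->
        mu (L j) = 1%E -> nu (L j) = 1%E ->
        s <= t -> u <= v ->
        `|s - u| <= 2 ^- n_ j -> `|t - v| <= 2 ^- n_ j ->
        d mu nu <= 2 ^- n_ j ->
        (P [set w : omega w0 |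
            (2 ^- j <= dhat (embed (kact mu (DK w s t)))
                           (embed (kact nu (DK w u v))))%R]
         <= (2 ^- j)%:E)%E].

Context (n_ : nat -> nat)
  (ellhat : (nat -> pmeas (compactify M) R) -> pmeas (compactify M) R) (x0 : M).

Definition Phi (K : nat -> kern M) : kern M :=
  kern_of (fun x => unembed x0 (ellhat (fun j => embed (pkern (K j) x)))).

Definition flow (w : dyadic_system) (s t : R) : kern M :=
  pkern (Phi (fun j =>
    DK w (dyadic_floor (n_ j.+1) s) (dyadic_floor (n_ j.+1) t))).

End spatial.

(* Main.v *)
Require Import Defs.
From HB Require Import structures.
From mathcomp Require Import all_boot all_order all_algebra.
From mathcomp Require Import all_classical all_reals all_analysis.
From mathcomp Require Import measurable_realfun ring lra.

Set Implicit Arguments.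
Unset Strict Implicit.
Unset Printing Implicit Defensive.

Import Order.TTheory GRing.Theory Num.Theory.
Import numFieldNormedType.Exports.

Local Open Scope classical_set_scope.
Local Open Scope ring_scope.

(** Moments: the law of a random kernel [K] is determined by the expectations of
    the products of the integrals [K f_a (x_a)], [f_a] continuous, compactly supported
    and [0, 1]-valued, because indicators of half-lines are bounded limits of
    polynomials.

    Dyadic times: since [d (K x, K z_m)] is small in probability when [z_m] is close to
    [x], Borel-Cantelli gives [p(K)(x) = K(x)] almost surely, so [p] is a presentation
    of every [nu_t]. Independence and the convolution property then show, by induction
    on the number of factors, that [DK_{s,t}] has law [nu_{t-s}].

    Real times: for fixed [x], Borel-Cantelli and the time modulus make
    [DK_{s_j,t_j}(x)] almost surely Cauchy in the measures on the compactification.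
    The moments of [nu_t] are continuous in [t], hence the limit does not charge
    infinity and has law [nu_{t-s}]. So [DK_{s_j,t_j}(x)] tends to [K_{s,t}(x)] almost
    surely for each [x]; Fubini turns this into convergence for almost all [x] with
    respect to a given measure, almost surely, and dominated convergence concludes. *)

(** * Expectations of bounded random variables *)

(** Two obstacles shape the construction. The sigma-field on kernels sees each point [x] separately,
    so a random kernel measurable for it may fail to be measurable in the pair of parameter and
    point, and neither composition nor Fubini is then available. Interpolation repairs this: a
    kernel rebuilt from countably many values is jointly measurable, and every exchange of an almost
    sure statement at fixed [x] with one for almost all [x] goes through such kernels. The second
    obstacle is that the time modulus only controls distances in the compactification, where limit
    points exist by compactness but may lose mass at infinity. Test functions therefore have compact
    support: extended by zero they are continuous on the compactification, so their moments survive
    the limit, and letting them tend to one recovers the mass left on [M]. Equality of two random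
    kernels is only known almost surely at each fixed point, with a null set depending on it. This
    suffices for laws, since a moment involves finitely many points, and for integrals against a
    fixed measure, by Fubini. *)

Section bounded_measurable.
Context d (T : measurableType d) (R : realType).
Implicit Types (f g : T -> R) (P : probability T R).

(** Bounded measurable functions form an algebra and are integrable for every probability measure at
    once, so real-valued expectations can be manipulated without integrability conditions or
    extended reals. *)
Definition bmeas f := measurable_fun [set: T] f /\ exists B : R, forall x, `|f x| <= B.

Lemma bmeas_cst r : bmeas (cst r).
Proof. by split => //; exists `|r|. Qed.

Lemma bmeasD f g : bmeas f -> bmeas g -> bmeas (fun x => f x + g x).
Proof.
move=> [mf [B fB]] [mg [C gC]]; split; first exact: measurable_funD.
by exists (B + C) => x; rewrite (le_trans (ler_normD _ _))// lerD.
Qed.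

Lemma bmeasM f g : bmeas f -> bmeas g -> bmeas (fun x => f x * g x).
Proof.
move=> [mf [B fB]] [mg [C gC]]; split; first exact: measurable_funM.
by exists (B * C) => x; rewrite normrM ler_pM.
Qed.

Lemma bmeasZ r f : bmeas f -> bmeas (fun x => r * f x).
Proof. by move=> bf; apply: bmeasM => //; exact: bmeas_cst. Qed.

Lemma bmeasN f : bmeas f -> bmeas (fun x => - f x).
Proof.
move=> bf; rewrite (_ : (fun x => _) = fun x => (-1) * f x); first exact: bmeasZ.
by apply/funext => x; rewrite mulN1r.
Qed.

Lemma bmeasB f g : bmeas f -> bmeas g -> bmeas (fun x => f x - g x).
Proof. by move=> bf bg; apply: bmeasD => //; exact: bmeasN. Qed.

Lemma bmeas_norm f : bmeas f -> bmeas (fun x => `|f x|).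
Proof.
move=> [mf [B fB]]; split; first exact: measurableT_comp.
by exists B => x; rewrite normr_id.
Qed.

Lemma bmeas_prod (J : Type) (s : seq J) (f : J -> T -> R) :
  (forall a, bmeas (f a)) -> bmeas (fun x => \prod_(a <- s) f a x).
Proof.
move=> bf; elim: s => [|a s IH].
  by rewrite (_ : (fun x => _) = cst 1)//; [exact: bmeas_cst|
    apply/funext => x; rewrite big_nil].
rewrite (_ : (fun x => _) = fun x => f a x * \prod_(a <- s) f a x).
  exact: bmeasM.
by apply/funext => x; rewrite big_cons.
Qed.

Lemma bmeas_sum (J : Type) (s : seq J) (f : J -> T -> R) :
  (forall a, bmeas (f a)) -> bmeas (fun x => \sum_(a <- s) f a x).
Proof.
move=> bf; elim: s => [|a s IH].
  by rewrite (_ : (fun x => _) = cst 0)//; [exact: bmeas_cst|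
    apply/funext => x; rewrite big_nil].
rewrite (_ : (fun x => _) = fun x => f a x + \sum_(a <- s) f a x).
  exact: bmeasD.
by apply/funext => x; rewrite big_cons.
Qed.

Lemma bmeas_indic (A : set T) : measurable A -> bmeas (\1_A).
Proof.
move=> mA; split; first exact: measurable_indic.
by exists 1 => x; rewrite indicE; case: (_ \in _); rewrite ?normr0 ?normr1.
Qed.

Lemma bmeas_integrable P f : bmeas f -> P.-integrable setT (EFin \o f).
Proof.
move=> [mf [B fB]]; apply: (@le_integrable _ _ _ _ _ _ _ (EFin \o cst B)) => //.
- exact/measurable_EFinP.
- move=> x _ /=; rewrite lee_fin (le_trans (fB x))// ler_norm//.
- by apply: finite_measure_integrable_cst.
Qed.

Lemma expectE P f : bmeas f -> (\int[P]_x f x)%:E = (\int[P]_x (f x)%:E)%E.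
Proof.
move=> bf; rewrite /Rintegral fineK//.
by apply: integrable_fin_num => //; exact: bmeas_integrable.
Qed.

Lemma expect_cst P r : \int[P]_x r = r.
Proof. by rewrite Rintegral_cst//= probability_setT mulr1. Qed.

Lemma expectD P f g : bmeas f -> bmeas g ->
  \int[P]_x (f x + g x) = \int[P]_x f x + \int[P]_x g x.
Proof. by move=> ? ?; rewrite RintegralD//; exact: bmeas_integrable. Qed.

Lemma expectB P f g : bmeas f -> bmeas g ->
  \int[P]_x (f x - g x) = \int[P]_x f x - \int[P]_x g x.
Proof. by move=> ? ?; rewrite RintegralB//; exact: bmeas_integrable. Qed.

Lemma expectZ P r f : bmeas f -> \int[P]_x (r * f x) = r * \int[P]_x f x.
Proof. by move=> ?; rewrite RintegralZl//; exact: bmeas_integrable. Qed.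

Lemma expect_sum P (J : Type) (s : seq J) (f : J -> T -> R) :
  (forall a, bmeas (f a)) ->
  \int[P]_x (\sum_(a <- s) f a x) = \sum_(a <- s) \int[P]_x f a x.
Proof.
move=> bf; elim: s => [|a s IH].
  rewrite big_nil -[RHS](expect_cst P); apply: eq_Rintegral => x _.
  by rewrite big_nil.
rewrite big_cons -IH -expectD//; last exact: bmeas_sum.
by apply: eq_Rintegral => x _; rewrite big_cons.
Qed.

Lemma expect_le P f g : bmeas f -> bmeas g -> (forall x, f x <= g x) ->
  \int[P]_x f x <= \int[P]_x g x.
Proof. by move=> ? ? ?; apply: le_Rintegral => //; exact: bmeas_integrable. Qed.

Lemma expect_ge0 P f : (forall x, 0 <= f x) -> 0 <= \int[P]_x f x.
Proof. by move=> f0; apply: Rintegral_ge0. Qed.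

Lemma expect_norm P f : bmeas f -> `|\int[P]_x f x| <= \int[P]_x `|f x|.
Proof. by move=> ?; apply: le_normr_Rintegral => //; exact: bmeas_integrable. Qed.

Lemma expect_bound P f B : bmeas f -> (forall x, `|f x| <= B) ->
  `|\int[P]_x f x| <= B.
Proof.
move=> bf fB; rewrite (le_trans (expect_norm _ bf))// -[leRHS](expect_cst P).
by apply: expect_le => //; [exact: bmeas_norm|exact: bmeas_cst].
Qed.

Lemma expect_indic P A : measurable A -> \int[P]_x (\1_A x) = fine (P A).
Proof. by move=> mA; rewrite /Rintegral integral_indic// setIT. Qed.

Lemma fine_prob P A : measurable A -> (fine (P A))%:E = P A.
Proof. by move=> mA; rewrite fineK// fin_num_measure. Qed.

Lemma expect_ae P f g : bmeas f -> bmeas g ->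
  (\forall x \ae P, f x = g x) -> \int[P]_x f x = \int[P]_x g x.
Proof.
move=> [mf _] [mg _] fg; rewrite /Rintegral; congr fine.
apply: ae_eq_integral => //; try exact/measurable_EFinP.
by apply: filterS fg => x -> _.
Qed.

Lemma ae_imp P (A B : set T) : (\forall x \ae P, A x) -> (forall x, A x -> B x) ->
  \forall x \ae P, B x.
Proof. by move=> PA AB; exact: filterS PA. Qed.

Lemma expect_cvg P (f_ : nat -> T -> R) f B :
  (forall n, measurable_fun setT (f_ n)) -> measurable_fun setT f ->
  (forall n x, `|f_ n x| <= B) ->
  (\forall x \ae P, f_ n x @[n --> \oo] --> f x) ->
  \int[P]_x f_ n x @[n --> \oo] --> \int[P]_x f x.
Proof.
move=> mf_ mf fB ff.
have [|||||fi _ h] := @dominated_convergence _ T R P setT measurableT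
  (fun n => EFin \o f_ n) (EFin \o f) (EFin \o cst B).
- by move=> n; exact/measurable_EFinP.
- exact/measurable_EFinP.
- by apply: filterS ff => x fx _; apply/fine_cvgP; split => //; exact: nearW.
- exact: finite_measure_integrable_cst.
- by apply: aeW => x n _ /=; rewrite lee_fin.
by apply: fine_cvg; rewrite fineK//; exact: integrable_fin_num.
Qed.

End bounded_measurable.

Lemma bmeas_comp d1 d2 (T1 : measurableType d1) (T2 : measurableType d2)
    (R : realType) (f : T2 -> R) (g : T1 -> T2) :
  bmeas f -> measurable_fun setT g -> bmeas (f \o g).
Proof.
move=> [mf [B fB]] mg; split; first exact: measurableT_comp.
by exists B => x /=.
Qed.

(** * Random probability measures and their mixtures *)

Section random_measure.
Context d d' (T : measurableType d) (Y : measurableType d') (R : realType).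
Variables (k : T -> probability Y R).
Local Open Scope ereal_scope.

Definition measurable_family :=
  forall U, measurable U -> measurable_fun setT (fun t => k t U).

(** An alias of [k] indexed by the proof of measurability, so that the kernel structure can be
    attached to it. *)
Definition rm_kernel (_ : measurable_family) (t : T) : {measure set Y -> \bar R} :=
  k t.

Hypothesis mk : measurable_family.

HB.instance Definition _ := isKernel.Build _ _ T Y R (rm_kernel mk) mk.

Let rm_kernelT t : rm_kernel mk t setT = 1.
Proof. exact: probability_setT. Qed.

HB.instance Definition _ :=
  Kernel_isProbability.Build _ _ T Y R (rm_kernel mk) rm_kernelT.

Lemma rm_measurable_integral (f : T * Y -> \bar R) : (forall z, 0 <= f z) ->
  measurable_fun setT f -> measurable_fun setT (fun t => \int[k t]_y f (t, y)).
Proof.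
by move=> f0 mf; exact: (@measurable_fun_integral_finite_kernel _ _ T Y R f (rm_kernel mk)).
Qed.

(** Parametrised integrals are measurable for nonnegative integrands; adding the bound [B] of [f]
    and subtracting it afterwards reduces the signed case to that one. *)
Lemma rm_bmeas (f : T * Y -> R) : bmeas f ->
  bmeas (fun t => (\int[k t]_y f (t, y))%R).
Proof.
move=> bf; have [mf [B fB]] := bf.
have bft t : bmeas (fun y => f (t, y)).
  split; last by exists B => y.
  exact: measurableT_comp mf (pair1_measurable t).
split; last by exists B => t; apply: expect_bound.
pose g z : R := (f z + B)%R.
have g0 z : (0 <= (g z)%:E).
  by rewrite lee_fin /g -lerBlDr sub0r; have := fB z; rewrite ler_norml => /andP[].
have bg t : bmeas (fun y => g (t, y)).
  by apply: bmeasD => //; exact: bmeas_cst.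
rewrite (_ : (fun t => _) = (fun t => fine (\int[k t]_y (g (t, y))%:E) - B)%R).
  apply: measurable_funB => //; apply: measurableT_comp => //.
  apply: (@rm_measurable_integral (EFin \o g)) => //.
  by apply/measurable_EFinP; apply: measurable_funD.
apply/funext => t; rewrite -expectE//= /g expectD//; last exact: bmeas_cst.
by rewrite expect_cst addrK.
Qed.

Section mixture.
Variable (P : probability T R).

(** The law of a point drawn from [k t], with [t] itself drawn from [P]. *)
Definition mixture (A : set Y) := \int[P]_t k t A.

Let mixture0 : mixture set0 = 0.
Proof. by rewrite /mixture integral0_eq. Qed.

Let mixture_ge0 A : 0 <= mixture A.
Proof. exact: integral_ge0. Qed.

Let mixture_sigma_additive : semi_sigma_additive mixture.
Proof.
move=> U mU tU mUU; rewrite [X in _ --> X](_ : _ =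
  \int[P]_t (\sum_(n <oo) k t (U n))); last first.
  apply: eq_integral => V _.
  by apply/esym/cvg_lim => //; exact/measure_semi_sigma_additive.
apply/cvg_closeP; split.
  by apply: is_cvg_nneseries => n _ _; exact: integral_ge0.
by rewrite closeE// integral_nneseries// => n; exact: mk.
Qed.

HB.instance Definition _ := isMeasure.Build _ _ _ mixture
  mixture0 mixture_ge0 mixture_sigma_additive.

Let mixtureT : mixture setT = 1.
Proof.
rewrite /mixture; under eq_integral do rewrite probability_setT.
by rewrite integral_cst//= probability_setT mule1.
Qed.

HB.instance Definition _ := Measure_isProbability.Build _ _ _ mixture mixtureT.

Definition mixture_prob : probability Y R := mixture.

End mixture.

End random_measure.

Section random_measure_integral.
Context d d' (T : measurableType d) (Y : measurableType d') (R : realType).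
Variables (k : T -> probability Y R).
Hypothesis mk : measurable_family k.
Variable (P : probability T R).

(** The mixture is the composition of the constant kernel [P] on the one-point space with [k], so
    the integral formula for composed kernels applies. *)
Lemma ge0_integral_mixture (f : Y -> \bar R) : (forall y, 0 <= f y)%E ->
  measurable_fun setT f ->
  (\int[mixture_prob mk P]_y f y = \int[P]_t \int[k t]_y f y)%E.
Proof.
move=> f0 mf.
have mcst : measurable_family (fun _ : unit => P).
  by move=> U _; exact: measurable_cst.
have mk2 : measurable_family (fun z : unit * T => k z.2).
  by move=> U mU; exact: measurableT_comp (mk mU) measurable_snd.
have := (@integral_kcomp _ _ _ unit T Y R (rm_kernel mcst) (rm_kernel mk2) tt f f0 mf).
exact.
Qed.

Lemma expect_mixture (f : Y -> R) : bmeas f ->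
  \int[mixture_prob mk P]_y f y = \int[P]_t \int[k t]_y f y.
Proof.
move=> bf; have [mf [B fB]] := bf.
have bk : bmeas (fun t => \int[k t]_y f y).
  by apply: (rm_bmeas mk (f := f \o snd)); apply: bmeas_comp.
pose g y : R := f y + B.
have g0 y : 0 <= g y.
  by rewrite /g -lerBlDr sub0r; have := fB y; rewrite ler_norml => /andP[].
have bg : bmeas g by apply: bmeasD => //; exact: bmeas_cst.
have bgk : bmeas (fun t => \int[k t]_y g y).
  by apply: (rm_bmeas mk (f := g \o snd)); apply: bmeas_comp.
have : \int[mixture_prob mk P]_y g y = \int[P]_t \int[k t]_y g y.
  apply: EFin_inj; rewrite !expectE// ge0_integral_mixture//.
  - by apply: eq_integral => t _; rewrite expectE.
  - by apply/measurable_EFinP; exact: bg.1.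
rewrite /g expectD//; last exact: bmeas_cst.
under [X in _ = X -> _]eq_Rintegral => t _ do
  (rewrite expectD ?expect_cst//; last exact: bmeas_cst).
by rewrite expectD ?expect_cst//; [exact: addIr|exact: bmeas_cst].
Qed.

End random_measure_integral.

(** * Fubini for expectations and uniqueness of probability measures *)

Section product_expectation.
Context d1 d2 (T1 : measurableType d1) (T2 : measurableType d2) (R : realType).
Variables (P1 : probability T1 R) (P2 : probability T2 R).

Lemma product_expectation (f : T1 * T2 -> R) : bmeas f ->
  \int[(P1 \x P2)%E]_z f z = \int[P1]_x \int[P2]_y f (x, y).
Proof.
move=> bf; rewrite [LHS]/Rintegral [RHS]/Rintegral; congr fine.
rewrite -(@integral12_prod_meas1 _ _ _ _ _ P1 P2 (EFin \o f)).
  apply: eq_integral => x _; rewrite expectE//.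
  exact: bmeas_comp bf (pair1_measurable x).
exact: (@bmeas_integrable _ _ _ (P1 \x P2)%E).
Qed.

Lemma expectation_swap (f : T1 * T2 -> R) : bmeas f ->
  \int[P1]_x \int[P2]_y f (x, y) = \int[P2]_y \int[P1]_x f (x, y).
Proof.
move=> bf; rewrite -product_expectation//.
rewrite [LHS]/Rintegral [RHS]/Rintegral; congr fine.
rewrite -(@integral21_prod_meas1 _ _ _ _ _ P1 P2 (EFin \o f)).
  apply: eq_integral => x _; rewrite expectE//.
  exact: bmeas_comp bf (pair2_measurable x).
exact: (@bmeas_integrable _ _ _ (P1 \x P2)%E).
Qed.

End product_expectation.

Lemma probability_unique d (T : measurableType d) (R : realType)
    (G : set (set T)) (P Q : probability T R) :
  measurable = <<s G >> -> setI_closed G ->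
  (forall A, G A -> P A = Q A) -> forall A, measurable A -> P A = Q A.
Proof.
move=> GE GI PQ A; rewrite GE.
apply: (dynkin_induction GE GI (P := [set A | P A = Q A])).
- by rewrite /= !probability_setT.
- exact: PQ.
- by move=> S mS /= PS; rewrite !probability_setC// PS.
move=> F mF tF /= PF.
have h1 := @measure_semi_sigma_additive _ _ _ P F mF tF (bigcup_measurable (fun k _ => mF k)).
have h2 := @measure_semi_sigma_additive _ _ _ Q F mF tF (bigcup_measurable (fun k _ => mF k)).
apply: (cvg_unique (@ereal_hausdorff R) h1).
rewrite [X in X @ _](_ : _ = (fun n => (\sum_(0 <= i < n) Q (F i))%E)); first exact: h2.
by apply/funext => n; apply: eq_bigr => i _; exact: PF.
Qed.

(** * Polynomial approximation of indicators of half-lines *)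

(** With [c = - ln z], the bound [(c n)^2 / 2 <= exp (c n)] gives [n z^n <= 2 / (c^2 n)]. *)
Lemma cvg_nX_expr (R : realType) (z : R) : 0 <= z -> z < 1 ->
  n%:R * z ^+ n @[n --> \oo] --> (0 : R).
Proof.
move=> z0 z1.
have [->|zn0] := eqVneq z 0.
  apply: cvg_near_cst; near=> n; rewrite expr0n.
  have -> : (n == 0)%N = false by apply/negbTE; rewrite -lt0n; near: n; exact: nbhs_infty_gt.
  by rewrite mulr0.
have {}z0 : 0 < z by rewrite lt_neqAle eq_sym zn0.
pose c := - ln z.
have c0 : 0 < c by rewrite oppr_gt0 ln_lt0// z0.
have zE n : z ^+ n = (expR (c * n%:R))^-1.
  by rewrite expRM_natr -exprVn -expRN opprK lnK.
apply: (@squeeze_cvgr _ _ _ _ (cst 0) (fun n => (2 / c ^+ 2) * n%:R^-1)).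
- near=> n.
  have n0 : 0 < n%:R :> R by rewrite ltr0n; near: n; exact: nbhs_infty_gt.
  rewrite mulr_ge0 ?ler0n ?exprn_ge0 ?(ltW z0)//= zE.
  rewrite ler_pdivrMr ?expR_gt0//.
  have /(expR_ge1Dxn 1%N) : 0 <= c * n%:R by rewrite mulr_ge0 ?ltW.
  rewrite (_ : 2`!%:R = 2 :> R)// => h.
  have h2 : (c * n%:R) ^+ 2 / 2 <= expR (c * n%:R) by rewrite (le_trans _ h)// lerDr.
  rewrite (le_trans _ (ler_wpM2l _ h2))//; last first.
    by rewrite mulr_ge0 ?invr_ge0 ?ltW// divr_gt0// exprn_gt0.
  rewrite le_eqVlt; apply/orP; left; apply/eqP; field.
  by rewrite !gt_eqF.
- exact: cvg_cst.
- rewrite -[X in _ --> X](mulr0 (2 / c ^+ 2)); apply: cvgM; first exact: cvg_cst.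
  by rewrite -(cvg_shiftn 1); under eq_fun do rewrite addn1; exact: cvg_harmonic.
Unshelve. all: by end_near. Qed.

Lemma bernoulli_expr (R : realDomainType) (y : R) n : 0 <= y <= 1 ->
  1 - n%:R * y <= (1 - y) ^+ n.
Proof.
move=> /andP[y0 y1]; elim: n => [|n IH]; first by rewrite mul0r subr0 expr0.
rewrite exprS (le_trans _ (ler_wpM2l _ IH)) ?subr_ge0// -natr1.
rewrite -subr_ge0.
rewrite (_ : _ - _ = n%:R * y ^+ 2); last by ring.
by rewrite mulr_ge0// sqr_ge0.
Qed.

(* [u ^+ n] is compared with [2 ^- n]: Bernoulli's inequality handles [u < 1 / 2],
   and at [u = 1 / 2] the limit is [0] thanks to the extra factor [n] in the exponent. *)
Lemma half_step_cvg (R : realType) (u : R) : 0 <= u <= 1 ->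
  (1 - u ^+ n) ^+ (2 ^ n * n) @[n --> \oo] --> ((u < 1 / 2)%R%:R : R).
Proof.
move=> /andP[u0 u1].
have un n : 0 <= u ^+ n <= 1 by rewrite exprn_ge0//= exprn_ile1.
have [u2|u2] := ltP u (1 / 2).
  apply: (@squeeze_cvgr _ _ _ _ (fun n => 1 - n%:R * (2 * u) ^+ n) (cst 1)).
  - near=> n; apply/andP; split.
      rewrite (le_trans _ (bernoulli_expr _ (un n)))//.
      by rewrite exprMn natrM natrX; lra.
    by have /andP[? ?] := un n; rewrite exprn_ile1 ?subr_ge0// lerBlDr lerDl.
  - rewrite -[X in _ --> X]subr0; apply: cvgB; first exact: cvg_cst.
    by apply: cvg_nX_expr; [rewrite mulr_ge0|lra].
  - exact: cvg_cst.
apply: (@squeeze_cvgr _ _ _ _ (cst 0) (fun n => expR (1 *- n))).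
- near=> n; have /andP[? ?] := un n; rewrite exprn_ge0 ?subr_ge0//=.
  rewrite (@le_trans _ _ (expR (- u ^+ n) ^+ (2 ^ n * n)))//.
    by rewrite lerXn2r ?nnegrE ?subr_ge0 ?expR_ge0// expR_ge1Dx.
  rewrite -expRM_natr ler_expR mulNr lerN2 natrM mulrA natrX -exprMn.
  rewrite -[leLHS]mul1r ler_wpM2r// exprn_ege1//; lra.
- exact: cvg_cst.
- exact: cvgn_expR.
Unshelve. all: by end_near. Qed.

Lemma polynomial_step (R : realType) (b C : R) : 0 <= C ->
  exists p_ : nat -> {poly R},
    (forall n x, `|x| <= C -> `|(p_ n).[x]| <= 1) /\
    forall x, `|x| <= C -> (p_ n).[x] @[n --> \oo] --> ((x < b)%R%:R : R).
Proof.
move=> C0.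
(* The affine map [u x = al * (x - m)] sends [m] to [0] and [b] to [1 / 2]. The point [m] lies so
   far to the left that [[-C, C]] is contained in [[m, 2 * b - m]], where [u] takes values in
   [[0, 1]]. *)
pose m := - (2 * `|b| + C + 1); pose al := (2 * (b - m))^-1.
have bm : 0 < b - m.
  by rewrite /m; have := ler_norm (- b); have := normr_ge0 b; rewrite normrN; lra.
have al0 : 0 < al by rewrite invr_gt0 mulr_gt0.
pose u x := al * (x - m).
have u01 x : `|x| <= C -> 0 <= u x <= 1.
  rewrite ler_norml => /andP[x1 x2]; apply/andP; split.
    by apply: mulr_ge0; [exact: ltW|rewrite /m; have := normr_ge0 b; lra].
  rewrite /u mulrC ler_pdivrMr ?mulr_gt0// mul1r /m.
  by have := ler_norm b; have := ler_norm (- b); rewrite normrN; lra.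
exists (fun n => (1 - (al *: ('X - m%:P)) ^+ n) ^+ (2 ^ n * n)).
have pE n x : ((1 - (al *: ('X - m%:P)) ^+ n) ^+ (2 ^ n * n)).[x] =
    (1 - u x ^+ n) ^+ (2 ^ n * n).
  by rewrite horner_exp !hornerE.
split.
  move=> n x /u01/andP[u0 u1]; rewrite pE.
  have un : 0 <= u x ^+ n <= 1 by rewrite exprn_ge0//= exprn_ile1.
  have /andP[? ?] := un.
  by rewrite ger0_norm ?exprn_ge0 ?subr_ge0// exprn_ile1 ?subr_ge0// lerBlDr lerDl.
move=> x /u01 ux; under eq_fun do rewrite pE.
suff -> : (x < b) = (u x < 1 / 2) by exact: half_step_cvg.
rewrite /u mulrC /al ltr_pdivrMr ?mulr_gt0//; apply/idP/idP; lra.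
Qed.

(** * Laws determined by moments *)

Section moments.
Context d1 d2 (T1 : measurableType d1) (T2 : measurableType d2) (R : realType).
Variables (P : probability T1 R) (Q : probability T2 R) (A : Type).
Variables (X : A -> T1 -> R) (Y : A -> T2 -> R).
Hypotheses (bX : forall a, bmeas (X a)) (bY : forall a, bmeas (Y a)).
Hypothesis XY : forall s : seq A,
  \int[P]_x \prod_(a <- s) X a x = \int[Q]_y \prod_(a <- s) Y a y.

(** The factors [g] and [h] are tested against all products of the coordinates. In this form the
    relation is stable under multiplication by a coordinate, linear combinations and bounded limits,
    so it spreads from the constant [1] to products of indicators. *)
Definition moment_equal (g : T1 -> R) (h : T2 -> R) :=
  [/\ bmeas g, bmeas h & forall s : seq A,
    \int[P]_x (g x * \prod_(a <- s) X a x) = \int[Q]_y (h y * \prod_(a <- s) Y a y)].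

Lemma moment_equal1 : moment_equal (cst 1) (cst 1).
Proof.
split; try exact: bmeas_cst.
by move=> s; under eq_Rintegral do rewrite mul1r; rewrite XY;
  apply: eq_Rintegral => y _; rewrite mul1r.
Qed.

Lemma moment_equalM g h a : moment_equal g h ->
  moment_equal (fun x => g x * X a x) (fun y => h y * Y a y).
Proof.
move=> [bg bh gh]; split; try exact: bmeasM.
move=> s; have := gh (a :: s).
under eq_Rintegral do rewrite big_cons mulrA.
by under [in RHS]eq_Rintegral do rewrite big_cons mulrA.
Qed.

Lemma moment_equalD g1 h1 g2 h2 : moment_equal g1 h1 -> moment_equal g2 h2 ->
  moment_equal (fun x => g1 x + g2 x) (fun y => h1 y + h2 y).
Proof.
move=> [bg1 bh1 gh1] [bg2 bh2 gh2]; split; try exact: bmeasD.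
move=> s; under eq_Rintegral do rewrite mulrDl.
under [in RHS]eq_Rintegral do rewrite mulrDl.
by rewrite !expectD ?gh1 ?gh2//; apply: bmeasM => //; exact: bmeas_prod.
Qed.

Lemma moment_equalZ r g h : moment_equal g h ->
  moment_equal (fun x => r * g x) (fun y => r * h y).
Proof.
move=> [bg bh gh]; split; try exact: bmeasZ.
move=> s; under eq_Rintegral do rewrite -mulrA.
under [in RHS]eq_Rintegral do rewrite -mulrA.
by rewrite !expectZ ?gh//; apply: bmeasM => //; exact: bmeas_prod.
Qed.

Lemma moment_equal_horner g h a (p : {poly R}) : moment_equal g h ->
  moment_equal (fun x => p.[X a x] * g x) (fun y => p.[Y a y] * h y).
Proof.
move=> gh; elim/poly_ind: p => [|p c IH].
  have := moment_equalZ 0 gh; congr moment_equal;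
    by apply/funext => x; rewrite horner0.
have := moment_equalD (moment_equalM a IH) (moment_equalZ c gh).
congr moment_equal; apply/funext => x; rewrite hornerMXaddC; ring.
Qed.

Lemma moment_equal_lim (g_ : nat -> T1 -> R) (h_ : nat -> T2 -> R) g h B :
  (forall n, moment_equal (g_ n) (h_ n)) ->
  (forall n x, `|g_ n x| <= B) -> (forall n y, `|h_ n y| <= B) ->
  (forall x, g_ n x @[n --> \oo] --> g x) ->
  (forall y, h_ n y @[n --> \oo] --> h y) ->
  moment_equal g h.
Proof.
move=> gh gB hB gg hh.
have bg : bmeas g.
  split; first by apply: (measurable_fun_cvg (h := g_)) => // n; case: (gh n) => -[].
  exists B => x; apply: (ler_cvg_to (cvg_norm (gg x)) (cvg_cst B)).
  by apply: nearW => n; exact: gB.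
have bh : bmeas h.
  split; first by apply: (measurable_fun_cvg (h := h_)) => // n; case: (gh n) => _ [].
  exists B => x; apply: (ler_cvg_to (cvg_norm (hh x)) (cvg_cst B)).
  by apply: nearW => n; exact: hB.
split=> // s.
have [mPX [CX PX]] := bmeas_prod s bX.
have [mPY [CY PY]] := bmeas_prod s bY.
have h1 : \int[P]_x (g_ n x * \prod_(a <- s) X a x) @[n --> \oo] -->
    \int[P]_x (g x * \prod_(a <- s) X a x).
  apply: (expect_cvg (B := B * CX)).
  - by move=> n; have [[? _] _ _] := gh n; exact: measurable_funM.
  - by apply: measurable_funM => //; case: bg.
  - by move=> n x; rewrite normrM ler_pM.
  - by apply: aeW => x; apply: cvgM => //; exact: cvg_cst.
have h2 : \int[Q]_x (h_ n x * \prod_(a <- s) Y a x) @[n --> \oo] -->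
    \int[Q]_x (h x * \prod_(a <- s) Y a x).
  apply: (expect_cvg (B := B * CY)).
  - by move=> n; have [_ [? _] _] := gh n; exact: measurable_funM.
  - by apply: measurable_funM => //; case: bh.
  - by move=> n x; rewrite normrM ler_pM.
  - by apply: aeW => x; apply: cvgM => //; exact: cvg_cst.
apply: (cvg_unique _ h1) => //.
rewrite [X in X @ _](_ : _ = fun n => \int[Q]_x (h_ n x * \prod_(a <- s) Y a x)) //.
by apply/funext => n; have [_ _ ->] := gh n.
Qed.

(** The polynomials of [polynomial_step] are bounded by [1] and converge to the indicator of the
    half-line. They are taken on an interval containing the ranges of both [X a] and [Y a], because
    the same polynomials must serve on the two sides. *)
Lemma moment_equal_lt g h a b : moment_equal g h ->
  moment_equal (fun x => (X a x < b)%R%:R * g x) (fun y => (Y a y < b)%R%:R * h y).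
Proof.
move=> gh; have [[_ [G gG]] [_ [H hH]] _] := gh.
have [_ [CX XC]] := bX a; have [_ [CY YC]] := bY a.
have CX' x : `|X a x| <= Num.max 0 (Num.max CX CY).
  by rewrite !le_max XC/= orbT.
have CY' x : `|Y a x| <= Num.max 0 (Num.max CX CY).
  by rewrite !le_max YC/= !orbT.
have [|p_ [p1 pc]] := @polynomial_step R b (Num.max 0 (Num.max CX CY)).
  by rewrite le_max lexx.
apply: (@moment_equal_lim (fun n x => (p_ n).[X a x] * g x)
  (fun n y => (p_ n).[Y a y] * h y) _ _ (Num.max G H)).
- by move=> n; exact: moment_equal_horner.
- move=> n x; rewrite normrM -[leRHS]mul1r ler_pM//; first exact: p1.
  by rewrite le_max gG.
- move=> n x; rewrite normrM -[leRHS]mul1r ler_pM//; first exact: p1.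
  by rewrite le_max hH orbT.
- by move=> x; apply: cvgM; [exact: pc|exact: cvg_cst].
- by move=> x; apply: cvgM; [exact: pc|exact: cvg_cst].
Qed.

(** The indicator of the event is a product of half-line indicators, attached one at a time to the
    constant [1]; the moment for the empty list then compares the probabilities. *)
Lemma moment_equal_events (s : seq (A * R)) :
  P [set x | all (fun ab => X ab.1 x < ab.2) s] =
  Q [set y | all (fun ab => Y ab.1 y < ab.2) s].
Proof.
have measE d (T : measurableType d) (Z : A -> T -> R) : (forall a, bmeas (Z a)) ->
    measurable [set x | all (fun ab => Z ab.1 x < ab.2) s].
  move=> bZ; elim: s => [|ab s' IH]; first by rewrite (_ : mkset _ = setT)//; apply/seteqP.
  rewrite (_ : mkset _ = (fun x => Z ab.1 x < ab.2) @^-1` [set true] `&`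
      [set x | all (fun ab => Z ab.1 x < ab.2) s']).
    apply: measurableI => //; rewrite -[X in measurable X]setTI.
    by apply: (measurable_fun_ltr (bZ _).1 (measurable_cst _) measurableT).
  by apply/seteqP; split => x /= => [/andP[]|[-> ->]].
have indE T (Z : A -> T -> R) :
    (fun x => (all (fun ab => Z ab.1 x < ab.2) s)%:R : R) =
    \1_[set x | all (fun ab => Z ab.1 x < ab.2) s].
  by apply/funext => x; rewrite indicE; congr (_%:R); congr nat_of_bool; apply/idP/idP; rewrite inE.
have [_ _ H] : moment_equal
    (fun x => (all (fun ab => X ab.1 x < ab.2) s)%:R)
    (fun y => (all (fun ab => Y ab.1 y < ab.2) s)%:R).
  elim: s {measE indE} => [|ab s' IH]; first exact: moment_equal1.
  have := moment_equal_lt ab.1 ab.2 IH; congr moment_equal.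
    by apply/funext => x /=; rewrite -natrM mulnb.
  by apply/funext => x /=; rewrite -natrM mulnb.
have {H} := H [::].
under eq_Rintegral do rewrite big_nil mulr1.
under [in RHS]eq_Rintegral do rewrite big_nil mulr1.
rewrite !indE !expect_indic; try exact: measE.
move=> H; have := congr1 EFin H; rewrite !fine_prob; [by []|exact: measE|exact: measE].
Qed.

End moments.

Lemma indic_mkset (T : Type) (R : pzRingType) (p : T -> bool) x :
  \1_[set x | p x] x = (p x)%:R :> R.
Proof.
by rewrite indicE (_ : (x \in _) = p x)//; apply/idP/idP; rewrite inE.
Qed.

(** * Convergence in initial and product topologies *)

Lemma cvg_initial (S : choiceType) (T : topologicalType) (f : S -> T)
    (F : set_system S) (s : S) :
  Filter F -> f @ F --> f s -> F --> (s : initial_topology f).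
Proof.
move=> FF fs A; rewrite nbhsE => -[B [[C oC <-] Cs] BA].
apply: (@filterS _ F _ _ _ BA).
by apply: (fs C); apply: open_nbhs_nbhs.
Qed.

Lemma cvg_prod_topology (J : Type) (T : J -> topologicalType)
    (F : set_system (forall j, T j)) (x : forall j, T j) :
  Filter F -> (forall j, (fun y => y j) @ F --> x j) ->
  F --> (x : prod_topology T).
Proof.
move=> FF Fx; apply/cvg_sup => j.
exact: (@cvg_initial (forall j, T j : choiceType) (T j) (fun y => y j)).
Qed.

Lemma coord_continuous (J : Type) (T : J -> topologicalType) (j : J) :
  continuous (fun y : prod_topology T => y j).
Proof.
move=> y; have /cvg_sup/(_ j) h : (y : prod_topology T) --> (y : prod_topology T).
  exact: cvg_id.
apply: cvg_trans.
  exact: cvg_fmap2 h.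
exact: (@initial_continuous _ _ (fun y : forall j, T j => y j)).
Qed.

(** * Weak convergence and Borel structure *)

Section pmeas_topology.
Context (X : ptopologicalType) (R : realType).
Implicit Types (mu : pmeas X R) (f : X -> R).

Lemma pmeas_cvg (F : set_system (pmeas X R)) mu : Filter F ->
  (forall f, bcontinuous f ->
    (fun nu : pmeas X R => \int[nu]_x f x) @ F --> \int[mu]_x f x) ->
  F --> mu.
Proof.
move=> FF h; apply: (@cvg_initial _ _ (@weak_eval X R)).
apply: cvg_prod_topology => f.
exact: (h _ (set_mem (valP f))).
Qed.

Lemma expect_continuous f : bcontinuous f ->
  continuous (fun mu : pmeas X R => \int[mu]_x f x).
Proof.
move=> bf mu.
have c1 : continuous (@weak_eval X R : pmeas X R -> _).
  exact: (@initial_continuous _ _ (@weak_eval X R)).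
have := @coord_continuous _ (fun _ : set_type (@bcontinuous X R) => R)
  (SigSub (mem_set bf)).
by move=> c2; exact: (cvg_comp _ _ (c1 mu) (c2 _)).
Qed.

Lemma open_borel (U : set X) : open U -> measurable (U : set (borel X)).
Proof. by move=> oU; exact: sub_sigma_algebra. Qed.

Lemma closed_borel (U : set X) : closed U -> measurable (U : set (borel X)).
Proof.
move=> cU; rewrite -[U]setCK; apply: measurableC; apply: open_borel.
exact: closed_openC.
Qed.

Lemma measurable_to_borel d (T : measurableType d) (h : T -> X) :
  (forall U, open U -> measurable (h @^-1` U)) ->
  measurable_fun [set: T] (h : T -> borel X).
Proof.
move=> hU; apply: (@measurability _ _ T (borel X) setT h (@open X)) => //.
by move=> _ [U oU <-]; rewrite setTI; exact: hU.
Qed.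

Lemma continuous_measurable_real f : continuous f ->
  measurable_fun [set: borel X] (f : borel X -> R).
Proof.
move=> cf; apply: (@measurability _ _ (borel X) R setT f (@RGenOInfty.G R)) => //.
  exact: RGenOInfty.measurableE.
move=> _ [_ [r ->] <-]; rewrite setTI; apply: open_borel.
by move/continuousP : cf; apply; exact: interval_open.
Qed.

Lemma bcontinuous_bmeas f : bcontinuous f -> bmeas (f : borel X -> R).
Proof. by move=> [cf [B fB]]; split; [exact: continuous_measurable_real|exists B]. Qed.

End pmeas_topology.

Lemma measurable_from_borel (X Y : ptopologicalType) (h : X -> Y) :
  continuous h -> measurable_fun [set: borel X] (h : borel X -> borel Y).
Proof.
move=> ch; apply: measurable_to_borel => U oU; apply: open_borel.
by move/continuousP : ch; apply.
Qed.

Section layer_cake.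
Context (X : ptopologicalType) (R : realType).

(** Discrete layer-cake formula: the number of grid points [k * del] below [y] is [y / del] rounded
    up. *)
Lemma layer_count (N : nat) (del y : R) : 0 < del -> 0 <= y -> y <= N%:R * del ->
  y <= del * \sum_(k < N) (k%:R * del < y)%R%:R <= y + del.
Proof.
move=> d0 y0; elim: N => [|N IH].
  rewrite mul0r big_ord0 mulr0 => y0'; apply/andP; split => //.
  by rewrite addr_ge0// ltW.
move=> yN; rewrite big_ord_recr/=; have [Ny|Ny] := ltP (N%:R * del) y.
  have -> : \sum_(k < N) (k%:R * del < y)%R%:R = N%:R :> R.
    rewrite (eq_bigr (fun=> 1)) ?sumr_const ?card_ord// => i _.
    have -> // : i%:R * del < y.
    by rewrite (le_lt_trans _ Ny)// ler_pM2r// ler_nat ltnW.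
  rewrite natr1 mulrC yN/= -natr1 mulrDl mul1r lerD2r ltW//.
by rewrite addr0; exact: IH.
Qed.

(** The layer-cake sum over the open superlevel sets [U k] transfers lower semicontinuity from open
    sets to functions. Replacing the integral against [nu] by this sum costs at most [del], and the
    [N] errors [1 / (N + 1)] cost together at most another [del]; the gap [4 * del] absorbs both. *)
Lemma pmeas_lsc (F : set_system (pmeas X R)) (mu : pmeas X R) (f : X -> R) (B c : R) :
  Filter F -> continuous f -> (forall x, 0 <= f x <= B) ->
  (forall U (e : R), open U -> 0 < e ->
     F [set nu : pmeas X R | fine (mu U) - e < fine (nu U)]) ->
  c < \int[mu]_x f x -> F [set nu : pmeas X R | c < \int[nu]_x f x].
Proof.
move=> FF cf fB FU cmu.
have bf : bmeas (f : borel X -> R).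
  apply: bcontinuous_bmeas; split => //; exists B => x.
  by have /andP[? ?] := fB x; rewrite ger0_norm.
pose del := (\int[mu]_x f x - c) / 4.
have d0 : 0 < del by rewrite divr_gt0// subr_gt0.
have B0 : 0 <= B by have /andP[/le_trans h /h] := fB point.
have [N NB] : exists N : nat, B <= N%:R * del.
  exists (Num.truncn (B / del)).+1; rewrite -ler_pdivrMr//.
  by apply/ltW/truncnS_gt.
pose U k := [set x : X | k%:R * del < f x].
have oU k : open (U k).
  by have /continuousP := cf => /(_ _ (@open_gt R (k%:R * del))).
have bU k : bmeas (fun x : borel X => (k%:R * del < f x)%R%:R : R).
  rewrite (_ : (fun x => _) = \1_(U k)); first by apply: bmeas_indic; apply: open_borel; exact: (oU k).
  by apply/funext => x; rewrite indic_mkset.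
have iU (nu : pmeas X R) k : \int[nu]_x (k%:R * del < f x)%R%:R = fine (nu (U k)).
  rewrite -expect_indic; last exact: open_borel.
  by apply: eq_Rintegral => x _; rewrite indic_mkset.
have lay (nu : pmeas X R) :
    \int[nu]_x f x <= del * \sum_(k < N) fine (nu (U k)) <= \int[nu]_x f x + del.
  have bS : bmeas (fun x : borel X => del * \sum_(k < N) ((k%:R * del < f x)%R%:R : R)).
    by apply: bmeasZ; apply: bmeas_sum => k; exact: bU.
  have -> : del * \sum_(k < N) fine (nu (U k)) =
      \int[nu]_x (del * \sum_(k < N) (k%:R * del < f x)%R%:R).
    rewrite expectZ; last by apply: bmeas_sum => k; exact: bU.
    rewrite expect_sum; last by move=> k; exact: bU.
    by congr (_ * _); apply: eq_bigr => k _; rewrite iU.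
  have h x : f x <= del * \sum_(k < N) (k%:R * del < f x)%R%:R <= f x + del.
    by have /andP[f0 f1] := fB x; apply: layer_count => //; exact: le_trans NB.
  apply/andP; split; first by apply: expect_le => // x; have /andP[] := h x.
  rewrite -[X in _ + X](expect_cst nu) -expectD//; last exact: bmeas_cst.
  apply: expect_le => // [|x]; last by have /andP[] := h x.
  by apply: bmeasD => //; exact: bmeas_cst.
have e0 : 0 < (N%:R + 1 : R)^-1 by rewrite invr_gt0 ltr_wpDl.
have : F [set nu : pmeas X R | forall k : 'I_N, fine (mu (U k)) - (N%:R + 1)^-1 < fine (nu (U k))].
  by apply: filter_forall => k; exact: FU.
apply: filterS => nu /= hnu.
have /andP[m1 _] := lay mu; have /andP[_ n2] := lay nu.
have : del * \sum_(k < N) fine (mu (U k)) <= del * \sum_(k < N) fine (nu (U k)) + del.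
  rewrite -[X in _ + X]mulr1 -mulrDr ler_pM2l//.
  rewrite (@le_trans _ _ (\sum_(k < N) (fine (nu (U k)) + (N%:R + 1)^-1)))//.
    by apply: ler_sum => k _; rewrite -lerBlDr ltW.
  rewrite big_split/= lerD2l sumr_const card_ord -[_ *+ N]mulr_natl ler_pdivrMr ?mul1r ?lerDl//.
move: m1 n2; set S := del * _; set S' := del * _ => m1 n2 h.
have muE : \int[mu]_x f x = c + 4 * del by rewrite /del mulrC divfK// subrKC.
rewrite {}muE in m1; move: m1 n2 h {lay hnu iU bU}; clearbody S S'; move=> m1 n2 h.
by have := le_trans m1 h; lra.
Qed.

(** The condition on open sets makes integrals of nonnegative bounded continuous functions lower
    semicontinuous; applied to [f + B] and to [B - f] this bounds the integral of [f] from both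
    sides. *)
Lemma portmanteau (F : set_system (pmeas X R)) (mu : pmeas X R) : Filter F ->
  (forall U (e : R), open U -> 0 < e ->
     F [set nu : pmeas X R | fine (mu U) - e < fine (nu U)]) ->
  F --> mu.
Proof.
move=> FF FU; apply: pmeas_cvg => f bf; have [cf [B fB]] := bf.
have bmf := bcontinuous_bmeas bf.
have fB1 x : 0 <= f x + B <= B + B.
  by have := fB x; rewrite ler_norml => /andP[? ?]; apply/andP; split; lra.
have fB2 x : 0 <= B - f x <= B + B.
  by have := fB x; rewrite ler_norml => /andP[? ?]; apply/andP; split; lra.
have c1 : continuous (fun x => f x + B) by move=> x; apply: cvgD => //; [exact: cf|exact: cvg_cst].
have c2 : continuous (fun x => B - f x) by move=> x; apply: cvgB => //; [exact: cvg_cst|exact: cf].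
have i1 (nu : pmeas X R) : \int[nu]_x (f x + B) = \int[nu]_x f x + B.
  by rewrite expectD ?expect_cst//; exact: bmeas_cst.
have i2 (nu : pmeas X R) : \int[nu]_x (B - f x) = B - \int[nu]_x f x.
  by rewrite expectB ?expect_cst//; exact: bmeas_cst.
apply/cvgrPdist_lt => e e0.
have h1 : F [set nu : pmeas X R | \int[mu]_x f x + B - e < \int[nu]_x (f x + B)].
  by apply: (pmeas_lsc FF c1 fB1 FU); rewrite i1 ltrBlDr ltrDl.
have h2 : F [set nu : pmeas X R | B - \int[mu]_x f x - e < \int[nu]_x (B - f x)].
  by apply: (pmeas_lsc FF c2 fB2 FU); rewrite i2 ltrBlDr ltrDl.
apply: filterS2 h1 h2 => nu /=; rewrite i1 i2 => h1 h2.
by rewrite ltr_norml; apply/andP; split; lra.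
Qed.

End layer_cake.

Section countable_base.
Context (X : topologicalType) (K : countType).

Definition countable_base (B : K -> set X) := (forall k, open (B k)) /\
  forall x A, nbhs x A -> exists2 k, B k x & B k `<=` A.

Lemma countable_base_open (B : K -> set X) (U : set X) : countable_base B -> open U ->
  U = \bigcup_k (if `[< B k `<=` U >] then B k else set0).
Proof.
move=> [_ hB] oU; apply/seteqP; split=> [x Ux|x [k _]]; last first.
  by case: asboolP => // h /h.
have [k Bkx BkU] : exists2 k, B k x & B k `<=` U by apply: hB; exact: open_nbhs_nbhs.
by exists k => //; rewrite asboolT.
Qed.

Lemma countType_bigcup_measurable d (T : measurableType d) (F : K -> set T) :
  (forall k, measurable (F k)) -> measurable (\bigcup_k F k).
Proof. by move=> mF; apply: countable_bigcupT_measurable => //; exact: countableP. Qed.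

End countable_base.

(** * Compactly supported test functions and the Borel structure of the weak topology *)

Section metric_tests.
Context (R : realType) (M : pmetricType R).
Implicit Types (f : M -> R) (x y : M) (U : set M).

Lemma nbhs_mdist_lt x e : 0 < e -> nbhs x [set y | mdist x y < e].
Proof. by move=> e0; rewrite -ballEmdist; exact: nbhsx_ballx. Qed.

Lemma lipschitz_continuous_real (k : R) f :
  (forall x y, f x - f y <= k * mdist x y) -> continuous f.
Proof.
move=> fk x; apply/cvgrPdist_lt => e e0.
have k1 : 0 < `|k| + 1 by rewrite ltr_wpDl.
have : nbhs x [set y | mdist x y < e / (`|k| + 1)] by apply: nbhs_mdist_lt; rewrite divr_gt0.
apply: filterS => y /=; rewrite ltr_pdivlMr// => xy.
have := fk x y; have := fk y x; rewrite (metric_sym y x) => h1 h2.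
have h3 : k * mdist x y <= `|k| * mdist x y by rewrite ler_wpM2r ?mdist_ge0// ler_norm.
have := mdist_ge0 x y; rewrite ltr_norml => h4; apply/andP; split; nra.
Qed.

Definition clamp (r : R) : R := Num.max 0 (Num.min 1 r).

Lemma clamp_itv r : 0 <= clamp r <= 1.
Proof. by rewrite /clamp le_max lexx/= ge_max ler01 ge_min lexx. Qed.

Lemma clamp_le0 r : r <= 0 -> clamp r = 0.
Proof. by move=> r0; rewrite /clamp; apply/max_idPl; rewrite ge_min r0 orbT. Qed.

Lemma clamp_ge1 r : 1 <= r -> clamp r = 1.
Proof. by move=> r1; rewrite /clamp (min_idPl r1); apply/max_idPr. Qed.

Lemma clamp_sub r s : clamp r - clamp s <= `|r - s|.
Proof.
have h1 : Num.min 1 r <= 1 by rewrite ge_min lexx.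
have h2 : Num.min 1 r <= r by rewrite ge_min lexx orbT.
have h3 : Num.min 1 r - `|r - s| <= Num.min 1 s.
  by rewrite le_min; apply/andP; split; have := ler_norm (r - s); have := normr_ge0 (r - s); lra.
have h4 : Num.min 1 s <= clamp s by rewrite /clamp le_max lexx orbT.
have /andP[h5 _] := clamp_itv s.
rewrite lerBlDr {1}/clamp ge_max; apply/andP; split; first by rewrite addr_ge0.
by rewrite -lerBlDl (le_trans h3).
Qed.

Lemma clamp_lipschitz (k : R) f : 0 <= k ->
  (forall x y, f x - f y <= k * mdist x y) -> continuous (clamp \o f).
Proof.
move=> k0 fk; apply: (@lipschitz_continuous_real k) => x y /=.
rewrite (le_trans (clamp_sub _ _))// ler_norml fk andbT lerNl opprB.
by rewrite metric_sym fk.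
Qed.

(** The distance to the complement of [U] cut off at [1]; as a supremum of radii it also makes sense
    for [U = setT]. *)
Definition radius U x : R := sup [set r | 0 <= r <= 1 /\ ball x r `<=` U].

Let radius_ubound U x : has_ubound [set r : R | 0 <= r <= 1 /\ ball x r `<=` U].
Proof. by exists 1 => r /= [/andP[]]. Qed.

Lemma radius_sub U x y : radius U x - radius U y <= 1 * mdist x y.
Proof.
rewrite mul1r lerBlDr; apply: ge_sup.
  exists 0; split; first by rewrite lexx ler01.
  by move=> z; rewrite ballEmdist/= ltNge mdist_ge0.
move=> r /= [/andP[r0 r1] rU]; rewrite -lerBlDl.
have [h|h] := leP (r - mdist x y) 0.
  apply: (le_trans h); apply: ub_le_sup => //; split; first by rewrite lexx ler01.
  by move=> z; rewrite ballEmdist/= ltNge mdist_ge0.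
apply: ub_le_sup => //; split.
  by rewrite (ltW h)/= (le_trans _ r1)// gerBl mdist_ge0.
move=> z; rewrite ballEmdist/= ltrBrDl => yz; apply: rU; rewrite ballEmdist/=.
by rewrite (le_lt_trans _ yz)// metric_triangle.
Qed.

Lemma radius0 U x : ~ U x -> radius U x <= 0.
Proof.
move=> Ux; apply: ge_sup.
  exists 0; split; first by rewrite lexx ler01.
  by move=> z; rewrite ballEmdist/= ltNge mdist_ge0.
move=> r /= [_ rU]; rewrite leNgt; apply/negP => r0; apply: Ux.
by apply: rU; rewrite ballEmdist/= mdistxx.
Qed.

Lemma radius_gt0 U x : open U -> U x -> 0 < radius U x.
Proof.
move=> oU Ux; have /nbhs_ballP[e /= e0 eU] : nbhs x U by exact: open_nbhs_nbhs.
apply: (@lt_le_trans _ _ (Num.min e 1)); first by rewrite lt_min e0 ltr01.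
apply: ub_le_sup => //; split.
  by rewrite le_min (ltW e0) ler01 ge_min lexx orbT.
by apply: subset_trans eU; apply: le_ball; rewrite ge_min lexx.
Qed.

(** Compact support makes the extension by [0] to the one-point compactification continuous; values
    in [[0, 1]] allow products of integrals to be compared factor by factor. *)
Definition test_function f := [/\ continuous f, forall x, 0 <= f x <= 1 &
  exists2 C, compact C & forall x, ~ C x -> f x = 0].

Lemma test_bcontinuous f : test_function f -> bcontinuous f.
Proof.
move=> [cf f01 _]; split => //; exists 1 => x.
by have /andP[? ?] := f01 x; rewrite ger0_norm.
Qed.

Lemma test_bmeas f : test_function f -> bmeas (f : borel M -> R).
Proof. by move=> /test_bcontinuous /bcontinuous_bmeas. Qed.

Hypothesis hM : proper_metric M.

(** Approximates the indicator of an open set from below: the first factor vanishes off [U] and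
    tends to [1] on it, the second one cuts off at distance [n] from [point], which gives compact
    support because closed balls are compact. *)
Definition bump U (n : nat) x : R :=
  clamp (n%:R * radius U x) * clamp (n%:R - mdist point x).

Lemma bump_test U n : test_function (bump U n).
Proof.
have c2 : continuous (clamp \o (fun x : M => n%:R - mdist point x)).
  apply: (@clamp_lipschitz 1) => // x y; rewrite mul1r.
  have := metric_triangle point x y; have := metric_triangle point y x.
  by rewrite (metric_sym y x); lra.
split.
- move=> x; apply: cvgM; last exact: c2.
  apply: (@clamp_lipschitz n%:R (fun x => n%:R * radius U x)) => // {}x y.
  by rewrite -mulrBr ler_wpM2l// -[leRHS]mul1r radius_sub.
- move=> x; have /andP[? ?] := clamp_itv (n%:R * radius U x).
  have /andP[? ?] := clamp_itv (n%:R - mdist point x).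
  by rewrite mulr_ge0//= mulr_ile1.
exists [set x : M | mdist point x <= n%:R]; last first.
  move=> x /negP; rewrite -ltNge => h; rewrite /bump [X in _ * X]clamp_le0 ?mulr0//.
  by rewrite subr_le0 ltW.
have [_ _ hb] := hM.
rewrite -precompact_closed; last first.
  rewrite (_ : mkset _ = (fun x => mdist point x) @^-1` [set r | r <= n%:R])//.
  move: (@closed_le R n%:R); move: [set r | _]; apply/(@continuous_closedP M R).
  apply: (@lipschitz_continuous_real 1) => x y; rewrite mul1r.
  by have := metric_triangle point y x; rewrite (metric_sym y x); lra.
by apply: hb; exists point, n%:R.
Qed.

Lemma bump0 U n x : ~ U x -> bump U n x = 0.
Proof.
by move=> /radius0 r0; rewrite /bump clamp_le0 ?mul0r// mulr_ge0_le0.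
Qed.

Lemma bump_cvg U x : open U -> U x -> bump U n x @[n --> \oo] --> (1 : R).
Proof.
move=> oU Ux; have r0 := radius_gt0 oU Ux.
apply: cvg_near_cst; near=> n; rewrite /bump !clamp_ge1 ?mulr1//.
  rewrite lerBrDl -[_ + 1]/(_ + 1) ltW//.
  by near: n; exact: nbhs_infty_gtr.
rewrite -ler_pdivrMr// div1r ltW//.
by near: n; exact: nbhs_infty_gtr.
Unshelve. all: by end_near. Qed.

Lemma bump_indic_cvg U x : open U -> bump U n x @[n --> \oo] --> (\1_U x : R).
Proof.
move=> oU; rewrite indicE; have [Ux|Ux] := boolP (x \in U).
  by apply: bump_cvg => //; exact: set_mem.
apply: cvg_near_cst; apply: nearW => n; apply: bump0.
by move=> /mem_set; exact/negP.
Qed.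

Lemma bump_le_indic U n x : bump U n x <= \1_U x.
Proof.
rewrite indicE; have [Ux|Ux] := boolP (x \in U).
  by have [_ /(_ x)/andP[]] := bump_test U n.
by rewrite bump0// => /mem_set; exact/negP.
Qed.

Lemma expect_bump_cvg (mu : pmeas M R) U : open U ->
  \int[mu]_x bump U n x @[n --> \oo] --> fine (mu U).
Proof.
move=> oU; rewrite -expect_indic; last exact: open_borel.
apply: (expect_cvg (B := 1)).
- by move=> n; case: (test_bmeas (bump_test U n)).
- by apply: measurable_indic; exact: open_borel.
- move=> n x; have [_ /(_ x)/andP[? ?] _] := bump_test U n; by rewrite ger0_norm.
- by apply: aeW => x; exact: bump_indic_cvg.
Qed.

Lemma expect_bump_le (mu : pmeas M R) U n : open U ->
  \int[mu]_x bump U n x <= fine (mu U).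
Proof.
move=> oU; rewrite -expect_indic; last exact: open_borel.
apply: expect_le; [exact/test_bmeas/bump_test|by apply: bmeas_indic; exact: open_borel|].
exact: bump_le_indic.
Qed.

(** Integrals of bumps stay below the mass of [U] and converge to it. A strict lower bound on this
    mass thus becomes a countable union of conditions on integrals of test functions, which serves
    both openness and measurability. *)
Lemma lt_fine_open (mu : pmeas M R) U c : open U ->
  c < fine (mu U) <-> exists n, c < \int[mu]_x bump U n x.
Proof.
move=> oU; split=> [cmu|[n]]; last first.
  by move=> /lt_le_trans; apply; exact: expect_bump_le.
have /cvgr_gt/(_ c cmu)[n _ h] := expect_bump_cvg (mu := mu) oU.
by exists n; apply: h => /=.
Qed.

Lemma open_lt_fine U c : open U -> open [set mu : pmeas M R | c < fine (mu U)].
Proof.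
move=> oU; rewrite (_ : mkset _ = \bigcup_n [set mu : pmeas M R | c < \int[mu]_x bump U n x]).
  apply: bigcup_open => n _.
  have := @expect_continuous M R _ (test_bcontinuous (bump_test U n)).
  by move=> /continuousP /(_ _ (@open_gt R c)).
apply/seteqP; split => mu /=; first by move=> /(lt_fine_open _ _ oU)[n ?]; exists n.
by move=> [n _ ?]; apply/lt_fine_open => //; exists n.
Qed.

Section pmeas_base.
Context (K : countType) (B : K -> set M).
Hypothesis hB : countable_base B.

Definition base_union (s : seq K) := \bigcup_(k in [set` s]) B k.

Lemma base_union_open s : open (base_union s).
Proof. by apply: bigcup_open => k _; have [] := hB. Qed.

Definition pmeas_base (l : seq (seq K * rat)) : set (pmeas M R) :=
  [set mu | all (fun p => ratr p.2 < fine (mu (base_union p.1))) l].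

(** [U] is the increasing union over [n] of the finite unions of those basic subsets whose code is
    below [n], so continuity of [mu] from below gives the approximation. *)
Lemma base_union_approx (mu : pmeas M R) U c : open U -> c < fine (mu U) ->
  exists2 s, base_union s `<=` U & c < fine (mu (base_union s)).
Proof.
move=> oU cU.
pose s n := [seq k <- pmap unpickle (iota 0 n) | `[< B k `<=` U >]].
have sU n : base_union (s n) `<=` U.
  by move=> x [k] /=; rewrite mem_filter => /andP[/asboolP h _]; exact: h.
have UE : U = \bigcup_n base_union (s n).
  apply/seteqP; split; last by move=> x [n _]; exact: sU.
  move=> x Ux; have [k Bkx BkU] : exists2 k, B k x & B k `<=` U.
    by have [_] := hB; apply; exact: open_nbhs_nbhs.
  exists (pickle k).+1 => //; exists k => //.
  rewrite /mkset /s mem_filter asboolT// andTb mem_pmap.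
  by apply/mapP; exists (pickle k); rewrite ?pickleK// mem_iota add0n leq0n ltnSn.
have : (mu \o (base_union \o s)) @ \oo --> mu U.
  rewrite [in mu U]UE; apply: nondecreasing_cvg_mu.
  - by move=> n; apply: open_borel; exact: base_union_open.
  - by rewrite -UE; exact: open_borel.
  - move=> n m nm; apply/subsetPset => x [k /=]; rewrite mem_filter => /andP[kU].
    rewrite mem_pmap => /mapP[i ii ki] Bkx; exists k => //=; rewrite mem_filter kU/= mem_pmap.
    apply/mapP; exists i => //; move: ii; rewrite !mem_iota/= !add0n => /leq_trans; exact.
rewrite -(fine_prob mu (open_borel oU)) => /fine_cvg/cvgr_gt/(_ c cU)[n _ h].
by exists (s n) => //; apply: h => /=.
Qed.

(* By [portmanteau] the sets [{mu | c < mu U}], with [U] a finite union of basic open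
   sets and [c] rational, form a subbase. *)
Lemma pmeas_countable_base : countable_base pmeas_base.
Proof.
split.
  elim=> [|[s q] l IH].
    by rewrite (_ : pmeas_base _ = setT); [exact: openT|apply/seteqP].
  rewrite (_ : pmeas_base _ = [set mu : pmeas M R | ratr q < fine (mu (base_union s))] `&` pmeas_base l).
    by apply: openI => //; apply: open_lt_fine; exact: base_union_open.
  by apply/seteqP; split => mu; rewrite /pmeas_base /=; [move=> /andP[]|move=> [h1 h2]; apply/andP].
move=> mu A muA.
pose F := filter_from [set l | pmeas_base l mu] pmeas_base.
have FF : Filter F.
  apply: filter_from_filter; first by exists [::].
  move=> l1 l2 h1 h2; exists (l1 ++ l2); first by rewrite /pmeas_base/= all_cat; apply/andP.
  by move=> nu; rewrite /pmeas_base/= all_cat => /andP.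
suff : F --> mu by move=> /(_ A muA)[l ? ?]; exists l.
apply: portmanteau => U e oU e0.
have [|s sU hs] := @base_union_approx mu U (fine (mu U) - e) oU.
  by rewrite ltrBlDr ltrDl.
have [q] := rat_in_itvoo hs; rewrite in_itv/= => /andP[q1 q2].
exists [:: (s, q)]; first by rewrite /pmeas_base /= andbT.
move=> nu; rewrite /pmeas_base /= andbT => h; rewrite (lt_trans q1)// (lt_le_trans h)//.
apply: fine_le; rewrite ?fin_num_measure//; try exact: open_borel.
- by apply: open_borel; exact: base_union_open.
- by apply: le_measure => //; rewrite inE; apply: open_borel => //; exact: base_union_open.
Qed.

(** Open sets are countable unions of basic ones, and these are cut out by finitely many strict
    lower bounds on masses of open sets, which [lt_fine_open] expresses through bumps. *)
Lemma measurable_pmeas d (T : measurableType d) (h : T -> pmeas M R) :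
  (forall f, test_function f -> measurable_fun setT (fun t => \int[h t]_x f x)) ->
  measurable_fun [set: T] (h : T -> borel (pmeas M R)).
Proof.
move=> hf; apply: measurable_to_borel => V oV.
rewrite (countable_base_open pmeas_countable_base oV) preimage_bigcup.
apply: countType_bigcup_measurable => l; case: asboolP => _; last by rewrite preimage_set0.
elim: l => [|[s q] l IH].
  by rewrite (_ : pmeas_base _ = setT) ?preimage_setT//; apply/seteqP.
rewrite (_ : pmeas_base _ = [set mu : pmeas M R | ratr q < fine (mu (base_union s))] `&` pmeas_base l).
  2: by apply/seteqP; split => mu; rewrite /pmeas_base /=; [move=> /andP[]|move=> [h1 h2]; apply/andP].
rewrite preimage_setI; apply: measurableI => //.
rewrite (_ : _ @^-1` _ = \bigcup_n [set t | ratr q < \int[h t]_x bump (base_union s) n x]).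
  apply: bigcupT_measurable => n.
  rewrite (_ : mkset _ = (fun t => ratr q < \int[h t]_x bump (base_union s) n x) @^-1` [set true]);
    last by apply/seteqP; split.
  rewrite -[X in measurable X]setTI.
  apply: (measurable_fun_ltr (measurable_cst _) _ measurableT) => //.
  exact/hf/bump_test.
apply/seteqP; split => t /=.
  by move=> /(lt_fine_open _ _ (base_union_open s))[n ?]; exists n.
by move=> [n _ ?]; apply/(lt_fine_open _ _ (base_union_open s)); exists n.
Qed.

End pmeas_base.

(** For open sets the mass is a limit of continuous functions of [mu], the integrals of bumps; a
    Dynkin argument extends this to Borel sets. *)
Lemma measurable_pmeas_eval (U : set (borel M)) : measurable U ->
  measurable_fun [set: borel (pmeas M R)] (fun mu : pmeas M R => mu U).
Proof.
move: U.
pose P := [set U : set (borel M) |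
  measurable_fun [set: borel (pmeas M R)] (fun mu : pmeas M R => mu U)].
apply: (@dynkin_induction _ (borel M) (@open M) P) => //.
- by move=> A B; exact: openI.
- rewrite /P/= (_ : (fun _ => _) = cst 1%E); first exact: measurable_cst.
  by apply/funext => mu; exact: probability_setT.
- move=> V oV; rewrite /P/=.
  apply: (@emeasurable_fun_cvg _ (borel (pmeas M R)) R setT
    (fun n (mu : pmeas M R) => (\int[mu]_x bump V n x)%:E)).
    move=> n; apply/measurable_EFinP; apply: continuous_measurable_real.
    exact/expect_continuous/test_bcontinuous/bump_test.
  move=> mu _; rewrite -(fine_prob mu (open_borel oV)).
  by apply/fine_cvgP; split; [exact: nearW|exact: expect_bump_cvg].
- move=> S mS; rewrite /P/= => h.
  rewrite (_ : (fun _ => _) = (fun mu : pmeas M R => 1 - mu S)%E).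
    by apply: emeasurable_funB => //; exact: measurable_cst.
  by apply/funext => mu; rewrite -probability_setC.
- move=> F mF tF; rewrite /P/= => h.
  apply: (@emeasurable_fun_cvg _ (borel (pmeas M R)) R setT
    (fun n (mu : pmeas M R) => (\sum_(0 <= i < n) mu (F i))%E)).
    by move=> n; apply: emeasurable_sum.
  move=> mu _; apply: measure_semi_sigma_additive => //.
  exact: bigcupT_measurable.
Qed.

End metric_tests.

Lemma indic_preimage (T Y : Type) (R : pzRingType) (f : T -> Y) (A : set Y) t :
  \1_(f @^-1` A) t = (f t \in A)%:R :> R.
Proof.
by rewrite indicE (_ : (t \in _) = (f t \in A))//; apply/idP/idP; rewrite !inE.
Qed.

(** * Image laws and measurability criteria *)

Section law.
Context d1 d2 (T : measurableType d1) (Y : measurableType d2) (R : realType).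
Variables (P : probability T R) (f : T -> Y).
Hypothesis mf : measurable_fun setT f.

Lemma measurable_family_dirac :
  measurable_family (fun t => \d_(f t) : probability Y R).
Proof.
move=> U mU; rewrite (_ : (fun t => _) = EFin \o (\1_(f @^-1` U))).
  apply/measurable_EFinP; apply: measurable_indic.
  by rewrite -[X in measurable X]setTI; exact: mf.
by apply/funext => t /=; rewrite diracE indic_preimage.
Qed.

(** The image measure is presented as a mixture of Dirac masses, so that the change of variables
    formula is an instance of [expect_mixture]. *)
Definition law : probability Y R := mixture_prob measurable_family_dirac P.

Lemma lawE A : measurable A -> law A = P (f @^-1` A).
Proof.
move=> mA; rewrite /law /mixture_prob/= /mixture/=.
rewrite (eq_integral (fun t => (\1_(f @^-1` A) t)%:E)); last first.
  by move=> t _; rewrite diracE indic_preimage.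
by rewrite integral_indic ?setIT// -[X in measurable X]setTI; exact: mf.
Qed.

Lemma expect_law (g : Y -> R) : bmeas g -> \int[law]_y g y = \int[P]_t g (f t).
Proof.
move=> bg; rewrite /law expect_mixture//; apply: eq_Rintegral => t _.
rewrite /Rintegral integral_dirac// ?diracT ?mul1e//.
by apply/measurable_EFinP; case: bg.
Qed.

End law.

Lemma law_unique d1 d2 d (T1 : measurableType d1) (T2 : measurableType d2)
    (Y : measurableType d) (R : realType) (G : set (set Y))
    (P : probability T1 R) (Q : probability T2 R) (f : T1 -> Y) (g : T2 -> Y) :
  measurable = <<s G >> -> setI_closed G ->
  measurable_fun setT f -> measurable_fun setT g ->
  (forall A, G A -> P (f @^-1` A) = Q (g @^-1` A)) ->
  forall A, measurable A -> P (f @^-1` A) = Q (g @^-1` A).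
Proof.
move=> GE GI mf mg PQ A mA; rewrite -(lawE P mf mA) -(lawE Q mg mA).
apply: (probability_unique GE GI) => // B GB.
have mB : measurable B by rewrite GE; exact: sub_sigma_algebra.
by rewrite !lawE//; exact: PQ.
Qed.

Lemma open_mdist_lt (R : realType) (M : pmetricType R) (x : M) (e : R) :
  open [set y | mdist x y < e].
Proof.
have : continuous (fun y : M => mdist x y).
  apply: (@lipschitz_continuous_real _ _ 1) => y z; rewrite mul1r.
  by have := metric_triangle x z y; rewrite (metric_sym z y); lra.
by move=> /continuousP /(_ _ (@open_lt R e)).
Qed.

(** Balls of radius [1 / (k + 1)] around the points of the dense set, addressed by the code of the
    centre and by [k]; a number that codes no point gives the empty set. *)
Lemma proper_metric_base (R : realType) (M : pmetricType R) : proper_metric M ->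
  exists B : nat * nat -> set M, countable_base B.
Proof.
move=> [_ [Z /countable_injP[f fZ] dZ] _].
exists (fun p => \bigcup_(z in [set z | Z z /\ f z = p.1]) [set y | mdist z y < p.2.+1%:R^-1]).
split; first by move=> [n k]; apply: bigcup_open => z _; exact: open_mdist_lt.
move=> x A /nbhs_ballP[e /= e0 eA].
have [k ke] : exists k, (k.+1%:R^-1 : R) < e / 2.
  have /cvgrPdist_lt/(_ (e / 2)) := @cvg_harmonic R.
  rewrite divr_gt0// => /(_ isT)[k _ /(_ k (leqnn _))/=].
  by rewrite sub0r normrN ger0_norm// => ?; exists k.
have [z [/= xz Zz]] : ([set y | mdist x y < k.+1%:R^-1] `&` Z) !=set0.
  apply: dZ; last exact: open_mdist_lt.
  by exists x => /=; rewrite mdistxx.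
exists (f z, k).
  by exists z => //=; rewrite metric_sym.
move=> y [z' /= [Zz' fz']] /= zy.
have z'z : z' = z by apply: fZ; rewrite ?inE.
apply: eA; rewrite ballEmdist/= (le_lt_trans (metric_triangle _ z _))//.
by rewrite (splitr e) ltrD// ?(lt_trans xz)// -z'z (lt_trans zy).
Qed.

Lemma measurable_fun_lt d (T : measurableType d) (R : realType) (f : T -> R) :
  (forall b, measurable [set t | f t < b]) -> measurable_fun [set: T] f.
Proof.
move=> fb; apply: (@measurability _ _ T R setT f (@RGenInftyO.G R)) => //.
  exact: RGenInftyO.measurableE.
move=> _ [_ [r ->] <-]; rewrite setTI.
rewrite (_ : _ @^-1` _ = [set t | f t < r]); first exact: fb.
by apply/seteqP; split => t /=; rewrite in_itv.
Qed.

Lemma measurable_set_lt d (T : measurableType d) (R : realType) (f : T -> R) b :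
  measurable_fun [set: T] f -> measurable [set t | f t < b].
Proof.
move=> mf; rewrite (_ : mkset _ = (fun t => f t < b) @^-1` [set true]).
  rewrite -[X in measurable X]setTI.
  exact: (measurable_fun_ltr mf (measurable_cst _) measurableT).
by apply/seteqP; split.
Qed.

Lemma measurable_set_ge d (T : measurableType d) (R : realType) (f : T -> R) b :
  measurable_fun [set: T] f -> measurable [set t | b <= f t].
Proof.
move=> mf; rewrite (_ : mkset _ = ~` [set t | f t < b]).
  by apply: measurableC; exact: measurable_set_lt.
by apply/seteqP; split => t /=; rewrite leNgt => /negP.
Qed.

Lemma measurable_pmeasP (R : realType) (M : pmetricType R) (hM : proper_metric M)
    d (T : measurableType d) (h : T -> pmeas M R) :
  (forall f, test_function f -> measurable_fun setT (fun t => \int[h t]_x f x)) ->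
  measurable_fun [set: T] (h : T -> borel (pmeas M R)).
Proof. by have [B hB] := proper_metric_base hM; exact: (measurable_pmeas hM hB). Qed.

Lemma measurable_coord (J : Type) d (T : measurableType d) (j : J) :
  measurable_fun [set: power_space J T] (fun w => w j).
Proof.
move=> _ B mB; rewrite setTI; apply: sub_sigma_algebra.
by exists j, B.
Qed.

Lemma measurable_to_power (J : Type) d d' (T : measurableType d)
    (T' : measurableType d') (f : T' -> J -> T) :
  (forall j, measurable_fun setT (fun t => f t j)) ->
  measurable_fun [set: T'] (f : T' -> power_space J T).
Proof.
move=> mf; apply: (@measurability _ _ T' (power_space J T) setT f (@cylinder J d T)) => //.
move=> _ [_ [j [B mB ->]] <-]; exact: (mf j).
Qed.

(** * The moment method for families of random measures *)

Section finite_dimensional.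
Context (R : realType) (M : pmetricType R) (hM : proper_metric M).
Context (J : Type).

Definition test_type := {f : M -> R | test_function f}.

Definition moment_var (a : J * test_type) (w : J -> pmeas M R) : R :=
  \int[w a.1]_x sval a.2 x.

Definition moment_events : set (set (power_space J (borel (pmeas M R)))) :=
  [set C | exists s : seq (J * test_type * R),
    C = [set w | all (fun p => moment_var p.1 w < p.2) s]].

Lemma moment_var_bmeas a :
  bmeas (moment_var a : power_space J (borel (pmeas M R)) -> R).
Proof.
have tf := svalP a.2; split.
  apply: (measurableT_comp (f := fun mu : borel (pmeas M R) => \int[mu]_x sval a.2 x)).
    by apply: continuous_measurable_real; apply: expect_continuous; exact: test_bcontinuous.
  exact: measurable_coord.
exists 1 => w; apply: expect_bound; first exact: test_bmeas.
by move=> x; have [_ /(_ x)/andP[? ?] _] := tf; rewrite ger0_norm.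
Qed.

(** Coordinates are measurable for the generated sigma-algebra because measurability of a random
    measure is tested on integrals of test functions. *)
Lemma moment_events_generate :
  @measurable _ (power_space J (borel (pmeas M R))) = <<s moment_events >>.
Proof.
apply/seteqP; split; last first.
  apply: smallest_sub; first exact: sigma_algebra_measurable.
  move=> _ [s ->]; elim: s => [|p s IH].
    by rewrite (_ : mkset _ = setT)//; apply/seteqP; split.
  rewrite (_ : mkset _ = [set w | moment_var p.1 w < p.2] `&`
     [set w | all (fun p => moment_var p.1 w < p.2) s]).
    by apply: measurableI => //; apply: measurable_set_lt; case: (moment_var_bmeas p.1).
  by apply/seteqP; split => w /= => [/andP[]|[h1 h2]]; last apply/andP.
pose T' := g_sigma_algebraType moment_events.
apply: smallest_sub; first exact: (@sigma_algebra_measurable _ T').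
move=> _ [j [B mB ->]].
have : measurable_fun [set: T'] (fun w : T' => w j : borel (pmeas M R)).
  apply: (measurable_pmeasP hM) => f tf; apply: measurable_fun_lt => b.
  apply: sub_sigma_algebra; exists [:: (j, exist _ f tf, b)].
  by apply/seteqP; split => w /=; rewrite andbT.
by move=> /(_ measurableT B mB); rewrite setTI.
Qed.

Lemma moment_events_setI : setI_closed moment_events.
Proof.
move=> _ _ [s ->] [s' ->]; exists (s ++ s').
by apply/seteqP; split => w /=; rewrite all_cat => /andP.
Qed.

(** The variables [moment_var a] are bounded, so their joint moments fix the probabilities of
    [moment_events], a pi-system generating the product sigma-algebra. The index set [J] may be
    uncountable: it is [M] itself when random kernels are compared. *)
Lemma fdd_unique d1 d2 (T1 : measurableType d1) (T2 : measurableType d2)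
    (P : probability T1 R) (Q : probability T2 R)
    (xi : T1 -> J -> pmeas M R) (eta : T2 -> J -> pmeas M R) :
  (forall j, measurable_fun setT (fun t => xi t j : borel (pmeas M R))) ->
  (forall j, measurable_fun setT (fun t => eta t j : borel (pmeas M R))) ->
  (forall s : seq (J * test_type),
    \int[P]_t \prod_(a <- s) moment_var a (xi t) =
    \int[Q]_t \prod_(a <- s) moment_var a (eta t)) ->
  forall C : set (power_space J (borel (pmeas M R))), measurable C ->
    P (xi @^-1` C) = Q (eta @^-1` C).
Proof.
move=> mxi meta mom.
have mxi' : measurable_fun setT (xi : T1 -> power_space J (borel (pmeas M R))).
  exact: measurable_to_power.
have meta' : measurable_fun setT (eta : T2 -> power_space J (borel (pmeas M R))).
  exact: measurable_to_power.
apply: (law_unique moment_events_generate moment_events_setI mxi' meta').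
move=> _ [s ->].
apply: (moment_equal_events (X := fun a t => moment_var a (xi t))
  (Y := fun a t => moment_var a (eta t))) => //.
- by move=> a; apply: (bmeas_comp (moment_var_bmeas a) mxi').
- by move=> a; apply: (bmeas_comp (moment_var_bmeas a) meta').
Qed.

End finite_dimensional.

Lemma emeasurable_prod d (T : measurableType d) (R : realType) (J : Type)
    (s : seq J) (g : J -> T -> \bar R) :
  (forall k, measurable_fun setT (g k)) ->
  measurable_fun setT (fun t => \prod_(k <- s) g k t)%E.
Proof.
move=> mg; elim: s => [|k s IH].
  by under eq_fun do rewrite big_nil; exact: measurable_cst.
by under eq_fun do rewrite big_cons; exact: emeasurable_funM.
Qed.

(** * Finite powers of a space and product measures *)

Section finite_power.
Context (X : ptopologicalType) (n : nat) (K : countType) (B : K -> set X).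
Hypothesis hB : countable_base B.

Definition box_base (f : {ffun 'I_n -> K}) : set {ptws 'I_n -> X} :=
  [set y | forall i, B (f i) (y i)].

(** The filter generated by the boxes around [x] converges to [x] in each coordinate, hence in the
    product topology. *)
Lemma box_countable_base : countable_base box_base.
Proof.
split.
  move=> f; rewrite openE => y hy.
  have : forall i, nbhs y [set y' : {ptws 'I_n -> X} | B (f i) (y' i)].
    move=> i.
    apply: (@coord_continuous _ (fun _ : 'I_n => X) i y (B (f i))).
    by apply: open_nbhs_nbhs; split; [case: hB|exact: hy].
  by move=> /filter_forall.
move=> x A xA.
pose F := filter_from [set f | box_base f x] box_base.
have ex U i : nbhs (x i) U -> exists k, B k (x i) /\ B k `<=` U.
  by move=> xU; have [_ /(_ _ _ xU)[k ? ?]] := hB; exists k.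
have exf (U : 'I_n -> set X) : (forall i, nbhs (x i) (U i)) ->
    exists2 f, box_base f x & box_base f `<=` [set y | forall i, U i (y i)].
  move=> xU; exists [ffun i => sval (cid (ex (U i) i (xU i)))].
    by move=> i; rewrite ffunE; case: cid => k [].
  by move=> y h i; have := h i; rewrite ffunE; case: cid => k /= [_]; apply.
have FF : Filter F.
  apply: filter_from_filter.
    by have [|f ? _] := exf (fun=> setT); [move=> i; exact: filterT|exists f].
  move=> f g fx gx; have [|h hx hfg] := exf (fun i => B (f i) `&` B (g i)).
    move=> i; apply: filterI; apply: open_nbhs_nbhs; split.
    - by have [] := hB.
    - exact: fx.
    - by have [] := hB.
    - exact: gx.
  by exists h => // y /hfg hy; split => i; have [] := hy i.
suff : F --> (x : {ptws 'I_n -> X}) by move=> /(_ A xA)[f ? ?]; exists f.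
apply: cvg_prod_topology => i U xU.
have [|f fx fU] := exf (fun j => if j == i then U else setT).
  by move=> j; case: eqP => [->//|_]; exact: filterT.
by exists f => // y /fU/(_ i); rewrite eqxx.
Qed.

Lemma measurable_to_ptws d (T : measurableType d) (h : T -> {ptws 'I_n -> X}) :
  (forall i, measurable_fun setT (fun t => h t i : borel X)) ->
  measurable_fun [set: T] (h : T -> borel {ptws 'I_n -> X}).
Proof.
move=> mh; apply: measurable_to_borel => V oV.
rewrite (countable_base_open box_countable_base oV) preimage_bigcup.
apply: countType_bigcup_measurable => f; case: asboolP => _; last by rewrite preimage_set0.
rewrite (_ : _ @^-1` _ = \bigcap_(i in setT) ((fun t => h t i) @^-1` B (f i))).
  apply: fin_bigcap_measurable => // i _; rewrite -[X in measurable X]setTI.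
  by apply: mh => //; apply: open_borel; have [] := hB.
by apply/seteqP; split => t /= => [ht i _|ht i]; exact: ht.
Qed.

Definition rectangles : set (set (borel {ptws 'I_n -> X})) :=
  [set A | exists2 C : 'I_n -> set (borel X), (forall i, measurable (C i)) &
    A = [set y | forall i, C i (y i)]].

(** The Borel and the product sigma-algebra agree thanks to the countable base: the identity from
    the latter to the former is measurable since all its coordinates are. *)
Lemma rectangles_generate :
  @measurable _ (borel {ptws 'I_n -> X}) = <<s rectangles >>.
Proof.
apply/seteqP; split; last first.
  apply: smallest_sub; first exact: sigma_algebra_measurable.
  move=> _ [C mC ->].
  rewrite (_ : mkset _ = \bigcap_(i in setT) ((fun y : {ptws 'I_n -> X} => y i) @^-1` C i)).
    apply: fin_bigcap_measurable => // i _; rewrite -[X in measurable X]setTI.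
    by apply: (measurable_from_borel (@coord_continuous _ (fun _ : 'I_n => X) i)).
  by apply/seteqP; split => t /= => [ht i _|ht i]; exact: ht.
pose T' := g_sigma_algebraType rectangles.
have mid : measurable_fun [set: T'] (idfun : T' -> borel {ptws 'I_n -> X}).
  apply: (@measurable_to_ptws _ T') => i _ D mD; rewrite setTI; apply: sub_sigma_algebra.
  exists (fun j => if j == i then D else setT); first by move=> j; case: eqP.
  apply/seteqP; split => y /=; last by move=> /(_ i); rewrite eqxx.
  by move=> Dy j; case: eqP => // ->.
by move=> A mA; have := mid measurableT A mA; rewrite setTI.
Qed.

Lemma rectangles_setI : setI_closed rectangles.
Proof.
move=> _ _ [C mC ->] [D mD ->]; exists (fun i => C i `&` D i).
  by move=> i; exact: measurableI.
by apply/seteqP; split => y /= => [[h1 h2] i|h]; [split|split => i; have [] := h i].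
Qed.

End finite_power.

Section finite_product_measure.
Context (X : ptopologicalType) (R : realType) (K : countType) (B : K -> set X).
Hypothesis hB : countable_base B.

Lemma bmeas_coord_prod n (f : 'I_n -> X -> R) :
  (forall k, bmeas (f k : borel X -> R)) ->
  bmeas (fun y : borel {ptws 'I_n -> X} => \prod_(k < n) f k (y k)).
Proof.
move=> bf; apply: (@bmeas_prod _ (borel {ptws 'I_n -> X}) R _ (index_enum 'I_n) (fun k y => f k (y k))) => k.
apply: (bmeas_comp (bf k)).
exact: (measurable_from_borel (@coord_continuous _ (fun _ : 'I_n => X) k)).
Qed.

Definition ord_cons n (x : X) (y : 'I_n -> X) : 'I_n.+1 -> X :=
  fun i => if unlift ord0 i is Some j then y j else x.

Lemma measurable_ord_cons n : measurable_fun
  [set: borel X * borel {ptws 'I_n -> X}]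
  (fun p => ord_cons p.1 p.2 : borel {ptws 'I_n.+1 -> X}).
Proof.
apply: (measurable_to_ptws hB) => i; rewrite /ord_cons.
case: unliftP => [j _|_]; last exact: measurable_fst.
have mj : measurable_fun [set: borel {ptws 'I_n -> X}] (fun y => y j : borel X).
  exact: (measurable_from_borel (@coord_continuous _ (fun _ : 'I_n => X) j)).
exact: (measurableT_comp mj measurable_snd).
Qed.

(** [prod_pmeas] selects a measure with prescribed values on rectangles, so one has to be exhibited.
    By induction, the first coordinate is drawn from [mu ord0] and prepended to a point drawn from
    the product of the others. Products of functions are used because they yield rectangles and
    expectations alike. *)
Lemma product_measure_exists n (mu : 'I_n -> pmeas X R) :
  exists m : probability (borel {ptws 'I_n -> X}) R,
    forall f : 'I_n -> X -> R, (forall k, bmeas (f k : borel X -> R)) ->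
      \int[m]_y \prod_(k < n) f k (y k) = \prod_(k < n) \int[mu k]_x f k x.
Proof.
elim: n mu => [|n IH] mu.
  exists (\d_(point : borel {ptws 'I_0 -> X})) => f bf.
  rewrite big_ord0 -[RHS](expect_cst \d_(point : borel {ptws 'I_0 -> X})).
  by apply: eq_Rintegral => y _; rewrite big_ord0.
have [m hm] := IH (fun k => mu (lift ord0 k)).
pose c (x : borel X) (y : borel {ptws 'I_n -> X}) : borel {ptws 'I_n.+1 -> X} := ord_cons x y.
have mc x : measurable_fun setT (c x).
  exact: (measurableT_comp (@measurable_ord_cons n) (pair1_measurable x)).
pose k (x : borel X) : probability (borel {ptws 'I_n.+1 -> X}) R := law m (mc x).
have mk : measurable_family k.
  move=> U mU.
  pose F (p : borel X * borel {ptws 'I_n -> X}) : \bar R := (\1_U (ord_cons p.1 p.2))%:E.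
  have mF : measurable_fun setT F.
    have mi : measurable_fun setT (\1_U : borel {ptws 'I_n.+1 -> X} -> R).
      exact: measurable_indic.
    by apply/measurable_EFinP; exact: (measurableT_comp mi (@measurable_ord_cons n)).
  have : measurable_fun [set: borel X] (fun x => \int[m]_y F (x, y))%E.
    apply: (@measurable_fun_fubini_tonelli_F _ _ _ _ _ m F mF) => p.
    by rewrite lee_fin indicE.
  apply: eq_measurable_fun => x _; rewrite /k lawE// -[c x @^-1` U]setIT -integral_indic//.
  by rewrite -[X in measurable X]setTI; apply: (mc x).
exists (mixture_prob mk (mu ord0)) => f bf.
have bprod := bmeas_coord_prod bf.
rewrite expect_mixture// big_ord_recl.
have bfl : forall j : 'I_n, bmeas (f (lift ord0 j) : borel X -> R) by [].
have -> : \int[mu ord0]_t \int[k t]_y \prod_(k0 < n.+1) f k0 (y k0) =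
    \int[mu ord0]_t (\prod_(i < n) \int[mu (lift ord0 i)]_x f (lift ord0 i) x * f ord0 t).
  apply: eq_Rintegral => x _; rewrite expect_law// -(hm (fun i => f (lift ord0 i)))//.
  rewrite [RHS]mulrC -expectZ; last exact: (bmeas_coord_prod bfl).
  apply: eq_Rintegral => y _; rewrite big_ord_recl /c /ord_cons unlift_none.
  by congr (_ * _); apply: eq_bigr => i _; rewrite liftK.
by rewrite expectZ// mulrC.
Qed.

Lemma product_measure_rect n (mu : 'I_n -> pmeas X R)
    (m : probability (borel {ptws 'I_n -> X}) R) :
  (forall f : 'I_n -> X -> R, (forall k, bmeas (f k : borel X -> R)) ->
      \int[m]_y \prod_(k < n) f k (y k) = \prod_(k < n) \int[mu k]_x f k x) ->
  forall C : 'I_n -> set (borel X), (forall k, measurable (C k)) ->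
    m [set y | forall k, C k (y k)] = (\prod_(k < n) mu k (C k))%E.
Proof.
move=> hm C mC.
have mR : measurable ([set y | forall k, C k (y k)] : set (borel {ptws 'I_n -> X})).
  by rewrite (rectangles_generate _ hB); apply: sub_sigma_algebra; exists C.
have E : \int[m]_y \prod_(k < n) (\1_(C k) (y k) : R) =
    \int[m]_y (\1_([set y | forall k, C k (y k)] : set (borel {ptws 'I_n -> X})) y).
  apply: eq_Rintegral => y _; rewrite indicE; case: (pselect (forall k, C k (y k))) => h.
    by rewrite mem_set// big1// => k _; rewrite indicE mem_set.
  rewrite memNset//; have /existsNP[k Ck] := h.
  by rewrite (bigD1 k)//= indicE memNset// mul0r.
have := hm (fun k => \1_(C k)) (fun k => bmeas_indic _ (mC k)).
rewrite E expect_indic// => H; rewrite -(fine_prob m mR) H.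
rewrite (big_morph EFin (@EFinM R) erefl); apply: eq_bigr => k _.
by rewrite expect_indic// fine_prob.
Qed.

Lemma prod_pmeas_rect n (mu : 'I_n -> pmeas X R) (C : 'I_n -> set (borel X)) :
  (forall k, measurable (C k)) ->
  prod_pmeas mu [set y | forall k, C k (y k)] = (\prod_(k < n) mu k (C k))%E.
Proof.
move: C; rewrite /prod_pmeas; case: xgetP => [m _ //|].
have [m hm] := product_measure_exists mu.
move=> /(_ (trim m)) h; exfalso; apply: h => C mC.
rewrite trimE; first exact: product_measure_rect.
by rewrite (rectangles_generate _ hB); apply: sub_sigma_algebra; exists C.
Qed.

Lemma prod_pmeas_expect n (mu : 'I_n -> pmeas X R) (f : 'I_n -> X -> R) :
  (forall k, bmeas (f k : borel X -> R)) ->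
  \int[prod_pmeas mu]_y \prod_(k < n) f k (y k) = \prod_(k < n) \int[mu k]_x f k x.
Proof.
move=> bf; have [m hm] := product_measure_exists mu; rewrite -hm//.
rewrite /Rintegral; congr fine; apply: eq_measure_integral => A mA _.
apply: (@probability_unique _ _ _ (@rectangles X n) (prod_pmeas mu) m) => //.
- exact: (rectangles_generate _ hB).
- exact: rectangles_setI.
- move=> _ [C mC ->]; rewrite prod_pmeas_rect//.
  by rewrite (product_measure_rect hm).
Qed.

Lemma measurable_prod_pmeas d (T : measurableType d) n (h : T -> 'I_n -> pmeas X R) :
  (forall k, measurable_family (fun t => h t k)) ->
  measurable_family (fun t => prod_pmeas (h t)).
Proof.
move=> mh U.
pose Q := [set U : set (borel {ptws 'I_n -> X}) |
  measurable_fun [set: T] (fun t => prod_pmeas (h t) U)].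
move=> mU; have : <<s @rectangles X n >> U by rewrite -(rectangles_generate _ hB).
apply: (@dynkin_induction _ (borel {ptws 'I_n -> X}) (@rectangles X n) Q).
- exact: (rectangles_generate _ hB).
- exact: rectangles_setI.
- rewrite /Q/= (_ : (fun _ => _) = cst 1%E); first exact: measurable_cst.
  by apply/funext => mu; exact: probability_setT.
- move=> _ [C mC ->]; rewrite /Q/=.
  rewrite (_ : (fun _ => _) = (fun t => \prod_(k < n) h t k (C k))%E).
    by apply: (@emeasurable_prod _ _ _ _ (index_enum 'I_n) (fun k t => h t k (C k))) => k; exact: mh.
  by apply/funext => t; rewrite prod_pmeas_rect.
- move=> S mS; rewrite /Q/= => hS.
  rewrite (_ : (fun _ => _) = (fun t => 1 - prod_pmeas (h t) S)%E).
    by apply: emeasurable_funB => //; exact: measurable_cst.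
  by apply/funext => t; rewrite -probability_setC.
- move=> F mF tF; rewrite /Q/= => hF.
  apply: (@emeasurable_fun_cvg _ T R setT
    (fun n0 t => (\sum_(0 <= i < n0) prod_pmeas (h t) (F i))%E)).
    by move=> n0; apply: emeasurable_sum.
  move=> t _; apply: measure_semi_sigma_additive => //.
  exact: bigcupT_measurable.
Qed.

End finite_product_measure.

Lemma eq_expect d (T : measurableType d) (R : realType) (P Q : probability T R) f :
  (forall A, measurable A -> P A = Q A) -> \int[P]_x f x = \int[Q]_x f x.
Proof. by move=> PQ; rewrite /Rintegral; congr fine; apply: eq_measure_integral => A mA _; exact: PQ. Qed.

(** * One-point compactification *)

Section compactification.
Context (R : realType) (M : pmetricType R) (hM : proper_metric M).
Local Notation Mhat := (compactify M).
Local Notation PM := (pmeas M R).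
Local Notation PMhat := (pmeas (compactify M) R).

Definition closed_mball (n : nat) := [set x : M | mdist point x <= n%:R].

Lemma closed_mball_compact n : compact (closed_mball n) /\ closed (closed_mball n).
Proof.
have cl : closed (closed_mball n).
  rewrite -[closed_mball n]setCK; apply: open_closedC.
  have : continuous (fun y : M => mdist point y).
    apply: (@lipschitz_continuous_real _ _ 1) => y z; rewrite mul1r.
    by have := metric_triangle point z y; rewrite (metric_sym z y); lra.
  move=> /continuousP /(_ _ (@open_gt R n%:R)).
  congr open; by apply/seteqP; split => x /=; rewrite /closed_mball/= ltNge => /negP.
split => //; rewrite -precompact_closed//.
by case: hM => _ _; apply; exists point, n%:R.
Qed.

Lemma compact_sub_mball (C : set M) : compact C -> exists n, C `<=` closed_mball n.
Proof.
move=> cC.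
have cd : continuous (fun y : M => mdist point y).
  apply: (@lipschitz_continuous_real _ _ 1) => y z; rewrite mul1r.
  by have := metric_triangle point z y; rewrite (metric_sym z y); lra.
have : compact ((fun y : M => mdist point y) @` C).
  by apply: continuous_compact => //; exact: continuous_subspaceT.
move=> /compact_bounded[r [_ hr]].
exists (Num.truncn (`|r| + 1)).+1 => x Cx; rewrite /closed_mball/=.
have r1 : r < `|r| + 1 by rewrite (le_lt_trans (ler_norm _))// ltrDl.
have /= h := hr _ r1 (mdist point x) (ex_intro2 _ _ x Cx erefl).
by rewrite (le_trans (ler_norm _))// (le_trans h)// ltW// truncnS_gt.
Qed.

(** Every compact set lies in a closed ball of integer radius around [point], so the complements of
    these balls give a countable neighbourhood base at infinity. *)
Lemma compactify_countable_base (K : countType) (B : K -> set M) : countable_base B ->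
  countable_base (fun k : K + nat => match k with
    | inl k => Some @` B k
    | inr n => (Some @` (~` closed_mball n)) `|` [set None]
    end : set Mhat).
Proof.
move=> [oB hB]; split.
  move=> [k|n]; first by apply: one_point_compactification_open_some; exact: oB.
  rewrite openE => -[x|].
    move=> [[y ny [<-]]|//]; rewrite /interior.
    apply: (@filterS _ _ _ (Some @` (~` closed_mball n))); first by move=> z ?; left.
    apply: one_point_compactification_some_nbhs; apply: open_nbhs_nbhs; split => //.
    by apply: closed_openC; case: (closed_mball_compact n).
  move=> _; rewrite /interior; exists (closed_mball n) => //.
  exact: closed_mball_compact.
move=> [x|] A.
  move=> xA; have [k Bkx kA] := hB x _ xA.
  exists (inl k); first by exists x.
  by move=> _ [y /kA ? <-].
move=> [C [cC _] CA].
have [n Cn] := compact_sub_mball cC.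
exists (inr n); first by right.
move=> o [[y ny <-]|->]; apply: CA; last by right.
by left; exists y => // /Cn.
Qed.

Definition hat (f : M -> R) : Mhat -> R := fun o => oapp f 0 o.

Lemma hat_bcontinuous f : test_function f -> bcontinuous (hat f).
Proof.
move=> [cf f01 [C cC fC]]; split; last first.
  exists 1 => -[x|] /=; last by rewrite normr0.
  by have /andP[? ?] := f01 x; rewrite ger0_norm.
move=> [x|]; first by move=> A /cf.
have H : one_point_nbhs (None : Mhat) [set o | hat f o = 0]; last first.
  move=> V /nbhs_singleton fV; apply: (@filterS _ (nbhs (None : Mhat)) _ _ _ _ H).
  by move=> o /= ->.
exists C.
  by split => //; apply: compact_closed => //; exact: metric_hausdorff.
by move=> _ [[y Cy <-]|->] /=; [exact: fC|].
Qed.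

Lemma measurable_Some : measurable_fun [set: borel M] (Some : borel M -> borel Mhat).
Proof. exact: (measurable_from_borel (@one_point_compactification_some_continuous M)). Qed.

Lemma measurable_Some_image (B : set (borel M)) : measurable B ->
  measurable (Some @` B : set (borel Mhat)).
Proof.
have mr : measurable (range Some : set (borel Mhat)).
  by apply: open_borel; apply: one_point_compactification_open_some; exact: openT.
move: B; apply: smallest_sub; last first.
  by move=> U oU; apply: open_borel; exact: one_point_compactification_open_some.
split.
- by rewrite image_set0.
- move=> A mA; rewrite (_ : _ @` _ = range Some `\` Some @` A); first exact: measurableD.
  apply/seteqP; split => [_ [x [_ Ax] <-]|_ [[x _ <-] nAx]].
    by split; [exists x|move=> [y Ay [yx]]; apply: Ax; rewrite -yx].
  by exists x => //; split => // Ax; apply: nAx; exists x.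
- by move=> F mF; rewrite image_bigcup; exact: bigcupT_measurable.
Qed.

Lemma range_Some_measurable : measurable (range Some : set (borel Mhat)).
Proof. by apply: measurable_Some_image. Qed.

Lemma embedE (mu : PM) (A : set (borel Mhat)) : measurable A ->
  embed mu A = mu (Some @^-1` A).
Proof.
by move: A; apply: (prob_ofE (P := law mu measurable_Some)) => A mA; rewrite lawE.
Qed.

Lemma expect_embed (mu : PM) (g : Mhat -> R) : bmeas (g : borel Mhat -> R) ->
  \int[embed mu]_x g x = \int[mu]_x g (Some x).
Proof.
move=> bg; rewrite -(expect_law mu measurable_Some bg).
by apply: eq_expect => A mA; rewrite embedE// lawE.
Qed.

Lemma expect_embed_hat (mu : PM) f : test_function f ->
  \int[embed mu]_x hat f x = \int[mu]_x f x.
Proof. by move=> tf; rewrite expect_embed//; exact/bcontinuous_bmeas/hat_bcontinuous. Qed.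

Lemma embed_continuous : continuous (@embed R M).
Proof.
move=> mu.
have FF : Filter (@embed R M @ nbhs mu) by exact: fmap_filter.
apply: (pmeas_cvg FF) => g bg; have [cg [B gB]] := bg.
have bgS : bcontinuous (g \o Some : M -> R).
  split; last by exists B => x; exact: gB.
  move=> x; apply: continuous_comp; last exact: cg.
  exact: one_point_compactification_some_continuous.
rewrite (expect_embed _ (bcontinuous_bmeas bg)).
move=> V hV; apply: (@filterS _ (nbhs mu) _ _ _ _ (@expect_continuous _ _ _ bgS mu V hV)).
by move=> nu /=; rewrite expect_embed//; exact: bcontinuous_bmeas.
Qed.

(** Bumps extend continuously to the compactification, so their integrals converge and bound the
    masses of open sets from below, as [portmanteau] requires. No mass is lost because the limit
    [embed mu] is carried by [M]. *)
Lemma embed_cvg (F : set_system PM) (mu : PM) : Filter F ->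
  @embed R M @ F --> embed mu -> F --> mu.
Proof.
move=> FF Fmu; apply: portmanteau => U e oU e0.
have [|n hn] := (lt_fine_open hM mu (fine (mu U) - e) oU).1.
  by rewrite ltrBlDr ltrDl.
have tb := bump_test hM U n.
have hc : (fun nu : PM => \int[nu]_x bump U n x) @ F --> \int[mu]_x bump U n x.
  rewrite -expect_embed_hat//.
  move=> V hV.
  apply: (@filterS _ F _ _ _ _ (Fmu _ (@expect_continuous _ _ _ (hat_bcontinuous tb) (embed mu) V hV))).
  by move=> nu /=; rewrite expect_embed_hat.
apply: (@filterS _ F _ _ _ _ (cvgr_gt _ hc _ hn)) => nu /= h.
by rewrite (lt_le_trans h)//; exact: expect_bump_le.
Qed.

(** Writes the mass left on [M] as a limit of integrals of continuous functions, so that it depends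
    measurably on [m] and can be computed from moments. *)
Lemma carried_cvg (m : PMhat) :
  \int[m]_x hat (bump [set: M] n) x @[n --> \oo] --> fine (m (range Some)).
Proof.
rewrite -expect_indic; last exact: range_Some_measurable.
apply: (expect_cvg (B := 1)).
- by move=> n; have [] := bcontinuous_bmeas (hat_bcontinuous (bump_test hM setT n)).
- by apply: measurable_indic; exact: range_Some_measurable.
- move=> n [x|] /=; last by rewrite normr0.
  by have [_ /(_ x)/andP[? ?] _] := bump_test hM setT n; rewrite ger0_norm.
apply: aeW => -[x|].
  rewrite indicE mem_set//; apply: (bump_cvg (U := setT)) => //; exact: openT.
by rewrite indicE memNset; [exact: cvg_cst|move=> []].
Qed.

(** A measurable left inverse of [Some], whose image law realises [unembed]. Its value at infinity
    does not affect the measures it is applied to, which are carried by [M]. *)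
Definition strip (o : Mhat) : M := odflt point o.

Lemma measurable_strip : measurable_fun [set: borel Mhat] (strip : borel Mhat -> borel M).
Proof.
move=> _ A mA; rewrite setTI.
have [Ap|Ap] := pselect (A point).
  rewrite (_ : _ @^-1` _ = Some @` A `|` ~` range Some).
    apply: measurableU; first exact: measurable_Some_image.
    by apply: measurableC; exact: range_Some_measurable.
  apply/seteqP; split => [[x|] /= Ax|[x|] /=].
  - by left; exists x.
  - by right => -[].
  - by move=> [[y Ay [<-]]//|]; apply: contra_notP => _; exists x.
  - by [].
rewrite (_ : _ @^-1` _ = Some @` A); first exact: measurable_Some_image.
apply/seteqP; split => [[x|] /= Ax|[x|] /=] //.
- by exists x.
- by move=> [y Ay [<-]].
- by move=> [].
Qed.

Lemma unembedE (x0 : M) (m : PMhat) (A : set (borel M)) :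
  m (range Some) = 1%E -> measurable A ->
  unembed x0 m A = m (Some @` A).
Proof.
move=> m1; rewrite /unembed asboolT//; move: A.
apply: (prob_ofE (P := law m measurable_strip)) => A mA; rewrite lawE//.
have mS := measurable_Some_image mA.
have mN : measurable (~` range Some : set (borel Mhat)).
  by apply: measurableC; exact: range_Some_measurable.
have N0 : m (~` range Some) = 0%E.
  rewrite probability_setC; last exact: range_Some_measurable.
  by rewrite m1 subee.
have mp : measurable (strip @^-1` A : set (borel Mhat)).
  by rewrite -[X in measurable X]setTI; apply: measurable_strip.
apply/eqP; rewrite eq_le; apply/andP; split.
  have h : (m (strip @^-1` A) <= m (Some @` A `|` ~` range Some))%E.
    apply: le_measure; rewrite ?inE//; first exact: measurableU.
    move=> [x|] /= Ax; first by left; exists x.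
    by right => -[].
  rewrite (le_trans h)//; rewrite -[leRHS]adde0 -N0; exact: measureU2.
by apply: le_measure; rewrite ?inE// => _ [x Ax <-].
Qed.

Lemma unembedK (x0 : M) (m : PMhat) : m (range Some) = 1%E -> embed (unembed x0 m) = m.
Proof.
move=> m1; apply: pmeasP => A mA; rewrite embedE// unembedE//; last first.
  by rewrite -[X in measurable X]setTI; exact: measurable_Some.
have mN : measurable (~` range Some : set (borel Mhat)).
  by apply: measurableC; exact: range_Some_measurable.
have N0 : m (~` range Some) = 0%E.
  rewrite probability_setC; last exact: range_Some_measurable.
  by rewrite m1 subee.
have mp : measurable (Some @` (Some @^-1` A) : set (borel Mhat)).
  apply: measurable_Some_image; rewrite -[X in measurable X]setTI; exact: measurable_Some.
apply/eqP; rewrite eq_le; apply/andP; split.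
  by apply: le_measure; rewrite ?inE// => _ [x Ax <-].
have h : (m A <= m (Some @` (Some @^-1` A) `|` ~` range Some))%E.
  apply: le_measure; rewrite ?inE//; first exact: measurableU.
  move=> [x|] /= Ax; first by left; exists x.
  by right => -[].
rewrite (le_trans h)//; rewrite -[leRHS]adde0 -N0; exact: measureU2.
Qed.

Lemma embed_carried (mu : PM) : embed mu (range Some) = 1%E.
Proof.
rewrite embedE; last exact: range_Some_measurable.
rewrite (_ : _ @^-1` _ = setT) ?probability_setT//.
by apply/seteqP; split => // x _; exists x.
Qed.

Lemma embedK (x0 : M) (mu : PM) : unembed x0 (embed mu) = mu.
Proof.
apply: pmeasP => A mA; rewrite unembedE ?embed_carried// embedE.
  by congr (mu _); apply/seteqP; split => [x [y Ay [<-]]|x Ax]//=; exists x.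
exact: measurable_Some_image.
Qed.

Lemma expect_unembed (x0 : M) (m : PMhat) f : m (range Some) = 1%E -> test_function f ->
  \int[unembed x0 m]_x f x = \int[m]_x hat f x.
Proof. by move=> m1 tf; rewrite -{2}(unembedK x0 m1) expect_embed_hat. Qed.

Lemma measurable_carried :
  measurable [set m : borel PMhat | (m : PMhat) (range Some) = 1%E].
Proof.
have mf : measurable_fun [set: borel PMhat] (fun m : PMhat => fine (m (range Some))).
  apply: (@measurable_fun_cvg _ (borel PMhat) R setT
    (fun n (m : PMhat) => \int[m]_x hat (bump [set: M] n) x)).
    move=> n; apply: continuous_measurable_real; apply: expect_continuous.
    exact/hat_bcontinuous/bump_test.
  by move=> m _; exact: carried_cvg.
rewrite (_ : mkset _ = (fun m : borel PMhat => fine ((m : PMhat) (range Some))) @^-1` [set 1]).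
  by rewrite -[X in measurable X]setTI; exact: mf.
apply/seteqP; split => m /= => [->//|h].
by rewrite -(fine_prob m range_Some_measurable) h.
Qed.

Lemma measurable_unembed (x0 : M) :
  measurable_fun [set: borel PMhat] (unembed x0 : borel PMhat -> borel PM).
Proof.
apply: (measurable_pmeasP hM) => f tf.
rewrite (_ : (fun t => _) = (fun m : borel PMhat =>
    if `[< (m : PMhat) (range Some) = 1%E >] then \int[(m : PMhat)]_x hat f x
    else \int[pdirac x0 : PM]_x f x)).
  apply: measurable_fun_ifT.
  - apply: (measurable_fun_bool true); rewrite setTI.
    rewrite (_ : _ @^-1` _ = [set m : borel PMhat | (m : PMhat) (range Some) = 1%E]).
      exact: measurable_carried.
    by apply/seteqP; split => m /= /asboolP.
  - apply: continuous_measurable_real; apply: expect_continuous.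
    exact: hat_bcontinuous.
  - exact: measurable_cst.
apply/funext => m; case: asboolP => h; first exact: expect_unembed.
by rewrite /unembed asboolF.
Qed.

End compactification.

Lemma expect_eq0_ae d (T : measurableType d) (R : realType) (P : probability T R)
    (f : T -> R) : bmeas f -> (forall x, 0 <= f x) -> \int[P]_x f x = 0 ->
  \forall x \ae P, f x = 0.
Proof.
move=> bf f0 If.
have : ae_eq P setT (EFin \o f) (cst 0%E).
  apply/ae_eq_integral_abs => //; first by apply/measurable_EFinP; case: bf.
  rewrite (eq_integral (fun x => (f x)%:E)); last first.
    by move=> x _ /=; rewrite ger0_norm.
  by rewrite -expectE// If.
by apply: filterS => x /(_ I) [].
Qed.

Lemma prob_ae_eq d (T : measurableType d) (R : realType) (P : probability T R)
    (A B : set T) : measurable A -> measurable B ->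
  (\forall x \ae P, A x <-> B x) -> P A = P B.
Proof.
move=> mA mB AB; rewrite -(fine_prob P mA) -(fine_prob P mB) -!expect_indic//.
congr EFin; apply: expect_ae; [exact: bmeas_indic|exact: bmeas_indic|].
apply: filterS AB => x ABx; rewrite !indicE; congr (nat_of_bool _)%:R.
by apply/idP/idP; rewrite !inE => /ABx.
Qed.

(** * Kernels and their laws *)

Section kernel_space.
Context (R : realType) (M : pmetricType R) (hM : proper_metric M).
Local Notation PM := (pmeas M R).

Lemma measurable_kern_eval (x : M) :
  measurable_fun [set: kern_space M] (fun K : kern_space M => (K : kern M) x : borel PM).
Proof.
move=> _ B mB; rewrite setTI; apply: sub_sigma_algebra.
by exists x, B.
Qed.

Lemma measurable_to_kern d (T : measurableType d) (h : T -> kern M) :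
  (forall x, measurable_fun setT (fun t => h t x : borel PM)) ->
  measurable_fun [set: T] (h : T -> kern_space M).
Proof.
move=> mh; apply: (@measurability _ _ T (kern_space M) setT h (@kern_evals R M)) => //.
by move=> _ [_ [x [B mB ->]] <-]; exact: (mh x).
Qed.

(** Together with [measurable_pmeas_family], this identifies measurability for the Borel structure
    of the weak topology, used in the definition of kernels, with measurability of every mass, used
    by integration theory. *)
Lemma measurable_family_pmeas d (T : measurableType d) (h : T -> PM) :
  measurable_fun [set: T] (h : T -> borel PM) ->
  measurable_family (fun t => h t : probability (borel M) R).
Proof. by move=> mh U mU; exact: (measurableT_comp (measurable_pmeas_eval hM mU) mh). Qed.

Lemma measurable_pmeas_family d (T : measurableType d) (h : T -> PM) :
  measurable_family (fun t => h t : probability (borel M) R) ->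
  measurable_fun [set: T] (h : T -> borel PM).
Proof.
move=> mh; apply: (measurable_pmeasP hM) => f tf.
by have [] := rm_bmeas mh (bmeas_comp (test_bmeas tf) (@measurable_snd _ _ T (borel M))).
Qed.

Lemma expect_kern_bmeas d (T : measurableType d) (h : T -> PM) (f : M -> R) :
  measurable_fun [set: T] (h : T -> borel PM) -> bmeas (f : borel M -> R) ->
  bmeas (fun t => \int[h t]_y f y).
Proof.
move=> mh bf; have mk := measurable_family_pmeas mh.
exact: (rm_bmeas mk (bmeas_comp bf (@measurable_snd _ _ T (borel M)))).
Qed.

End kernel_space.

Lemma continuous_prod (R : realType) (T : topologicalType) (J : Type) (s : seq J)
    (g : J -> T -> R) : (forall k, continuous (g k)) ->
  continuous (fun y => \prod_(k <- s) g k y).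
Proof.
move=> cg; elim: s => [|k s IH] y.
  by under eq_fun do rewrite big_nil; exact: cvg_cst.
under eq_fun do rewrite big_cons.
by apply: cvgM; [exact: cg|exact: IH].
Qed.

(** * Spatial laws as laws of finitely many kernel values *)

Section spatial_law.
Context (R : realType) (M : pmetricType R) (hM : proper_metric M).
Local Notation PM := (pmeas M R).
Local Notation PMhat := (pmeas (compactify M) R).
Context (nu : R -> probability (kern_space M) R)
  (Pi : forall n, R -> ('I_n -> M) -> probability (npoint_space M n) R).
Hypothesis hPi : is_spatial_law nu Pi.

Lemma expect_npoint n t (x : 'I_n -> M) (f : 'I_n -> M -> R) :
  (forall k, bmeas (f k : borel M -> R)) ->
  \int[npoint nu t x]_y \prod_(k < n) f k (y k) =
  \int[nu t]_K \prod_(k < n) \int[(K : kern M) (x k)]_z f k z.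
Proof.
move=> bf; have [B hB] := proper_metric_base hM.
have mk : measurable_family (fun K : kern_space M => prod_pmeas (fun k => (K : kern M) (x k))).
  apply: (measurable_prod_pmeas hB) => k.
  exact: measurable_family_pmeas (measurable_kern_eval (x k)).
rewrite (eq_expect (Q := mixture_prob mk (nu t))); last first.
  by move=> A mA; apply: (prob_ofE (P := mixture_prob mk (nu t))).
rewrite expect_mixture//; last exact: (bmeas_coord_prod bf).
by apply: eq_Rintegral => K _; rewrite (prod_pmeas_expect hB).
Qed.

Lemma npoint_eval_measurable n (k : 'I_n) :
  measurable_fun [set: npoint_space M n] (fun v : {ptws 'I_n -> PMhat} => v k : borel PMhat).
Proof. exact: (measurable_from_borel (@coord_continuous _ (fun _ : 'I_n => PMhat) k)). Qed.

Lemma hat_expect_bmeas d (T : measurableType d) (X : T -> PMhat) f :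
  measurable_fun [set: T] (X : T -> borel PMhat) -> test_function f ->
  bmeas (fun t => \int[X t]_y hat f y).
Proof.
move=> mX tf; have bh := hat_bcontinuous tf; split.
  apply: (measurableT_comp (f := fun mu : borel PMhat => \int[(mu : PMhat)]_x hat f x)) => //.
  by apply: continuous_measurable_real; apply: expect_continuous.
have [_ [B hB]] := bh; exists B => v; apply: expect_bound => //.
exact: bcontinuous_bmeas.
Qed.

Lemma hat_var_bmeas n (k : 'I_n) f : test_function f ->
  bmeas (fun v : npoint_space M n => \int[(v : {ptws 'I_n -> PMhat}) k]_y hat f y).
Proof. by move=> tf; apply: hat_expect_bmeas => //; exact: npoint_eval_measurable. Qed.

(** The identity defining the spatial law, applied to the product of the extended test functions.
    The list [s] may repeat an index, which is what the map [i] of that definition allows, and it is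
    nonempty because [N] is positive there. *)
Lemma spatial_moment n t (x : 'I_n -> M) (s : seq ('I_n * test_type M)) :
  (0 < n)%N -> 0 <= t -> (0 < size s)%N ->
  \int[@Pi n t x]_v \prod_(a <- s) \int[(v : {ptws 'I_n -> PMhat}) a.1]_y hat (sval a.2) y =
  \int[nu t]_K \prod_(a <- s) \int[(K : kern M) (x a.1)]_y sval a.2 y.
Proof.
move=> n0 t0 s0; have [B hB] := proper_metric_base hM.
have hBh := compactify_countable_base hM hB.
pose i (k : 'I_(size s)) := (tnth (in_tuple s) k).1.
pose f (k : 'I_(size s)) := sval (tnth (in_tuple s) k).2.
have tf k : test_function (f k) by exact: svalP.
have cf k := hat_bcontinuous (tf k).
pose F (y : {ptws 'I_(size s) -> compactify M}) := \prod_(k < size s) hat (f k) (y k).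
have cF : continuous F.
  apply: (@continuous_prod _ _ _ (index_enum 'I_(size s)) (fun k (y : {ptws 'I_(size s) -> compactify M}) => hat (f k) (y k))).
  move=> k y; apply: (@continuous_comp _ _ _
      (fun y : {ptws 'I_(size s) -> compactify M} => y k) (hat (f k))).
    exact: (@coord_continuous _ (fun _ : 'I_(size s) => compactify M)).
  exact: (cf k).1.
have bfh k : bmeas (hat (f k) : borel (compactify M) -> R) by exact: bcontinuous_bmeas.
have bf k : bmeas (f k : borel M -> R) by exact: test_bmeas.
have bF : bmeas (F : borel {ptws 'I_(size s) -> compactify M} -> R).
  exact: (bmeas_coord_prod bfh).
have bFS : bmeas ((fun y => F (fun k => Some (y k))) : borel {ptws 'I_(size s) -> M} -> R).
  exact: (bmeas_coord_prod bf).
pose G (v : npoint_space M n) : R :=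
  \prod_(a <- s) \int[(v : {ptws 'I_n -> PMhat}) a.1]_y hat (sval a.2) y.
have bG : bmeas G.
  apply: (@bmeas_prod _ (npoint_space M n) R _ s
    (fun a v => \int[(v : {ptws 'I_n -> PMhat}) a.1]_y hat (sval a.2) y)) => a.
  by apply: hat_var_bmeas; exact: svalP.
have := hPi x n0 t0 i s0 cF.
rewrite (eq_integral (fun v => (G v)%:E)); last first.
  move=> v _; rewrite -expectE//.
  rewrite [X in X%:E](prod_pmeas_expect hBh _ (f := fun k => hat (f k)))//.
  by rewrite /G (big_tnth _ _ s).
rewrite -expectE// -expectE// => H; rewrite (EFin_inj H).
rewrite (expect_npoint t (fun k => x (i k)) bf).
by apply: eq_Rintegral => K _; rewrite [in RHS](big_tnth _ _ s).
Qed.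

(* The expected mass of [M] under [X] is the limit of the expectations of the
   compactly supported [bump setT j], which tend to [1] on [M]. *)
Lemma carried_ae d (T : measurableType d) (P : probability T R) (X : T -> PMhat) :
  measurable_fun [set: T] (X : T -> borel PMhat) ->
  \int[P]_t \int[X t]_y hat (bump [set: M] j) y @[j --> \oo] --> (1 : R) ->
  \forall t \ae P, X t (range Some) = 1%E.
Proof.
move=> mX h2; pose Y t := fine (X t (range Some)).
have Y01 t : 0 <= Y t <= 1.
  apply/andP; split; first by rewrite fine_ge0.
  rewrite -lee_fin (fine_prob _ (@range_Some_measurable R M)).
  by apply: probability_le1; exact: (@range_Some_measurable R M).
have tb j := bump_test hM setT j.
have bb j : bmeas (fun t => \int[X t]_y hat (bump setT j) y) by exact: hat_expect_bmeas.
have Yc t : \int[X t]_y hat (bump setT j) y @[j --> \oo] --> Y t.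
  exact: carried_cvg.
have bY : bmeas Y.
  split; last by exists 1 => t; have /andP[? ?] := Y01 t; rewrite ger0_norm.
  apply: (@measurable_fun_cvg _ T R setT (fun j t => \int[X t]_y hat (bump setT j) y)).
    by move=> j; case: (bb j).
  by move=> t _; exact: Yc.
have hb (m : PMhat) j : `|\int[m]_y hat (bump setT j) y| <= 1.
  apply: expect_bound; first exact/bcontinuous_bmeas/hat_bcontinuous.
  move=> [y|] /=; last by rewrite normr0.
  by have [_ /(_ y)/andP[? ?] _] := tb j; rewrite ger0_norm.
have EY : \int[P]_t Y t = 1.
  have h1 : \int[P]_t \int[X t]_y hat (bump setT j) y @[j --> \oo] --> \int[P]_t Y t.
    apply: (expect_cvg (B := 1)) => //.
    - by move=> j; case: (bb j).
    - by case: bY.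
    - exact: aeW.
  exact: (cvg_unique _ h1).
have b1 : bmeas (cst 1 : T -> R) by exact: bmeas_cst.
have f0 t : 0 <= 1 - Y t by have /andP[? ?] := Y01 t; rewrite subr_ge0.
have I0 : \int[P]_t (1 - Y t) = 0 by rewrite expectB// expect_cst EY subrr.
apply: filterS (expect_eq0_ae (bmeasB b1 bY) f0 I0) => t /eqP.
rewrite subr_eq0 => /eqP Y1.
by rewrite -(fine_prob _ (@range_Some_measurable R M)) -/(Y t) -Y1.
Qed.

Lemma expect_bump_family_cvg d (T : measurableType d) (P : probability T R) (h : T -> PM) :
  measurable_fun [set: T] (h : T -> borel PM) ->
  \int[P]_t \int[h t]_y bump [set: M] j y @[j --> \oo] --> (1 : R).
Proof.
move=> mh; have tb j := bump_test hM setT j.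
rewrite -(expect_cst P 1); apply: (expect_cvg (B := 1)).
- by move=> j; have [] := expect_kern_bmeas hM mh (test_bmeas (tb j)).
- exact: measurable_cst.
- move=> j t; apply: expect_bound; first exact: test_bmeas.
  by move=> y; have [_ /(_ y)/andP[? ?] _] := tb j; rewrite ger0_norm.
- apply: aeW => t; have := @expect_bump_cvg R M hM (h t) setT openT.
  by rewrite probability_setT.
Qed.

Lemma spatial_carried n t (x : 'I_n -> M) (k : 'I_n) : (0 < n)%N -> 0 <= t ->
  \forall v \ae @Pi n t x, (v : {ptws 'I_n -> PMhat}) k (range Some) = 1%E.
Proof.
move=> n0 t0; apply: carried_ae; first exact: npoint_eval_measurable.
rewrite [X in X @ _](_ : _ = fun j => \int[nu t]_K \int[(K : kern M) (x k)]_y bump setT j y).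
  exact: (expect_bump_family_cvg _ (measurable_kern_eval (x k))).
apply/funext => j; have tb := bump_test hM setT j.
have := @spatial_moment n t x [:: (k, exist _ _ tb)] n0 t0 isT.
under eq_Rintegral do rewrite big_seq1/=.
under [in RHS]eq_Rintegral do rewrite big_seq1/=.
by move=> ->.
Qed.

Lemma measurable_ptws_power n :
  measurable_fun [set: power_space 'I_n (borel PM)]
    (idfun : power_space 'I_n (borel PM) -> borel {ptws 'I_n -> PM}).
Proof.
have [B hB] := proper_metric_base hM.
apply: (@measurable_to_ptws _ _ _ _ (pmeas_countable_base hM hB)) => i.
exact: measurable_coord.
Qed.

(** Off a null set all coordinates of [v] are carried by [M], so membership in the image becomes the
    condition [U v] in [B]. The family [U v] and the values [K (x k)] have the same moments by
    [spatial_moment], hence the same law. *)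
Lemma spatial_image n t (x : 'I_n -> M) (B : set (borel {ptws 'I_n -> PM})) :
  (0 < n)%N -> 0 <= t -> measurable B ->
  @Pi n t x [set (fun k => embed (mu k)) | mu in B] =
  nu t [set K : kern_space M | B (fun k => (K : kern M) (x k))].
Proof.
move=> n0 t0 mB.
pose U (v : npoint_space M n) (k : 'I_n) : PM := unembed point ((v : {ptws 'I_n -> PMhat}) k).
pose C := [set v : npoint_space M n | forall k, (v : {ptws 'I_n -> PMhat}) k (range Some) = 1%E].
have mB' : measurable (B : set (power_space 'I_n (borel PM))).
  by have := @measurable_ptws_power n measurableT B mB; rewrite setTI.
have mU k : measurable_fun setT (fun v => U v k : borel PM).
  exact: (measurableT_comp (measurable_unembed hM point) (npoint_eval_measurable k)).
have mUB : measurable (U @^-1` B).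
  rewrite -[X in measurable X]setTI.
  by apply: (measurable_to_power mU (measurableT) mB').
have mC : measurable C.
  rewrite (_ : C = \bigcap_(k in setT) ((fun v : npoint_space M n => (v : {ptws 'I_n -> PMhat}) k) @^-1`
     [set m : borel PMhat | (m : PMhat) (range Some) = 1%E])).
    apply: fin_bigcap_measurable => // k _; rewrite -[X in measurable X]setTI.
    by apply: npoint_eval_measurable => //; exact: measurable_carried.
  by apply/seteqP; split => v h k => [_|]; [exact: h|exact: (h k I)].
have imE : [set (fun k => embed (mu k)) | mu in B] = (U @^-1` B) `&` C.
  apply/seteqP; split => [_ [mu Bmu <-]|v [BUv Cv]].
    split; last by move=> k; exact: embed_carried.
    rewrite /U /=; rewrite (_ : (fun k => _) = mu)//.
    by apply/funext => k; exact: embedK.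
  by exists (U v) => //; apply/funext => k; apply: unembedK; exact: Cv.
have aeC : \forall v \ae @Pi n t x, C v.
  have h : forall k : 'I_n, \forall v \ae @Pi n t x, (v : {ptws 'I_n -> PMhat}) k (range Some) = 1%E.
    by move=> k; exact: spatial_carried.
  exact: (@filter_forall _ _ (fun k => [set v : npoint_space M n |
    (v : {ptws 'I_n -> PMhat}) k (range Some) = 1%E]) (almost_everywhere (@Pi n t x)) _ h).
rewrite imE (@prob_ae_eq _ _ _ _ _ (U @^-1` B)) //; last 2 first.
- exact: measurableI.
- by apply: filterS aeC => v Cv; split => [[]|].
apply: (fdd_unique hM mU (fun k => measurable_kern_eval (x k))) => //.
move=> [|a s].
  under eq_Rintegral do rewrite big_nil.
  by under [in RHS]eq_Rintegral do rewrite big_nil; rewrite !expect_cst.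
rewrite -(@spatial_moment n t x (a :: s) n0 t0 isT).
apply: expect_ae.
- apply: (@bmeas_prod _ (npoint_space M n) R _ (a :: s) (fun a v => moment_var a (U v))) => b.
  exact: (bmeas_comp (moment_var_bmeas b) (measurable_to_power mU)).
- apply: (@bmeas_prod _ (npoint_space M n) R _ (a :: s) (fun a v => \int[(v : {ptws 'I_n -> PMhat}) a.1]_y hat (sval a.2) y)) => b.
  by apply: hat_var_bmeas; exact: svalP.
- apply: filterS aeC => v Cv; apply: eq_bigr => b _.
  by rewrite /moment_var /U expect_unembed//; exact: svalP.
Qed.

End spatial_law.

Lemma metrizes_ge0 (R : realType) (T : topologicalType) (d : T -> T -> R) x y :
  metrizes d -> 0 <= d x y.
Proof.
move=> hd; have := metrizes_triangle hd x y x; rewrite (metrizes_sym hd y x).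
by rewrite (_ : d x x = 0); [lra|apply/(metrizes_eq0 hd)].
Qed.

Lemma metrizes_hausdorff (R : realType) (T : topologicalType) (d : T -> T -> R) :
  metrizes d -> hausdorff_space T.
Proof.
move=> hd p q pq; apply/(metrizes_eq0 hd).
have d0 x y : 0 <= d x y by exact: metrizes_ge0.
apply/eqP; rewrite eq_le d0 andbT leNgt; apply/negP => e0.
pose V x := [set y | d x y < d p q / 2].
have nV x : nbhs x (V x).
  by apply/(metrizes_nbhs hd); exists (d p q / 2) => //; rewrite divr_gt0.
have [y [py qy]] := pq _ _ (nV p) (nV q).
have := metrizes_triangle hd p y q; rewrite (metrizes_sym hd y q).
by move: py qy; rewrite /V/=; lra.
Qed.

(** * Limits and limit points of sequences *)

Section sequence_limits.
Context (T : topologicalType).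
Hypothesis hT : hausdorff_space T.

(** The range with the limit added is compact: a proper filter on it that does not cluster at [l]
    contains a finite set of terms. *)
Lemma cvg_precompact (u : nat -> T) (l : T) : u @ \oo --> l -> precompact (range u).
Proof.
move=> ul; pose A := range u `|` [set l].
have cA : compact A.
  move=> F PF FA; have [cl|] := pselect (cluster F l); first by exists l; split => //; right.
  move=> /existsNP[G /existsNP[V /not_implyP[FG /not_implyP[lV /nonemptyPn GV]]]].
  have [N _ hN] := ul V lV.
  have FN : F (u @` `I_N).
    apply: filterS (filterI FG FA) => x [Gx [[n _ xE]|/= xE]]; subst x.
      exists n => //=; rewrite ltnNge; apply/negP => Nn.
      by have : set0 (u n) by rewrite -GV; split; [exact: Gx|exact: (hN n Nn)].
    by exfalso; have : set0 l by rewrite -GV; split; [exact: Gx|exact: nbhs_singleton].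
  have [|x [[n _ <-] cx]] := @finite_compact _ (u @` `I_N) _ F PF FN.
    by apply: finite_image; exact: finite_II.
  by exists (u n); split => //; left; exists n.
exists A; first by move=> x ?; left.
by split => //; exact: compact_closed.
Qed.

Lemma cvg_cluster_unique (u : nat -> T) (l l' : T) : u @ \oo --> l ->
  cluster (u @ \oo) l' -> l' = l.
Proof. by move=> ul cl; apply/esym/hT; exact: (cvg_cluster ul). Qed.

End sequence_limits.

(** * Mixtures, joint measurability and composition of kernels *)

Section mixing.
Context (R : realType) (M : pmetricType R) (hM : proper_metric M).
Local Notation PM := (pmeas M R).

(** The common body of [kern_comp] at a point and of [kact]; here [k] is a plain function, so that
    it can be a section of a jointly measurable map. *)
Definition mixpm (mu : PM) (k : M -> PM) : PM :=
  prob_of (fun B => \int[mu]_y k y B)%E.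

Lemma mixpmE (mu : PM) (k : M -> PM) (A : set (borel M)) :
  measurable_fun [set: borel M] (k : borel M -> borel PM) -> measurable A ->
  mixpm mu k A = (\int[mu]_y k y A)%E.
Proof.
move=> mk; move: A.
exact: (prob_ofE (P := mixture_prob (measurable_family_pmeas hM mk) mu)).
Qed.

Lemma expect_mixpm (mu : PM) (k : M -> PM) (f : M -> R) :
  measurable_fun [set: borel M] (k : borel M -> borel PM) ->
  bmeas (f : borel M -> R) ->
  \int[mixpm mu k]_x f x = \int[mu]_y \int[k y]_x f x.
Proof.
move=> mk bf; rewrite -(expect_mixture (measurable_family_pmeas hM mk))//.
by apply: eq_expect => A mA; rewrite mixpmE.
Qed.

Lemma measurable_mixpm d (T : measurableType d) (k1 : T -> PM) (k2 : T * M -> PM) :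
  measurable_fun [set: T] (k1 : T -> borel PM) ->
  measurable_fun [set: T * borel M] (k2 : T * borel M -> borel PM) ->
  measurable_fun [set: T] (fun t => mixpm (k1 t) (fun y => k2 (t, y)) : borel PM).
Proof.
move=> mk1 mk2; apply: (measurable_pmeas_family hM) => U mU.
have mk1' := measurable_family_pmeas hM mk1.
have mk2' := measurable_family_pmeas hM mk2.
have := rm_measurable_integral mk1' (f := fun p => k2 p U).
move=> /(_ (fun p => measure_ge0 _ _) (mk2' U mU)).
apply: eq_measurable_fun => t _; rewrite mixpmE//.
exact: (measurableT_comp mk2 (pair1_measurable t)).
Qed.

(** Stronger than measurability into [kern_space], which treats each point separately. It is what
    the second factor of a composition has to satisfy for the composition to be measurable. *)
Definition jmeas d (T : measurableType d) (K : T -> kern M) :=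
  measurable_fun [set: T * borel M] (fun p => K p.1 p.2 : borel PM).

Lemma jmeas_eval d (T : measurableType d) (K : T -> kern M) x :
  jmeas K -> measurable_fun [set: T] (fun t => K t x : borel PM).
Proof. by move=> mK; exact: (measurableT_comp (f := fun p : T * borel M => K p.1 p.2 : borel PM) mK
  (pair2_measurable (x : borel M))). Qed.

Lemma jmeas_cst d (T : measurableType d) (K : kern M) : jmeas (fun _ : T => K).
Proof. exact: (measurableT_comp (kern_meas K) (@measurable_snd _ _ T (borel M))). Qed.

Lemma jmeas_precomp d d' (T : measurableType d) (T' : measurableType d')
    (K : T -> kern M) (f : T' -> T) :
  measurable_fun setT f -> jmeas K -> jmeas (fun t => K (f t)).
Proof.
move=> mf mK.
have mg : measurable_fun [set: T' * borel M] (fun p => (f p.1, p.2)).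
  by apply: measurable_fun_pair => //; exact: (measurableT_comp mf measurable_fst).
exact: (measurableT_comp (f := fun p : T * borel M => K p.1 p.2 : borel PM) mK mg).
Qed.

Lemma kern_compE (K1 K2 : kern M) x : kern_comp K1 K2 x = mixpm (K1 x) K2.
Proof.
rewrite /kern_comp kern_ofE//.
apply: (@measurable_mixpm _ (borel M) K1 (fun p => K2 p.2)); first exact: kern_meas.
exact: (measurableT_comp (kern_meas K2) (@measurable_snd _ _ (borel M) (borel M))).
Qed.

Lemma measurable_kern_comp d (T : measurableType d) (K1 K2 : T -> kern M) x :
  measurable_fun [set: T] (fun t => K1 t x : borel PM) -> jmeas K2 ->
  measurable_fun [set: T] (fun t => kern_comp (K1 t) (K2 t) x : borel PM).
Proof.
move=> mK1 mK2; have := measurable_mixpm mK1 mK2.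
by apply: eq_measurable_fun => t _; rewrite kern_compE.
Qed.

Lemma jmeas_comp d (T : measurableType d) (K1 K2 : T -> kern M) :
  jmeas K1 -> jmeas K2 -> jmeas (fun t => kern_comp (K1 t) (K2 t)).
Proof.
move=> mK1 mK2.
have mK2' : measurable_fun [set: (T * borel M) * borel M]
    (fun p => K2 p.1.1 p.2 : borel PM).
  have mg : measurable_fun [set: (T * borel M) * borel M] (fun p => (p.1.1, p.2)).
    by apply: measurable_fun_pair => //; exact: (measurableT_comp measurable_fst measurable_fst).
  exact: (measurableT_comp (f := fun p : T * borel M => K2 p.1 p.2 : borel PM) mK2 mg).
have := measurable_mixpm mK1 mK2'.
by apply: eq_measurable_fun => t _; rewrite kern_compE.
Qed.

Lemma expect_kern_comp (K1 K2 : kern M) x (f : M -> R) : bmeas (f : borel M -> R) ->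
  \int[kern_comp K1 K2 x]_y f y = \int[K1 x]_y \int[K2 y]_z f z.
Proof. by move=> bf; rewrite kern_compE expect_mixpm//; exact: kern_meas. Qed.

Lemma expect_pdirac (x : M) (f : M -> R) : bmeas (f : borel M -> R) ->
  \int[pdirac x : PM]_y f y = f x.
Proof.
move=> [mf _]; rewrite (eq_expect (Q := \d_(x : borel M))).
  rewrite /Rintegral integral_dirac ?diracT ?mul1e//.
  exact/measurable_EFinP.
by move=> A mA; rewrite /pdirac trimE.
Qed.

Lemma pdirac_continuous : continuous (pdirac : M -> PM).
Proof.
move=> x.
have FF : Filter ((pdirac : M -> PM) @ nbhs x) by exact: fmap_filter.
apply: (pmeas_cvg FF) => f bf; have [cf _] := bf.
rewrite expect_pdirac; last exact: bcontinuous_bmeas.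
move=> V hV; apply: (@filterS _ (nbhs x) _ _ _ _ (cf x V hV)) => y /=.
by rewrite expect_pdirac//; exact: bcontinuous_bmeas.
Qed.

Lemma kdeltaE x : kdelta M x = pdirac x.
Proof.
rewrite /kdelta kern_ofE//.
exact: (measurable_from_borel pdirac_continuous).
Qed.

Lemma kern_comp_kdelta (K : kern M) : kern_comp K (kdelta M) =1 K.
Proof.
move=> x; rewrite kern_compE; apply: pmeasP => A mA.
rewrite mixpmE//; last exact: kern_meas.
rewrite (eq_integral (fun y => (\1_A y)%:E)); last first.
  by move=> y _; rewrite kdeltaE /pdirac trimE// indicE.
by rewrite integral_indic// setIT.
Qed.

End mixing.

Lemma kern_ext (R : realType) (M : pmetricType R) (K1 K2 : kern M) : K1 =1 K2 -> K1 = K2.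
Proof.
move: K1 K2 => [k1 m1] [k2 m2] /= /funext k12; subst k2.
by congr Kern; exact: Prop_irrelevance.
Qed.

Lemma leastP (A : set nat) : A !=set0 -> A (least A) /\ forall m, A m -> (least A <= m)%N.
Proof.
move=> [n An]; rewrite /least; case: xgetP => [m _ //|].
have ex : exists n, `[< A n >] by exists n; exact/asboolP.
case: (ex_minnP ex) => m /asboolP Am hm /(_ m) []; split => // k Ak.
by apply: hm; exact/asboolP.
Qed.

(** * Interpolation of kernels from a dense sequence *)

Section interpolation.
Context (R : realType) (M : pmetricType R) (hM : proper_metric M).
Local Notation PM := (pmeas M R).
Context (I : set nat) (z : I -> M) (eps : nat -> R) (ell : (nat -> PM) -> PM).
Hypothesis hPM : hausdorff_space PM.
Hypotheses (zinj : injective z) (zdense : dense (range z)).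
Hypotheses (eps_gt0 : forall j, 0 < eps j.+1) (eps_cvg : eps @ \oo --> 0).
Hypothesis hell : limit_selection ell.

Lemma first_indexP (x : M) j :
  { m : I | [/\ \val m = first_index z eps x j.+1, mdist x (z m) < eps j.+1 / 2 &
    forall m' : I, mdist x (z m') < eps j.+1 / 2 -> (\val m <= \val m')%N] }.
Proof.
apply: cid.
have e0 : 0 < eps j.+1 / 2 by rewrite divr_gt0.
have [y [/= xy [m _ zm]]] : ([set y | mdist x y < eps j.+1 / 2] `&` range z) !=set0.
  apply: zdense; last exact: open_mdist_lt.
  by exists x => /=; rewrite mdistxx.
have [|[m' /= xm' m'E] h] := @leastP [set \val m | m in [set m : I | mdist x (z m) < eps j.+1 / 2]].
  by exists (\val m); exists m => //=; rewrite zm; exact: xy.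
exists m'; split; [exact: m'E|exact: xm'|].
by move=> m'' xm''; have := h (\val m''); rewrite -m'E; apply; exists m''.
Qed.

Lemma eps_shift : eps j.+1 @[j --> \oo] --> (0 : R).
Proof. by rewrite (cvg_shiftS eps). Qed.

Definition nearest (x : M) j : I := sval (first_indexP x j).

(** Density of the sequence ensures that the first index exists and lies in [I], so the default
    value [point] never occurs. *)
Lemma nearest_insub (mu : I -> PM) x j :
  oapp mu point (insub (first_index z eps x j.+1)) = mu (nearest x j).
Proof.
by rewrite /nearest; case: first_indexP => m [E _ _] /=; move: E; move: first_index => F <-; rewrite valK.
Qed.

Lemma nearest_mdist x j : mdist x (z (nearest x j)) < eps j.+1 / 2.
Proof. by rewrite /nearest; case: first_indexP => m []. Qed.

Lemma nearest_eq x j i : nearest x j = i <-> mdist x (z i) < eps j.+1 / 2 /\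
  forall m : I, (\val m < \val i)%N -> ~ (mdist x (z m) < eps j.+1 / 2).
Proof.
rewrite /nearest; case: first_indexP => m [_ xm hm] /=; split=> [<-|[xi hi]].
  by split => // m' m'm /hm; rewrite leqNgt m'm.
apply: val_inj; apply/eqP; rewrite eqn_leq hm//= leqNgt; apply/negP => mi.
exact: (hi _ mi).
Qed.

(** The set is a ball minus the finitely many balls around points of smaller index; [insub] skips
    the numbers outside [I]. *)
Lemma measurable_nearest j i : measurable [set x : borel M | nearest x j = i].
Proof.
have mo (y : M) : measurable [set x : borel M | mdist x y < eps j.+1 / 2].
  rewrite (_ : mkset _ = [set x : M | mdist y x < eps j.+1 / 2]).
    by apply: open_borel; exact: open_mdist_lt.
  by apply/seteqP; split => x /=; rewrite metric_sym.
rewrite (_ : mkset _ = [set x : borel M | mdist x (z i) < eps j.+1 / 2] `&`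
  \bigcap_(n in `I_(\val i)) (if insub n is Some m then
     ~` [set x : borel M | mdist x (z m) < eps j.+1 / 2] else setT)).
  apply: measurableI => //; apply: fin_bigcap_measurable; first exact: finite_II.
  by move=> n _; case: insubP => [m _ _|//]; apply: measurableC.
apply/seteqP; split => x /=; rewrite nearest_eq => -[xi h]; split => //.
  by move=> n /= ni; case: insubP => [m _ mn|//] /=; apply: h; rewrite mn.
move=> m mi; have := h (\val m) mi; rewrite valK.
exact.
Qed.

Lemma nearest_cvg x : z (nearest x j) @[j --> \oo] --> x.
Proof.
apply/metricType_numDomainType.cvgrPdist_lt => e e0.
have : \forall j \near \oo, eps j.+1 < e.
  exact: (cvgr_lt _ eps_shift).
apply: filterS => j ej; rewrite (lt_trans (nearest_mdist x j))// (le_lt_trans _ ej)//.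
by rewrite ler_pdivrMr// ler_peMr// ?ler1n// ltW.
Qed.

(** Only finitely many indices precede [i], and by injectivity their points are at positive distance
    from [z i]; as soon as [eps] is below these distances, none of them is selected. *)
Lemma nearest_z i : \forall j \near \oo, nearest (z i) j = i.
Proof.
have h (k : 'I_(\val i)) : \forall j \near \oo, forall m : I, \val m = k ->
    ~ (mdist (z i) (z m) < eps j.+1 / 2).
  have [[m mk]|nm] := pselect (exists m : I, \val m = k); last first.
    by apply: nearW => j m mk; exfalso; apply: nm; exists m.
  have d0 : 0 < mdist (z i) (z m).
    rewrite mdist_gt0; apply/eqP => /zinj im.
    by have := ltn_ord k; rewrite -mk -im ltnn.
  have : \forall j \near \oo, eps j.+1 < mdist (z i) (z m).
    exact: (cvgr_lt _ eps_shift).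
  apply: filterS => j hj m' m'k; have -> : m' = m by apply: val_inj; rewrite m'k.
  apply/negP; rewrite -leNgt (le_trans _ (ltW hj))//.
  by rewrite ler_pdivrMr// ler_peMr// ?ler1n// ltW.
have hf := @filter_forall _ _ (fun k : 'I_(\val i) => [set j | forall m : I,
  \val m = k -> ~ (mdist (z i) (z m) < eps j.+1 / 2)]) \oo _ h.
apply: filterS (hf _) => j hj; apply/nearest_eq; split.
  by rewrite mdistxx divr_gt0.
by move=> m mi; apply: (hj (Ordinal mi)).
Qed.

Lemma jmeas_nearest d (T : measurableType d) (mu : T -> I -> PM) j :
  (forall i, measurable_fun [set: T] (fun t => mu t i : borel PM)) ->
  measurable_fun [set: T * borel M] (fun p => mu p.1 (nearest p.2 j) : borel PM).
Proof.
move=> mmu _ B mB; rewrite setTI.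
rewrite (_ : _ @^-1` _ = \bigcup_n (if insub n is Some i then
   (fun t => mu t i : borel PM) @^-1` B `*` [set x : borel M | nearest x j = i] else set0)).
  apply: bigcupT_measurable => n; case: insubP => [i _ _|//].
  apply: measurableX; last exact: measurable_nearest.
  by rewrite -[X in measurable X]setTI; exact: mmu.
apply/seteqP; split => -[t x] /=.
  by move=> Bx; exists (\val (nearest x j)) => //; rewrite valK.
by move=> [n _]; case: insubP => //= i _ _ [/= Bx ->].
Qed.

Lemma jmeas_select d (T : measurableType d) (mu : T -> I -> PM) :
  (forall i, measurable_fun [set: T] (fun t => mu t i : borel PM)) ->
  measurable_fun [set: T * borel M]
    (fun p => ell (fun j => mu p.1 (nearest p.2 j)) : borel PM).
Proof.
move=> mmu.
have m1 : measurable_fun [set: T * borel M]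
    (fun p => (fun j => mu p.1 (nearest p.2 j)) : power_space nat (borel PM)).
  by apply: measurable_to_power => j; exact: jmeas_nearest.
exact: (measurableT_comp hell.1 m1).
Qed.

Lemma ikernE (mu : I -> PM) x :
  ikern z eps ell mu x = ell (fun j => mu (nearest x j)).
Proof.
rewrite /ikern.
rewrite (_ : (fun x => _) = (fun x => ell (fun j => mu (nearest x j)))); last first.
  by apply/funext => y; congr ell; apply/funext => j; rewrite nearest_insub.
rewrite kern_ofE//.
have := @jmeas_select _ unit (fun _ => mu) (fun i => measurable_cst _).
by move=> h; exact: (measurableT_comp h (@pair1_measurable _ _ unit (borel M) tt)).
Qed.

Lemma jmeas_ikern d (T : measurableType d) (mu : T -> I -> PM) :
  (forall i, measurable_fun [set: T] (fun t => mu t i : borel PM)) ->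
  jmeas (fun t => ikern z eps ell (mu t)).
Proof.
move=> mmu; have := jmeas_select mmu.
by apply: eq_measurable_fun => -[t x] _ /=; rewrite ikernE.
Qed.

(** The gain from interpolation: the family [K] is measurable at each point only, while its
    interpolation depends on countably many values of [K] and is jointly measurable. *)
Lemma jmeas_pkern d (T : measurableType d) (K : T -> kern M) :
  (forall x, measurable_fun [set: T] (fun t => K t x : borel PM)) ->
  jmeas (fun t => pkern z eps ell (K t)).
Proof. by move=> mK; apply: jmeas_ikern => i; exact: mK. Qed.

Lemma ell_cvg (u : nat -> PM) (l : PM) : u @ \oo --> l -> ell u = l.
Proof.
move=> ul; apply: (cvg_cluster_unique hPM ul).
by apply: hell.2; exact: (cvg_precompact hPM ul).
Qed.

Lemma ikern_cvg (mu : I -> PM) x l : mu (nearest x j) @[j --> \oo] --> (l : PM) ->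
  ikern z eps ell mu x = l.
Proof. by move=> h; rewrite ikernE; exact: ell_cvg. Qed.

Lemma ikern_z (mu : I -> PM) i : ikern z eps ell mu (z i) = mu i.
Proof.
apply: ikern_cvg => V /nbhs_singleton Vi.
by apply: filterS (nearest_z i) => j /= ->.
Qed.

Lemma ikernK (mu : I -> PM) : ekern z (ikern z eps ell mu) = mu.
Proof. by apply/funext => i; rewrite /ekern ikern_z. Qed.

Lemma pkern_pkern (K : kern M) :
  pkern z eps ell (pkern z eps ell K) = pkern z eps ell K.
Proof. by rewrite {1}/pkern {1}/pkern ikernK. Qed.

Lemma pkern_kdelta : pkern z eps ell (kdelta M) = kdelta M.
Proof.
apply: kern_ext => x; apply: ikern_cvg; rewrite kdeltaE// /ekern.
move=> V hV.
apply: (@filterS _ \oo _ _ _ _ (@nearest_cvg x _ (@pdirac_continuous R M x V hV))) => j /=.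
by rewrite kdeltaE.
Qed.

End interpolation.

(** * Borel-Cantelli and measurability of distances *)

Lemma half_pow_lt (R : realType) (e : R) : 0 < e ->
  exists N : nat, forall j, (N <= j)%N -> 2 ^- j < e.
Proof.
move=> e0; have e1 : 0 < e^-1 by rewrite invr_gt0.
have [N _ hN] : \forall N \near \oo, e^-1 < N%:R by exact: nbhs_infty_gtr.
exists N => j Nj; rewrite -[e]invrK ltf_pV2 ?posrE ?exprn_gt0//.
rewrite (lt_trans (hN j _))//= -natrX ltr_nat.
exact: ltn_expl.
Qed.

Lemma borel_cantelli_half d (T : measurableType d) (R : realType) (P : probability T R)
    (F : nat -> set T) : (forall j, measurable (F j)) ->
  (\forall j \near \oo, (P (F j) <= (2 ^- j)%:E)%E) ->
  \forall x \ae P, \forall j \near \oo, ~ F j x.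
Proof.
(* After the shift by [N.+1] the probabilities are bounded by the terms [2 ^- (k + N.+1)] of a
   geometric series with sum [2 ^- N]. *)
move=> mF [N _ hN]; pose G k := F (k + N.+1)%N.
have PG : P (lim_sup_set G) = 0%E.
  apply: lim_sup_set_cvg0; first by move=> k; exact: mF.
  have h := @cvg_geometric_eseries_half R 1 N.
  apply: (@le_lt_trans _ _ (1 / 2 ^+ N)%:E); last exact: ltry.
  rewrite -(cvg_lim _ h)//; apply: lee_nneseries => k //.
  move=> _; rewrite (le_trans (hN _ _))//=.
    by rewrite (leq_trans (leqnSn N))// leq_addl.
  by rewrite lee_fin div1r natrX.
exists (lim_sup_set G); split => //.
  by apply: bigcap_measurableType => n _; apply: bigcup_measurable => k _; exact: mF.
move=> x; apply: contra_notP => nG.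
have [n hn] : exists n, forall k, (n <= k)%N -> ~ G k x.
  apply: contrapT => h; apply: nG => n _; apply: contrapT => h2; apply: h.
  by exists n => k nk Gk; apply: h2; exists k.
exists (n + N.+1)%N => // j /= nj Fj.
have Nj : (N.+1 <= j)%N by rewrite (leq_trans _ nj)// leq_addl.
apply: (hn (j - N.+1)%N); first by rewrite -(leq_add2r N.+1) subnK.
by rewrite /G subnK.
Qed.

Lemma metrizes_cvg (R : realType) (T : topologicalType) (d : T -> T -> R)
    (F : set_system T) (l : T) : metrizes d -> Filter F ->
  (forall e, 0 < e -> F [set y | d l y < e]) -> F --> l.
Proof.
move=> hd FF h V /(metrizes_nbhs hd)[e e0 eV].
exact: (filterS eV (h e e0)).
Qed.

(** The event that the distance is below [c] is a union over the countably many pairs of basic sets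
    on which the distance stays below [c]. The map [e] covers both the identity and [embed], so
    distances in the compactification are handled with a base of the measures on [M]. *)
Lemma measurable_metric (R : realType) (X : ptopologicalType) (Y : topologicalType)
    (K : countType) (B : K -> set X) (dist : Y -> Y -> R) (e : X -> Y)
    d (T : measurableType d) (h1 h2 : T -> X) :
  countable_base B -> metrizes dist -> continuous e ->
  measurable_fun setT (h1 : T -> borel X) -> measurable_fun setT (h2 : T -> borel X) ->
  measurable_fun setT (fun t => dist (e (h1 t)) (e (h2 t))).
Proof.
move=> hB hd ce m1 m2; apply: measurable_fun_lt => c.
pose S (p : K * K) := forall x y, B p.1 x -> B p.2 y -> dist (e x) (e y) < c.
rewrite (_ : mkset _ = \bigcup_p (if `[< S p >] then
    (h1 @^-1` B p.1) `&` (h2 @^-1` B p.2) else set0)).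
  apply: countType_bigcup_measurable => p; case: asboolP => // _; apply: measurableI.
    rewrite -[X in measurable X]setTI; apply: m1 => //.
    by apply: open_borel; have [] := hB.
  rewrite -[X in measurable X]setTI; apply: m2 => //.
  by apply: open_borel; have [] := hB.
apply/seteqP; split => t /=; last first.
  by move=> [p _]; case: asboolP => // h [] /h; apply.
move=> tc; pose r := (c - dist (e (h1 t)) (e (h2 t))) / 2.
have r0 : 0 < r by rewrite divr_gt0// subr_gt0.
have nb x : nbhs x [set y | dist (e x) (e y) < r].
  by apply: (ce x [set y | dist (e x) y < r]); apply/(metrizes_nbhs hd); exists r.
have [k k1 hk] := hB.2 _ _ (nb (h1 t)).
have [l l1 hl] := hB.2 _ _ (nb (h2 t)).
exists (k, l) => //; rewrite asboolT//= => x y /hk/= hx /hl/= hy.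
have := metrizes_triangle hd (e x) (e (h1 t)) (e y).
have := metrizes_triangle hd (e (h1 t)) (e (h2 t)) (e y).
rewrite (metrizes_sym hd (e x) (e (h1 t))).
move: hx hy; rewrite /r; lra.
Qed.

Lemma measurable_pmeas_dist (R : realType) (M : pmetricType R) (hM : proper_metric M)
    (dist : pmeas M R -> pmeas M R -> R) d (T : measurableType d) (h1 h2 : T -> pmeas M R) :
  metrizes dist ->
  measurable_fun setT (h1 : T -> borel (pmeas M R)) ->
  measurable_fun setT (h2 : T -> borel (pmeas M R)) ->
  measurable_fun setT (fun t => dist (h1 t) (h2 t)).
Proof.
have [B hB] := proper_metric_base hM => hd.
exact: (measurable_metric (pmeas_countable_base hM hB) hd (fun x => @cvg_id _ _)).
Qed.

(** * Finite rectangles in power spaces *)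

Section finite_rectangles.
Context (J : eqType) d (T : measurableType d).

Definition finite_rectangles : set (set (power_space J T)) :=
  [set A | exists F : seq J, exists2 C : J -> set T, (forall j, measurable (C j)) &
    A = [set w | forall j, j \in F -> C j (w j)]].

Lemma finite_rectangles_uniq A : finite_rectangles A ->
  exists2 F : seq J, uniq F & exists2 C : J -> set T, (forall j, measurable (C j)) &
    A = [set w | forall j, j \in F -> C j (w j)].
Proof.
move=> [F [C mC ->]]; exists (undup F); first exact: undup_uniq.
by exists C => //; apply/seteqP; split => w /= h j; rewrite ?mem_undup => jF; apply: h; rewrite ?mem_undup.
Qed.

Lemma finite_rectangles_setI : setI_closed finite_rectangles.
Proof.
move=> _ _ [F [C mC ->]] [F' [C' mC' ->]].
exists (F ++ F'), (fun j => (if j \in F then C j else setT) `&` (if j \in F' then C' j else setT)).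
  by move=> j; apply: measurableI; case: ifP.
apply/seteqP; split => w /= => [[h1 h2] j _|h].
  by split; case: ifP => //; [exact: h1|exact: h2].
split=> j jF.
  by have [] := h j; [rewrite mem_cat jF|rewrite jF].
by have [] := h j; [rewrite mem_cat jF orbT|rewrite jF].
Qed.

Lemma finite_rectangles_generate :
  @measurable _ (power_space J T) = <<s finite_rectangles >>.
Proof.
apply/seteqP; split.
  apply: smallest_sub; first exact: (@sigma_algebra_measurable _ (g_sigma_algebraType finite_rectangles)).
  move=> _ [j [B mB ->]]; apply: sub_sigma_algebra.
  exists [:: j], (fun=> B) => //.
  apply/seteqP; split => w /=; first by move=> h k; rewrite inE => /eqP ->.
  by apply; rewrite inE.
apply: smallest_sub; first exact: sigma_algebra_measurable.
move=> _ [F [C mC ->]]; elim: F => [|j F IH].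
  by rewrite (_ : mkset _ = setT)//; apply/seteqP; split.
rewrite (_ : mkset _ = (fun w : power_space J T => w j) @^-1` C j `&` [set w | forall j, j \in F -> C j (w j)]).
  by apply: measurableI => //; rewrite -[X in measurable X]setTI; apply: measurable_coord.
apply/seteqP; split => w /=.
  by move=> h; split => [|k kF]; apply: h; rewrite inE ?eqxx// kF orbT.
by move=> [h1 h2] k; rewrite inE => /predU1P[->//|]; exact: h2.
Qed.

End finite_rectangles.

(** * Laws of random kernels and their moments *)

(** Telescoping: the factors are replaced one at a time, and all the others lie in [[0, 1]]. *)
Lemma prod_sub_le (R : realType) (J : Type) (s : seq J) (X Y : J -> R) :
  (forall a, 0 <= X a <= 1) -> (forall a, 0 <= Y a <= 1) ->
  `|\prod_(a <- s) X a - \prod_(a <- s) Y a| <= \sum_(a <- s) `|X a - Y a|.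
Proof.
move=> X1 Y1; elim: s => [|a s IH]; first by rewrite !big_nil subrr normr0.
rewrite !big_cons.
have P1 (Z : J -> R) : (forall a, 0 <= Z a <= 1) -> `|\prod_(a <- s) Z a| <= 1.
  move=> hZ; rewrite ger0_norm; first by apply: prodr_ile1 => b _.
  by apply: prodr_ge0 => b _; have /andP[] := hZ b.
rewrite (_ : _ - _ = (X a - Y a) * \prod_(j <- s) X j +
    Y a * (\prod_(j <- s) X j - \prod_(j <- s) Y j)); last by ring.
rewrite (le_trans (ler_normD _ _))// lerD// normrM.
  by rewrite -[leRHS]mulr1 ler_wpM2l// P1.
rewrite (le_trans _ IH)// -[leRHS]mul1r ler_wpM2r//.
by have /andP[? ?] := Y1 a; rewrite ger0_norm.
Qed.

Section kernel_laws.
Context (R : realType) (M : pmetricType R) (hM : proper_metric M).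
Local Notation PM := (pmeas M R).

(** The sigma-field on kernels is the trace of the product sigma-algebra over [M], so [fdd_unique]
    applies with index set [M]. *)
Lemma kern_space_preimage (A : set (kern_space M)) : measurable A ->
  exists2 C : set (power_space M (borel PM)), measurable C &
    A = [set K : kern_space M | C ((K : kern M) : M -> PM)].
Proof.
move: A; apply: smallest_sub; last first.
  move=> _ [x [B mB ->]]; exists ((fun w : power_space M (borel PM) => w x) @^-1` B) => //.
  by rewrite -[X in measurable X]setTI; apply: measurable_coord.
split.
- by exists set0 => //; apply/seteqP; split.
- move=> _ [C mC ->]; exists (~` C); first exact: measurableC.
  by apply/seteqP; split => K //= [].
- move=> F hF; pose C n := sval (cid2 (hF n)).
  have mC n : measurable (C n) by rewrite /C; case: cid2.
  have FE n : F n = [set K : kern_space M | C n ((K : kern M) : M -> PM)].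
    by rewrite /C; case: cid2.
  exists (\bigcup_n C n); first exact: bigcupT_measurable.
  by apply/seteqP; split => K [n _ h]; exists n => //; move: h; rewrite FE.
Qed.

Definition kern_moment (s : seq (M * test_type M)) (K : kern M) : R :=
  \prod_(a <- s) \int[K a.1]_y sval a.2 y.

Lemma test_expect_itv (mu : PM) (f : M -> R) : test_function f ->
  0 <= \int[mu]_y f y <= 1.
Proof.
move=> tf; have [_ f01 _] := tf; apply/andP; split.
  by apply: expect_ge0 => y; have /andP[] := f01 y.
rewrite -[leRHS](expect_cst mu); apply: expect_le => //.
- exact: test_bmeas.
- exact: bmeas_cst.
- by move=> y; have /andP[] := f01 y.
Qed.

Lemma kern_moment_bmeas d (T : measurableType d) (h : T -> kern M) s :
  (forall x, measurable_fun setT (fun t => h t x : borel PM)) ->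
  bmeas (fun t => kern_moment s (h t)).
Proof.
move=> mh; apply: (@bmeas_prod _ T R _ s (fun a t => \int[h t a.1]_y sval a.2 y)) => a.
by apply: expect_kern_bmeas => //; apply: test_bmeas; exact: svalP.
Qed.

Lemma kern_law_unique d1 d2 (T1 : measurableType d1) (T2 : measurableType d2)
    (P : probability T1 R) (Q : probability T2 R) (h1 : T1 -> kern M) (h2 : T2 -> kern M) :
  (forall x, measurable_fun setT (fun t => h1 t x : borel PM)) ->
  (forall x, measurable_fun setT (fun t => h2 t x : borel PM)) ->
  (forall s, \int[P]_t kern_moment s (h1 t) = \int[Q]_t kern_moment s (h2 t)) ->
  forall A : set (kern_space M), measurable A ->
    P [set t | A (h1 t)] = Q [set t | A (h2 t)].
Proof.
move=> m1 m2 mom A /kern_space_preimage[C mC ->].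
exact: (fdd_unique hM (xi := fun t => h1 t : M -> PM) (eta := fun t => h2 t : M -> PM) m1 m2 mom mC).
Qed.

Lemma kern_moment_ae d (T : measurableType d) (P : probability T R) (h1 h2 : T -> kern M) s :
  (forall x, \forall t \ae P, h1 t x = h2 t x) ->
  \forall t \ae P, kern_moment s (h1 t) = kern_moment s (h2 t).
Proof.
move=> h12; elim: s => [|a s IH]; first by apply: aeW => t; rewrite /kern_moment !big_nil.
apply: filterS2 (h12 a.1) IH => t; rewrite /kern_moment !big_cons => -> ->.
by [].
Qed.

(** Each moment involves finitely many points, so equality almost surely at every fixed point is
    enough, although the null set depends on the point. *)
Lemma kern_law_ae d (T : measurableType d) (P : probability T R) (h1 h2 : T -> kern M) :
  (forall x, measurable_fun setT (fun t => h1 t x : borel PM)) ->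
  (forall x, measurable_fun setT (fun t => h2 t x : borel PM)) ->
  (forall x, \forall t \ae P, h1 t x = h2 t x) ->
  forall A : set (kern_space M), measurable A ->
    P [set t | A (h1 t)] = P [set t | A (h2 t)].
Proof.
move=> m1 m2 h12; apply: kern_law_unique => // s.
apply: expect_ae; [exact: kern_moment_bmeas|exact: kern_moment_bmeas|].
exact: kern_moment_ae.
Qed.

Lemma law_moment d (T : measurableType d) (P : probability T R)
    (Q : probability (kern_space M) R) (h : T -> kern M) s :
  (forall x, measurable_fun setT (fun t => h t x : borel PM)) ->
  (forall A : set (kern_space M), measurable A -> P [set t | A (h t)] = Q A) ->
  \int[P]_t kern_moment s (h t) = \int[Q]_K kern_moment s K.
Proof.
move=> mh hA; have mh' := measurable_to_kern mh.
have bs : bmeas (kern_moment s : kern_space M -> R).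
  by apply: kern_moment_bmeas => x; exact: measurable_kern_eval.
rewrite -(expect_law P mh' bs); apply: eq_expect => A mA.
by rewrite lawE// -hA.
Qed.

End kernel_laws.

Section exhaustions.
Context (R : realType) (M : pmetricType R) (L : nat -> set M).
Hypothesis hL : is_exhaustion L.

Lemma exhaustion_cover x : exists2 j, (0 < j)%N & L j x.
Proof.
have [_ LT _] := hL; have : [set: M] x by [].
by rewrite LT => -[j /= ? ?]; exists j.
Qed.

Lemma exhaustion_mono i j : (0 < i)%N -> (i <= j)%N -> L i `<=` L j.
Proof.
have [_ _ Li] := hL; move=> i0; elim: j => [|j IH]; first by rewrite leqNgt i0.
rewrite leq_eqVlt => /predU1P[->//|]; rewrite ltnS => ij.
move=> x /(IH ij) Lx; apply: interior_subset; apply: Li => //.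
exact: leq_trans ij.
Qed.

Lemma exhaustion_near x : \forall j \near \oo, L j.+1 x.
Proof.
have [i i0 Lx] := exhaustion_cover x; exists i => // j /= ij.
by apply: (exhaustion_mono i0 _ Lx); exact: leqW.
Qed.

End exhaustions.

(** * Convolution semigroups *)

Section time_continuity.
Context (R : realType) (M : pmetricType R) (hM : proper_metric M).
Local Notation PM := (pmeas M R).
Context (nu : R -> probability (kern_space M) R) (hnu : feller_convolution_semigroup nu).
Context (q : kern M -> kern M) (hq : forall t : R, 0 <= t -> presentation (nu t) q).

Let jq : jmeas (q : kern_space M -> kern M).
Proof. by have [] := hq (lexx 0). Qed.

Lemma measurable_convolution : measurable_fun [set: kern_space M * kern_space M]
  (fun K => kern_comp K.1 (q K.2) : kern_space M).
Proof.
apply: measurable_to_kern => x.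
apply: (measurable_kern_comp hM (K1 := fun K : kern_space M * kern_space M => K.1)
  (K2 := fun K : kern_space M * kern_space M => q K.2)).
  exact: (measurableT_comp (measurable_kern_eval x) measurable_fst).
exact: (jmeas_precomp measurable_snd jq).
Qed.

Lemma expect_convolution (t s : R) (G : kern_space M -> R) : 0 <= t -> 0 <= s ->
  bmeas G ->
  \int[nu (t + s)]_K G K = \int[nu t]_K1 \int[nu s]_K2 G (kern_comp K1 (q K2)).
Proof.
move=> t0 s0 bG.
rewrite -(product_expectation (nu t) (nu s) (bmeas_comp bG measurable_convolution)).
rewrite -(expect_law (nu t \x nu s)%E measurable_convolution bG).
apply: eq_expect => A mA; rewrite lawE//.
by rewrite -(fcs_convolution hnu t0 s0 (hq s0) mA).
Qed.

Lemma test_vanishing (f : M -> R) : test_function f -> vanishing_continuous f.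
Proof.
move=> [cf _ [C cC fC]]; split => // V /nbhs_singleton V0.
by exists C => // x Cx /=; rewrite fC.
Qed.

Lemma dev_bmeas (f : M -> R) : test_function f ->
  bmeas (fun p : kern_space M * borel M => `|\int[q p.1 p.2]_z f z - f p.2|).
Proof.
move=> tf; apply: bmeas_norm; apply: bmeasB.
  by apply: (expect_kern_bmeas hM jq); exact: test_bmeas.
exact: (bmeas_comp (test_bmeas tf) measurable_snd).
Qed.

Lemma dev_bmeas' (f : M -> R) y : test_function f ->
  bmeas (fun K : kern_space M => `|\int[(K : kern M) y]_z f z - f y|).
Proof.
move=> tf; apply: bmeas_norm; apply: bmeasB; last exact: bmeas_cst.
by apply: (expect_kern_bmeas hM (measurable_kern_eval y)); exact: test_bmeas.
Qed.

(** Joint measurability of [q] makes the left side measurable in [y]; at fixed [y], [q K y] equals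
    [K y] almost surely, which brings back the quantity controlled by the semigroup hypotheses. *)
Lemma dev_presentation (h : R) (f : M -> R) y : 0 <= h -> test_function f ->
  \int[nu h]_K `|\int[q K y]_z f z - f y| =
  \int[nu h]_K `|\int[(K : kern M) y]_z f z - f y|.
Proof.
move=> h0 tf; apply: expect_ae.
- have mp : measurable_fun [set: kern_space M] (fun K => (K, y) : kern_space M * borel M).
    exact: pair2_measurable.
  exact: (bmeas_comp (dev_bmeas tf) mp).
- exact: dev_bmeas'.
- by apply: (ae_imp ((hq h0).2 y)) => K /= ->.
Qed.

(** The deviation is at most [1], hence at most [e / 2] plus the indicator of the event that it
    reaches [e / 2], whose probability tends to [0] uniformly in [y]. *)
Lemma dev_near (f : M -> R) (e : R) : test_function f -> 0 < e ->
  \forall h \near 0^'+, forall y, \int[nu h]_K `|\int[(K : kern M) y]_z f z - f y| <= e.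
Proof.
move=> tf e0; have e2 : 0 < e / 2 by rewrite divr_gt0.
have h1 := fcs_time hnu (test_vanishing tf) e2.
have : nbhs (0%E : \bar R) [set y | (y < (e / 2)%:E)%E] by apply: open_nbhs_nbhs; split; [exact: open_ereal_lt_ereal|rewrite /= lte_fin].
move=> /h1 h2; near=> h => y.
have hsup : (ereal_sup (range (fun x => nu h [set K : kern_space M | (e / 2 <= `|kapp K f x - f x|)%R ])) < (e / 2)%:E)%E by near: h.
pose S := [set K : kern_space M | e / 2 <= `|\int[(K : kern M) y]_z f z - f y|].
have mS : measurable S by apply: measurable_set_ge; have [] := dev_bmeas' y tf.
have PS : fine (nu h S) <= e / 2.
  rewrite -lee_fin fine_prob//; apply: le_trans (ltW hsup).
  by apply: ereal_sup_ubound; exists y.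
rewrite (@le_trans _ _ (\int[nu h]_K (e / 2 + \1_S K)))//.
  apply: expect_le; first exact: dev_bmeas'.
    by apply: bmeasD; [exact: bmeas_cst|exact: bmeas_indic].
  move=> K; rewrite indicE; have [KS|KS] := boolP (K \in S).
    rewrite (@le_trans _ _ 1)//; last by rewrite lerDr ltW.
    have /andP[a1 a2] := test_expect_itv ((K : kern M) y) tf.
    have [_ /(_ y)/andP[b1 b2] _] := tf.
    by rewrite ler_norml; apply/andP; split; lra.
  rewrite addr0 leNgt; apply/negP => /ltW h'.
  by move/negP : KS; apply; rewrite inE.
rewrite expectD; [|exact: bmeas_cst|exact: bmeas_indic].
by rewrite expect_cst expect_indic// {2}(splitr e) lerD2l.
Unshelve. all: by end_near. Qed.

(** Under the convolution property [nu (t + h)] is the law of [K1 q(K2)]. With the short increment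
    as second factor, each difference of integrals is [K1] applied to [q(K2) f - f], and Fubini
    moves the expectation over [K2] inside. *)
Lemma moment_deviation (t h : R) (s : seq (M * test_type M)) : 0 <= t -> 0 <= h ->
  `|\int[nu (t + h)]_K kern_moment s K - \int[nu t]_K kern_moment s K| <=
  \sum_(a <- s) \int[nu t]_K1 \int[(K1 : kern M) a.1]_y
     \int[nu h]_K `|\int[(K : kern M) y]_z sval a.2 z - sval a.2 y|.
Proof.
move=> t0 h0.
have bK d (T : measurableType d) (g : T -> kern M) : (forall x, measurable_fun setT (fun t => g t x : borel PM)) ->
    bmeas (fun t => kern_moment s (g t)) by exact: kern_moment_bmeas.
have bm : bmeas (kern_moment s : kern_space M -> R).
  by apply: bK => x; exact: measurable_kern_eval.
rewrite (expect_convolution t0 h0 bm).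
pose X (a : M * test_type M) (p : kern_space M * kern_space M) : R :=
  \int[kern_comp p.1 (q p.2) a.1]_y sval a.2 y.
pose Y (a : M * test_type M) (p : kern_space M * kern_space M) : R :=
  \int[(p.1 : kern M) a.1]_y sval a.2 y.
have mc x := measurableT_comp (measurable_kern_eval x) measurable_convolution.
have bX a : bmeas (X a).
  by apply: (expect_kern_bmeas hM (mc a.1)); apply: test_bmeas; exact: svalP.
have bY a : bmeas (Y a).
  apply: (expect_kern_bmeas hM (measurableT_comp (measurable_kern_eval a.1) measurable_fst)).
  by apply: test_bmeas; exact: svalP.
have bpX : bmeas (fun p => \prod_(a <- s) X a p) by exact: bmeas_prod.
have bpY : bmeas (fun p => \prod_(a <- s) Y a p) by exact: bmeas_prod.
have bXY a : bmeas (fun p => `|X a p - Y a p|) by apply: bmeas_norm; exact: bmeasB.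
have -> : \int[nu t]_K1 \int[nu h]_K2 kern_moment s (kern_comp K1 (q K2)) =
    \int[(nu t \x nu h)%E]_p \prod_(a <- s) X a p.
  by rewrite product_expectation.
have -> : \int[nu t]_K kern_moment s K = \int[(nu t \x nu h)%E]_p \prod_(a <- s) Y a p.
  rewrite product_expectation//; apply: eq_Rintegral => K _.
  by rewrite [RHS](_ : _ = \int[nu h]_K2 kern_moment s K)// expect_cst.
rewrite -(expectB (nu t \x nu h)%E bpX bpY).
rewrite (le_trans (expect_norm (nu t \x nu h)%E (bmeasB bpX bpY)))//.
rewrite (@le_trans _ _ (\int[(nu t \x nu h)%E]_p \sum_(a <- s) `|X a p - Y a p|))//.
  apply: (@expect_le _ _ _ (nu t \x nu h)%E).
  - by apply: bmeas_norm; exact: bmeasB.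
  - exact: bmeas_sum.
  - move=> p; apply: prod_sub_le => a; apply: test_expect_itv; exact: svalP.
rewrite (@expect_sum _ _ _ (nu t \x nu h)%E)//.
elim/big_ind2 : _ => // [x1 x2 y1 y2 h1 h2|a _]; first exact: lerD.
have tf : test_function (sval a.2) by exact: svalP.
have bf := test_bmeas tf.
rewrite product_expectation//.
have bD : bmeas (fun y : borel M => \int[nu h]_K `|\int[q K y]_z sval a.2 z - sval a.2 y|).
  have mkc : measurable_family (fun _ : borel M => nu h) by move=> U _; exact: measurable_cst.
  exact: (rm_bmeas mkc (bmeas_comp (dev_bmeas tf) (@measurable_swap _ _ (borel M) (kern_space M)))).
have DE y : \int[nu h]_K `|\int[q K y]_z sval a.2 z - sval a.2 y| =
    \int[nu h]_K `|\int[(K : kern M) y]_z sval a.2 z - sval a.2 y|.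
  exact: dev_presentation.
under [leRHS]eq_Rintegral => K _ do under eq_Rintegral => y _ do rewrite -DE.
apply: expect_le.
- have mkc : measurable_family (fun _ : kern_space M => nu h) by move=> U _; exact: measurable_cst.
  exact: (rm_bmeas mkc (bXY a)).
- exact: (expect_kern_bmeas hM (measurable_kern_eval a.1) bD).
move=> K1; rewrite -(expectation_swap (nu h) ((K1 : kern M) a.1) (dev_bmeas tf)).
apply: expect_le.
- exact: (bmeas_comp (bXY a) (pair1_measurable K1)).
- have mkc : measurable_family (fun _ : kern_space M => (K1 : kern M) a.1 : probability (borel M) R).
    by move=> U _; exact: measurable_cst.
  exact: (rm_bmeas mkc (dev_bmeas tf)).
move=> K2; rewrite /X /Y /= expect_kern_comp//.
have bq : bmeas (fun y : borel M => \int[q K2 y]_z sval a.2 z).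
  exact: (expect_kern_bmeas hM (kern_meas (q K2)) bf).
rewrite -expectB//; apply: (le_trans (expect_norm _ _)); first exact: bmeasB.
exact: lexx.
Qed.

(** The deviation estimate is uniform in the starting point, so it integrates against any law: the
    admissible [h] do not depend on [t], which also yields continuity from the left. *)
Lemma moment_near (s : seq (M * test_type M)) (e : R) : 0 < e ->
  \forall h \near 0^'+, forall t, 0 <= t ->
    `|\int[nu (t + h)]_K kern_moment s K - \int[nu t]_K kern_moment s K| <= e.
Proof.
move=> e0.
suff : \forall h \near 0^'+, forall t, 0 <= t ->
    \sum_(a <- s) \int[nu t]_K1 \int[(K1 : kern M) a.1]_y
     \int[nu h]_K `|\int[(K : kern M) y]_z sval a.2 z - sval a.2 y| <= e.
  move=> hs; near=> h => t t0; rewrite (le_trans (moment_deviation s t0 _))//.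
  by move: t t0; near: h.
elim: s e e0 => [|a s IH] e e0; first by apply: nearW => h t _; rewrite big_nil ltW.
have e2 : 0 < e / 2 by rewrite divr_gt0.
have tf : test_function (sval a.2) by exact: svalP.
near=> h => t t0; rewrite big_cons (splitr e) lerD//; last first.
  by move: t t0; near: h; exact: IH.
have h0 : 0 <= h by [].
have hD : forall y, \int[nu h]_K `|\int[(K : kern M) y]_z sval a.2 z - sval a.2 y| <= e / 2.
  by near: h; exact: dev_near.
have bD : bmeas (fun y : borel M => \int[nu h]_K `|\int[(K : kern M) y]_z sval a.2 z - sval a.2 y|).
  have mkc : measurable_family (fun _ : borel M => nu h) by move=> U _; exact: measurable_cst.
  have := rm_bmeas mkc (bmeas_comp (dev_bmeas tf) (@measurable_swap _ _ (borel M) (kern_space M))).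
  by congr bmeas; apply/funext => y; exact: dev_presentation.
have D0 y : 0 <= \int[nu h]_K `|\int[(K : kern M) y]_z sval a.2 z - sval a.2 y|.
  exact: expect_ge0.
rewrite (le_trans (ler_norm _))//; apply: expect_bound.
  exact: (expect_kern_bmeas hM (measurable_kern_eval a.1) bD).
by move=> K; apply: expect_bound => // y; rewrite ger0_norm.
Unshelve. all: by end_near. Qed.

(** For small [h] the moments of [nu h] are close to those of [nu 0] by [moment_near] and to those
    of the identity kernel by [dev_near]. *)
Lemma moment_nu0 (s : seq (M * test_type M)) :
  \int[nu 0]_K kern_moment s K = \prod_(a <- s) sval a.2 a.1.
Proof.
apply/eqP; rewrite -subr_eq0 -normr_le0; apply/ler_addgt0Pr => e e0; rewrite add0r.
have e2 : 0 < e / 2 by rewrite divr_gt0.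
have h2 : \forall h \near 0^'+,
    \sum_(a <- s) \int[nu h]_K `|\int[(K : kern M) a.1]_z sval a.2 z - sval a.2 a.1| <= e / 2.
  elim: s (e / 2) e2 => [|a s IH] {e0}e e0; first by apply: nearW => h; rewrite big_nil ltW.
  have e2 : 0 < e / 2 by rewrite divr_gt0.
  near=> h; rewrite big_cons (splitr e) lerD//; last by near: h; exact: IH.
  by move: (a.1); near: h; apply: dev_near => //; exact: svalP.
near (0 : R)^'+ => h.
have a1' : forall t, 0 <= t ->
    `|\int[nu (t + h)]_K kern_moment s K - \int[nu t]_K kern_moment s K| <= e / 2.
  by near: h; exact: moment_near.
have a1 := a1' 0 (lexx 0).
have a2 : \sum_(a <- s) \int[nu h]_K `|\int[(K : kern M) a.1]_z sval a.2 z - sval a.2 a.1| <= e / 2.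
  by near: h.
rewrite add0r in a1.
have bm : bmeas (kern_moment s : kern_space M -> R).
  by apply: kern_moment_bmeas => // x; exact: measurable_kern_eval.
have a3 : `|\int[nu h]_K kern_moment s K - \prod_(a <- s) sval a.2 a.1| <= e / 2.
  apply: le_trans a2; rewrite -[X in _ - X](expect_cst (nu h)) -expectB//; last exact: bmeas_cst.
  rewrite -expect_sum; last by move=> a; apply: dev_bmeas'; exact: svalP.
  apply: (le_trans (expect_norm _ _)).
    by apply: bmeasB => //; exact: bmeas_cst.
  apply: expect_le.
  - by apply: bmeas_norm; apply: bmeasB => //; exact: bmeas_cst.
  - by apply: bmeas_sum => a; apply: dev_bmeas'; exact: svalP.
  - move=> K; apply: prod_sub_le => a; first by apply: test_expect_itv; exact: svalP.
    by have [_ h01 _] := svalP a.2; exact: h01.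
rewrite distrC in a1.
rewrite (le_trans (ler_distD (\int[nu h]_K kern_moment s K) _ _))//.
by rewrite (splitr e) lerD.
Unshelve. all: by end_near. Qed.

Lemma kdelta_law d (T : measurableType d) (P : probability T R) (A : set (kern_space M)) :
  measurable A -> P [set t | A (kdelta M)] = nu 0 A.
Proof.
move=> mA.
apply: (kern_law_unique hM (h1 := fun _ : T => kdelta M) (h2 := fun K : kern_space M => K)) => //.
  exact: measurable_kern_eval.
move=> s; rewrite moment_nu0 -[RHS](expect_cst P); apply: eq_Rintegral => t _.
by apply: eq_bigr => a _; rewrite kdeltaE// expect_pdirac//; apply: test_bmeas; exact: svalP.
Qed.

Lemma moment_continuous (u_ : nat -> R) (u : R) s : (forall j, 0 <= u_ j) -> 0 <= u ->
  u_ @ \oo --> u ->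
  \int[nu (u_ j)]_K kern_moment s K @[j --> \oo] --> \int[nu u]_K kern_moment s K.
Proof.
move=> u_0 u0 uu; apply/cvgrPdist_le => e e0.
have [D D0 hD] := moment_near s e0.
have hD' h t : 0 < h -> h < D -> 0 <= t ->
    `|\int[nu (t + h)]_K kern_moment s K - \int[nu t]_K kern_moment s K| <= e.
  move=> h0 hlt t0; apply: (hD h) => //=.
  by rewrite sub0r normrN gtr0_norm.
have /cvgrPdist_lt/(_ _ D0) uD := uu.
apply: (@filterS _ \oo _ _ _ _ uD) => j /= hj.
have [h|h|->] := ltgtP (u_ j) u; last by rewrite subrr normr0 ltW.
- have := hD' (u - u_ j) (u_ j); rewrite subr_gt0 (addrC (u_ j)) subrK; apply => //.
  by rewrite -(gtr0_norm (x := u - u_ j)) ?subr_gt0.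
- rewrite distrC; have := hD' (u_ j - u) u; rewrite subr_gt0 (addrC u) subrK; apply => //.
  by rewrite -(gtr0_norm (x := u_ j - u)) ?subr_gt0// distrC.
Qed.

End time_continuity.

(** * Exchanging null sets and modifying kernels *)

Section modifications.
Context (R : realType) (M : pmetricType R) (hM : proper_metric M).
Local Notation PM := (pmeas M R).

(** Fubini for the indicator of the complement of [E]: its double integral vanishes in one order,
    hence in the other. *)
Lemma ae_swap d d' (T : measurableType d) (S : measurableType d')
    (P : probability T R) (m : probability S R) (E : set (T * S)) : measurable E ->
  (forall x, \forall t \ae P, E (t, x)) ->
  \forall t \ae P, \forall x \ae m, E (t, x).
Proof.
move=> mE hE; have mE' : measurable (~` E) by exact: measurableC.
have bE : bmeas (\1_(~` E) : T * S -> R) by exact: bmeas_indic.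
have mk : measurable_family (fun _ : T => m) by move=> U _; exact: measurable_cst.
have mkP : measurable_family (fun _ : S => P) by move=> U _; exact: measurable_cst.
have m1 x : measurable_fun [set: T] (fun t => (t, x) : T * S) by exact: pair2_measurable.
have m2 t : measurable_fun [set: S] (fun x => (t, x) : T * S) by exact: pair1_measurable.
have I0 : \int[P]_t \int[m]_x (\1_(~` E) (t, x) : R) = 0.
  rewrite (expectation_swap P m bE) -(expect_cst m 0); apply: eq_Rintegral => x _.
  rewrite -[RHS](expect_cst P 0); apply: expect_ae.
  - exact: (bmeas_comp bE (m1 x)).
  - exact: bmeas_cst.
  apply: (ae_imp (hE x)) => t Et.
  by rewrite indicE memNset.
have bI : bmeas (fun t => \int[m]_x (\1_(~` E) (t, x) : R)) by exact: (rm_bmeas mk bE).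
have I1 := expect_eq0_ae bI (fun t => expect_ge0 _ (fun x => _)) I0.
apply: (ae_imp (I1 _)) => // t.
move=> h; have : \forall x \ae m, (\1_(~` E) (t, x) : R) = 0.
  by apply: expect_eq0_ae h => //; exact: (bmeas_comp bE (m2 t)).
move=> h'; apply: (ae_imp h') => x.
rewrite indicE; case: (boolP (_ \in _)) => [_ /eqP|]; first by rewrite oner_eq0.
by rewrite notin_setE => /contrapT.
Qed.

Lemma expect_eq_law d d' (T : measurableType d) (Y : measurableType d')
    (P : probability T R) (Q : probability Y R) (f : T -> Y) (g : Y -> R) :
  measurable_fun setT f -> (forall A, measurable A -> P [set t | A (f t)] = Q A) ->
  bmeas g -> \int[P]_t g (f t) = \int[Q]_y g y.
Proof.
move=> mf PQ bg; rewrite -(expect_law P mf bg); apply: eq_expect => A mA.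
by rewrite lawE// -PQ.
Qed.

Lemma ae_law d d' (T : measurableType d) (Y : measurableType d')
    (P : probability T R) (Q : probability Y R) (f : T -> Y) (E : set Y) :
  measurable_fun setT f -> (forall A, measurable A -> P [set t | A (f t)] = Q A) ->
  measurable E -> (\forall y \ae Q, E y) -> \forall t \ae P, E (f t).
Proof.
move=> mf PQ mE [N [mN N0 EN]]; exists (f @^-1` N); split.
- by rewrite -[X in measurable X]setTI; exact: mf.
- by rewrite -N0 -PQ.
- by move=> t /= nE; exact: EN.
Qed.

Context (dist : PM -> PM -> R) (hd : metrizes dist).

Lemma measurable_pmeas_eq d (T : measurableType d) (h1 h2 : T -> PM) :
  measurable_fun [set: T] (h1 : T -> borel PM) ->
  measurable_fun [set: T] (h2 : T -> borel PM) ->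
  measurable [set t | h1 t = h2 t].
Proof.
move=> m1 m2; have mD : measurable_fun setT (fun t => dist (h1 t) (h2 t)).
  exact: (measurable_pmeas_dist hM hd m1 m2).
rewrite (_ : mkset _ = (fun t => dist (h1 t) (h2 t)) @^-1` [set 0]).
  by rewrite -[X in measurable X]setTI; exact: mD.
by apply/seteqP; split => t /=; move=> /(metrizes_eq0 hd).
Qed.

(** Almost surely the two kernels agree at [m]-almost every point, by [ae_swap], and a mixture over
    [m] sees nothing else. *)
Lemma mixpm_modification d (T : measurableType d) (P : probability T R)
    (K1 K2 : T -> kern M) (m : PM) :
  jmeas K1 -> jmeas K2 -> (forall x, \forall t \ae P, K1 t x = K2 t x) ->
  \forall t \ae P, mixpm m (K1 t) = mixpm m (K2 t).
Proof.
move=> j1 j2 K12.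
apply: (ae_imp (ae_swap m (measurable_pmeas_eq j1 j2) K12)).
move=> t Et; apply: pmeasP => A mA; rewrite !mixpmE//; try exact: kern_meas.
have mk (K : kern M) : measurable_fun [set: borel M] (fun y => K y A).
  exact: (measurable_family_pmeas hM (kern_meas K) mA).
apply: ae_eq_integral => //.
by apply: (ae_imp Et) => x /= ->.
Qed.

End modifications.

(** * Power measures *)

Section power_measures.
Context d (T : measurableType d) (R : realType) (Q : probability T R).

Lemma power_measure_coord (J : eqType) (P : probability (power_space J T) R) j B :
  is_power_measure Q P -> measurable B -> P [set w | B (w j)] = Q B.
Proof.
move=> hP mB; have := hP [:: j] (fun=> B) isT (fun=> mB).
rewrite big_cons big_nil mule1 => <-; congr (P _).
by apply/seteqP; split => w /= h; [move=> k; rewrite inE => /eqP ->|exact: h (mem_head _ _)].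
Qed.

Lemma power_measure_reindex (J J' : eqType) (P : probability (power_space J T) R)
    (e : J' -> J) (g : J -> J')
    (me : measurable_fun [set: power_space J T]
      (fun w : power_space J T => (fun j => w (e j)) : power_space J' T)) :
  cancel e g -> is_power_measure Q P -> is_power_measure Q (law P me).
Proof.
move=> eg hP F C uF mC; rewrite lawE; last first.
  by rewrite finite_rectangles_generate; apply: sub_sigma_algebra; exists F, C.
have uF' : uniq (map e F) by rewrite map_inj_uniq//; exact: can_inj eg.
have := hP (map e F) (fun j => C (g j)) uF' (fun j => mC (g j)).
rewrite big_map (eq_bigr (fun j => Q (C j))) => [<-|j _]; last by rewrite eg.
congr (P _); apply/seteqP; split => w /= h.
  by move=> _ /mapP[j jF ->]; rewrite eg; exact: h.
by move=> j jF; have := h (e j) (map_f e jF); rewrite eg.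
Qed.

Definition seq_cons (p : T * power_space nat T) : power_space nat T :=
  fun k => if k is j.+1 then p.2 j else p.1.

Lemma measurable_seq_cons : measurable_fun setT seq_cons.
Proof.
apply: measurable_to_power => -[|j]; first exact: measurable_fst.
exact: (measurableT_comp (measurable_coord j) measurable_snd).
Qed.

(** The first term of an i.i.d. sequence is independent of the remaining ones, which again form such
    a sequence: this drives the induction on the number of composed kernels. *)
Lemma power_measure_cons (P : probability (power_space nat T) R) (A : set (power_space nat T)) :
  is_power_measure Q P -> measurable A ->
  P A = (Q \x P)%E [set p | A (seq_cons p)].
Proof.
move=> hP.
suff h : forall A, finite_rectangles A -> P (idfun @^-1` A) = (Q \x P)%E (seq_cons @^-1` A).
  move: A; apply: (law_unique (@finite_rectangles_generate nat _ T)
    (@finite_rectangles_setI nat _ T) (@measurable_id _ _ setT) measurable_seq_cons h).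
move=> _ [F [C mC ->]].
(* The rectangle is rewritten over the whole segment [0, ..., m], with trivial constraints outside
   [F], so that coordinate [0] can be split off. *)
pose m := \max_(j <- F) j.
pose C' j := if j \in F then C j else setT.
have mC' j : measurable (C' j) by rewrite /C'; case: ifP.
have -> : [set w : nat -> T | forall j, j \in F -> C j (w j)] =
    [set w | forall j, j \in iota 0 m.+1 -> C' j (w j)].
  apply/seteqP; split => w /= h j jF; first by rewrite /C'; case: ifP => //; exact: h.
  have := h j; rewrite /C' jF; apply.
  by rewrite -[_ :: _]/(iota 0 m.+1) mem_iota add0n ltnS/=; exact: (leq_bigmax_seq (F := id)).
rewrite hP ?iota_uniq//= big_cons -[iota 1 m]/(iota (1 + 0) m) iotaDl big_map.
rewrite (_ : _ @^-1` _ = C' 0%N `*` [set w | forall j, j \in iota 0 m -> C' j.+1 (w j)]).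
  rewrite product_measure1E//; last first.
    by rewrite finite_rectangles_generate; apply: sub_sigma_algebra; exists (iota 0 m), (fun j => C' j.+1).
  congr (_ * _)%E; apply/esym.
  exact: (hP (iota 0 m) (fun j => C' j.+1) (iota_uniq _ _) (fun j => mC' j.+1)).
have jS j : (j.+1 \in 0%N :: [seq (1 + i)%N | i <- iota 0 m]) = (j \in iota 0 m).
  by rewrite inE (mem_map (@addnI 1) (iota 0 m) j).
apply/seteqP; split => -[x w] h.
  split=> [|j jm]; first exact: (h 0%N).
  by apply: (h j.+1); exact: (etrans (jS j) jm).
by move: h => [h0 h] [|j] // jm; apply: h; exact: (etrans (esym (jS j)) jm).
Qed.

End power_measures.

(** The steps are summable, so the sequence is Cauchy and converges to any cluster point. The bound
    [2 * 2 ^- j - 2 * 2 ^- (j + k)] is the exact partial sum of the geometric series, which lets the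
    induction on [k] close; with [2 ^- m < e / 6] the path from [l] through [u k] and [u m] to [u j]
    has three pieces below [e / 3]. *)
Lemma cauchy_cluster_cvg (R : realType) (T : topologicalType) (d : T -> T -> R)
    (u : nat -> T) (l : T) N : metrizes d ->
  (forall j, (N <= j)%N -> d (u j) (u j.+1) < 2 ^- j) ->
  cluster (u @ \oo) l -> u @ \oo --> l.
Proof.
move=> hd hu hl.
have h k : forall j, (N <= j)%N -> d (u j) (u (j + k)%N) <= 2 * 2 ^- j - 2 * 2 ^- (j + k).
  elim: k => [|k IH] j Nj.
    by rewrite addn0 subrr le_eqVlt (_ : d _ _ = 0) ?eqxx//; apply/(metrizes_eq0 hd).
  have h1 := IH j Nj; have h2 := hu (j + k)%N (leq_trans Nj (leq_addr _ _)).
  have := metrizes_triangle hd (u j) (u (j + k)%N) (u (j + k.+1)%N).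
  rewrite addnS in h2 *; have : 2 * 2 ^- (j + k).+1 = 2 ^- (j + k) :> R.
    by rewrite exprS invfM mulrA divff// mul1r.
  by move: h1 h2; lra.
have {}h j k : (N <= j)%N -> (j <= k)%N -> d (u j) (u k) <= 2 * 2 ^- j.
  move=> Nj jk; have := h (k - j)%N j Nj; rewrite subnKC// => /le_trans; apply.
  by rewrite gerBl mulr_ge0.
apply: (metrizes_cvg hd) => e e0.
have [N1 hN1] := @half_pow_lt R (e / 6) (divr_gt0 e0 (ltr0n _ 6)).
pose m := maxn N N1.
have Nm : (N <= m)%N by exact: leq_maxl.
have m6 : 2 ^- m < e / 6 by apply: hN1; exact: leq_maxr.
have [y [[k /= mk <-] /= lk]] : ([set u k | k in [set k | (m <= k)%N]] `&`
    [set y | d l y < e / 3]) !=set0.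
  apply: hl; first by exists m => // k mk; exists k.
  by apply/(metrizes_nbhs hd); exists (e / 3) => //; rewrite divr_gt0.
exists m => // j /= mj.
have := h m k Nm mk; have := h m j Nm mj.
have := metrizes_triangle hd l (u k) (u j).
have := metrizes_triangle hd (u k) (u m) (u j).
rewrite (metrizes_sym hd (u k) (u m)).
by move: lk m6; lra.
Qed.

Lemma kact_pdirac (R : realType) (M : pmetricType R) (hM : proper_metric M) (K : kern M) x :
  kact (pdirac x) K = K x.
Proof.
rewrite -[kact _ _]/(mixpm (pdirac x) K); apply: pmeasP => A mA.
rewrite mixpmE//; last exact: kern_meas.
have mK := measurable_family_pmeas hM (kern_meas K) mA.
rewrite (eq_measure_integral (\d_(x : borel M))); last first.
  by move=> B mB _; exact: (trimE (\d_(x : borel M)) mB).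
by rewrite integral_dirac// diracT mul1e.
Qed.

Lemma expect_weak_cvg (X : ptopologicalType) (R : realType) (u : nat -> pmeas X R)
    (m : pmeas X R) (f : X -> R) : bcontinuous f -> u @ \oo --> m ->
  \int[u j]_x f x @[j --> \oo] --> \int[m]_x f x.
Proof.
move=> bf um; have c := @expect_continuous X R f bf m.
exact: (cvg_comp _ _ um c).
Qed.

(** * Dyadic approximation *)

Section dyadic_floors.
Context (R : realType).

Lemma dyadic_floorE n (k : int) : Num.floor ((k%:~R / 2 ^+ n : R) * 2 ^+ n) = k.
Proof. by rewrite divfK ?intrKfloor// expf_neq0. Qed.

Lemma dyadicS n m (s : R) : (n <= m)%N -> dyadic n s -> dyadic m s.
Proof.
move=> nm [k ->]; exists (k * 2 ^+ (m - n)).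
rewrite rmorphM rmorphXn/= -{2}(subnK nm) exprD invfM mulrA mulfK//.
Qed.

Lemma dyadic_floor_lt n (t : R) : t < dyadic_floor n t + 2 ^- n.
Proof.
rewrite /dyadic_floor -[X in _ + X]mul1r -mulrDl ltr_pdivlMr ?exprn_gt0//.
by have := floorD1_gt (t * 2 ^+ n); rewrite rmorphD.
Qed.

Lemma dyadic_floor_dist n (t : R) : `|t - dyadic_floor n t| <= 2 ^- n.
Proof.
have [_ h _] := dyadic_floorP n t; have := dyadic_floor_lt n t.
by rewrite ger0_norm ?subr_ge0//; lra.
Qed.

Lemma dyadic_floor_mono n (s t : R) : s <= t -> dyadic_floor n s <= dyadic_floor n t.
Proof.
move=> st; have [h1 h2 _] := dyadic_floorP n s; have [_ _ h3] := dyadic_floorP n t.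
by apply: h3 => //; exact: le_trans st.
Qed.

Lemma dyadic_floor_refine n m (t : R) : (n <= m)%N -> dyadic_floor n t <= dyadic_floor m t.
Proof.
move=> nm; have [h1 h2 _] := dyadic_floorP n t; have [_ _ h3] := dyadic_floorP m t.
by apply: h3 => //; exact: dyadicS h1.
Qed.

Lemma dyadic_floor_id n (t : R) : dyadic n t -> dyadic_floor n t = t.
Proof.
move=> nt; have [h1 h2 h3] := dyadic_floorP n t.
by apply/eqP; rewrite eq_le h2 h3.
Qed.

Lemma dyadics_floor n (t : R) : dyadics (dyadic_floor n t).
Proof. by exists n => //; have [] := dyadic_floorP n t. Qed.

Context (n_ : nat -> nat).
Hypothesis n_S : forall j, (n_ j.+1 < n_ j.+2)%N.

Lemma level_ge j : (j <= n_ j.+1)%N.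
Proof. by elim: j => // j /leq_ltn_trans; apply. Qed.

Lemma dyadic_floor_cvg (t : R) : dyadic_floor (n_ j.+1) t @[j --> \oo] --> t.
Proof.
apply/cvgrPdist_lt => e /half_pow_lt[N hN].
exists N => // j /= Nj; rewrite (le_lt_trans (dyadic_floor_dist _ _))//.
by apply: hN; exact: leq_trans (level_ge j).
Qed.

End dyadic_floors.

(** * The flow *)

Section feller.
Context (R : realType) (M : pmetricType R) (hM : proper_metric M).
Local Notation PM := (pmeas M R).
Local Notation PMhat := (pmeas (compactify M) R).
Context (d : PM -> PM -> R) (hd : metrizes d).
Context (nu : R -> probability (kern_space M) R) (hnu : feller_convolution_semigroup nu).
Context (Pi : forall n, R -> ('I_n -> M) -> probability (npoint_space M n) R)
  (hPi : is_spatial_law nu Pi).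
Context (L : nat -> set M) (hL : is_exhaustion L) (eps : nat -> R) (heps : is_modulus d L Pi eps).
Context (I : set nat) (z : I -> M) (zdense : dense (range z)).
Context (ell : (nat -> PM) -> PM) (hell : limit_selection ell).

Let hPM : hausdorff_space PM := metrizes_hausdorff hd.
Let eps_gt0 j : 0 < eps j.+1. Proof. by have [h _ _ _] := heps; exact: h. Qed.

Let eps_cvg : eps @ \oo --> 0. Proof. by case: heps. Qed.

Local Notation near_pt := (nearest zdense eps_gt0).
Local Notation ipk := (ikern z eps ell).
Local Notation ppk := (pkern z eps ell).

(** Translates the modulus condition, stated for the spatial law on the compactification, into an
    estimate under [nu t]. *)
Lemma spatial_pair (t : R) x y (c : R) : 0 <= t ->
  @Pi 2 t (pair2 x y) [set v | exists mu1 mu2, (c <= d mu1 mu2)%R /\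
    v = pair2 (embed mu1) (embed mu2)] =
  nu t [set K : kern_space M | c <= d ((K : kern M) x) ((K : kern M) y)].
Proof.
move=> t0.
pose i0 : 'I_2 := ord0; pose i1 : 'I_2 := ord_max.
pose D : set (borel {ptws 'I_2 -> PM}) := [set mu | c <= d (mu i0) (mu i1)].
have mD : measurable D.
  have mi (i : 'I_2) : measurable_fun [set: borel {ptws 'I_2 -> PM}] (fun mu => mu i : borel PM).
    exact: (measurable_from_borel (@coord_continuous _ (fun _ : 'I_2 => PM) i)).
  apply: measurable_set_ge.
  exact: (measurable_pmeas_dist hM hd (mi i0) (mi i1)).
have ord2 (i : 'I_2) : i = i0 \/ i = i1.
  by case: i => -[|[|//]] hi; [left|right]; apply: val_inj.
have := spatial_image hM hPi (pair2 x y) (isT : (0 < 2)%N) t0 mD.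
rewrite (_ : [set _ | mu in D] = [set v | exists mu1 mu2, (c <= d mu1 mu2)%R /\
    v = pair2 (embed mu1) (embed mu2)]) //.
apply/seteqP; split => [_ [mu Dmu <-]|v [mu1 [mu2 [h ->]]]].
  exists (mu i0), (mu i1); split => //; apply/funext => i.
  by case: (ord2 i) => ->.
exists (pair2 mu1 mu2) => //; apply/funext => i.
by case: (ord2 i) => ->.
Qed.

Lemma pkern_ae (t : R) x : 0 <= t ->
  \forall K \ae nu t, ppk (K : kern M) x = (K : kern M) x.
Proof.
move=> t0; pose y j := z (near_pt x j).
(* For positive [j] the point [y j.-1] is within [eps j / 2] of [x], hence the shift by one against
   the index of the modulus. *)
pose F j := [set K : kern_space M | 2 ^- j <= d ((K : kern M) x) ((K : kern M) (y j.-1))].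
have mF j : measurable (F j).
  apply: measurable_set_ge.
  exact: (measurable_pmeas_dist hM hd (measurable_kern_eval x) (measurable_kern_eval (y j.-1))).
have [_ _ Li] := hL; have [j0 j00 Lx] := exhaustion_cover hL x.
have PF : \forall j \near \oo, (nu t (F j) <= (2 ^- j)%:E)%E.
  (* The modulus requires [x] and its approximation to lie in the same compact set; [L j0.+1] is a
     neighbourhood of [x], so it eventually contains the approximations, and it is contained in
     [L j] for large [j]. *)
  have h1 : \forall j \near \oo, L j0.+1 (y j.-1).
    have h : \forall j \near \oo, L j0.+1 (y j).
      by apply: (nearest_cvg zdense eps_gt0 eps_cvg (x := x)); exact: (Li j0 j00 x Lx).
    have [N _ hN] := h; exists N.+1 => // -[//|j] /= Nj; exact: hN.
  have h2 : \forall j \near \oo, t <= j%:R.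
    by near=> j; rewrite ltW//; near: j; exact: nbhs_infty_gtr.
  near=> j.
  have j1 : (0 < j)%N by near: j; exact: nbhs_infty_gt.
  have jj0 : (j0 < j)%N by near: j; exact: nbhs_infty_gt.
  rewrite -(spatial_pair x (y j.-1) (2 ^- j) t0).
  have [_ _ _ hm] := heps; apply: hm => //.
  - by rewrite t0/=; near: j.
  - by apply: (exhaustion_mono hL j00 (ltnW jj0)).
  - by apply: (exhaustion_mono hL _ jj0) => //; near: j.
  - have := nearest_mdist zdense eps_gt0 x j.-1; rewrite prednK// => /ltW h.
    rewrite (le_trans h)// ler_pdivrMr// ler_peMr// ?ler1n//.
    by rewrite -(prednK j1) ltW.
apply: filterS (borel_cantelli_half mF PF) => K hK.
apply: ikern_cvg => //; apply: (metrizes_cvg hd) => e e0.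
have [k ke] := half_pow_lt e0.
have [N _ hN] := hK.
exists (N + k)%N => // j /= Nj.
have := hN j.+1; rewrite /F/= => /(_ _) h.
have {}h : ~ (2 ^- j.+1 <= d ((K : kern M) x) ((K : kern M) (y j))).
  by apply: h; rewrite (leq_trans _ (leqnSn j))// (leq_trans _ Nj)// leq_addr.
move/negP : h; rewrite -ltNge => /lt_trans; apply; apply: ke.
by rewrite (leq_trans _ (leqnSn j))// (leq_trans _ Nj)// leq_addl.
Unshelve. all: by end_near. Qed.

Lemma measurable_pkern : measurable_fun [set: kern_space M]
  (fun K : kern_space M => ppk K : kern_space M).
Proof.
apply: measurable_to_kern => x; apply: (jmeas_eval (K := fun K : kern_space M => ppk K)).
apply: (jmeas_pkern zdense eps_gt0 hell (T := kern_space M) (K := fun K => K)) => y.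
exact: measurable_kern_eval.
Qed.

Lemma pkern_law (t : R) (A : set (kern_space M)) : 0 <= t -> measurable A ->
  nu t [set K : kern_space M | A (ppk K)] = nu t A.
Proof.
move=> t0 mA.
apply: (kern_law_ae hM (h1 := fun K : kern_space M => ppk K) (h2 := fun K : kern_space M => K)) => //.
- by move=> x; exact: (measurableT_comp (measurable_kern_eval x) measurable_pkern).
- by move=> x; exact: measurable_kern_eval.
- by move=> x; exact: pkern_ae.
Qed.

Lemma pkern_presentation (t : R) : 0 <= t -> presentation (nu t) ppk.
Proof.
move=> t0; split; last by move=> x; exact: pkern_ae.
apply: (jmeas_pkern zdense eps_gt0 hell (T := kern_space M) (K := fun K => K)) => x.
exact: measurable_kern_eval.
Qed.

Context (PiI : R -> probability (seq_space M I) R) (hPiI : is_seq_law z Pi PiI).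

(** On rectangles over finitely many distinct indices this is the definition of [PiI] combined with
    [spatial_image]. The empty list is treated apart because that definition requires at least one
    point. *)
Lemma seq_law (t : R) (C : set (seq_space M I)) : 0 <= t -> measurable C ->
  PiI t C = nu t [set K : kern_space M | C (ekern z K)].
Proof.
move=> t0; move: C.
have me : measurable_fun [set: kern_space M] (fun K : kern_space M => ekern z K : seq_space M I).
  by apply: measurable_to_power => i; exact: measurable_kern_eval.
have mid : measurable_fun [set: seq_space M I] (idfun : seq_space M I -> seq_space M I).
  exact: measurable_id.
suff h : forall C, finite_rectangles C -> PiI t (idfun @^-1` C) = nu t ((fun K : kern_space M => ekern z K) @^-1` C).
  exact: (law_unique (@finite_rectangles_generate I _ (borel PM))
    (@finite_rectangles_setI I _ (borel PM)) mid me h).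
move=> _ /finite_rectangles_uniq[F uF [C mC ->]].
have [->|F0] := eqVneq F [::].
  by rewrite (_ : mkset _ = setT) ?preimage_setT ?probability_setT//; apply/seteqP; split.
have sF : (0 < size F)%N by rewrite lt0n size_eq0.
pose J (k : 'I_(size F)) := tnth (in_tuple F) k.
have Jinj : injective J by apply/(tuple_uniqP (in_tuple F)).
pose B : set (borel {ptws 'I_(size F) -> PM}) := [set y | forall k, C (J k) (y k)].
have mB : measurable B.
  have [B0 hB] := proper_metric_base hM.
  rewrite (rectangles_generate _ (pmeas_countable_base hM hB)).
  by apply: sub_sigma_algebra; exists (fun k => C (J k)).
have FJ (w : I -> PM) : (forall j, j \in F -> C j (w j)) <-> B (fun k => w (J k)).
  split=> [h k|h j /(tnthP (in_tuple F))[k ->]]; last exact: h.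
  by apply: h; exact: (mem_tnth k (in_tuple F)).
transitivity (PiI t [set mu : seq_space M I | B (fun k => mu (J k))]).
  by congr (PiI t _); apply/seteqP; split => w /FJ.
rewrite (hPiI t0 sF Jinj mB) (spatial_image hM hPi _ sF t0 mB).
by congr (nu t _); apply/seteqP; split => K; [move=> h; apply/FJ; exact: h|move=> /FJ].
Qed.

(** Pulled back along [ekern z], the map [ipk] becomes [ppk], which preserves [nu t]. *)
Lemma ikern_law (t : R) (A : set (kern_space M)) : 0 <= t -> measurable A ->
  PiI t [set mu : seq_space M I | A (ipk mu)] = nu t A.
Proof.
move=> t0 mA.
have mi : measurable_fun [set: seq_space M I] (fun mu : seq_space M I => ipk mu : kern_space M).
  apply: measurable_to_kern => x.
  apply: (jmeas_eval (K := fun mu : seq_space M I => ipk mu)).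
  apply: (jmeas_ikern zdense eps_gt0 hell (T := seq_space M I) (mu := fun mu => mu)) => i.
  exact: measurable_coord.
rewrite seq_law//; first exact: pkern_law.
by rewrite -[X in measurable X]setTI; exact: mi.
Qed.

Definition seq_comp (v : nat -> I -> PM) N : kern M :=
  \big[@kern_comp R M / kdelta M]_(k < N) ipk (v k).

Lemma seq_compS v N :
  seq_comp v N.+1 = kern_comp (ipk (v 0%N)) (seq_comp (fun k => v k.+1) N).
Proof. by rewrite /seq_comp big_ord_recl. Qed.

Lemma seq_comp1 v : seq_comp v 1 = ipk (v 0%N).
Proof.
rewrite seq_compS /seq_comp big_ord0; apply: kern_ext; exact: (kern_comp_kdelta hM).
Qed.

Lemma jmeas_seq_comp e (T : measurableType e) (v : T -> nat -> I -> PM) N :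
  (forall k i, measurable_fun [set: T] (fun t => v t k i : borel PM)) ->
  jmeas (fun t => seq_comp (v t) N).
Proof.
elim: N v => [|N IH] v mv.
  rewrite (_ : (fun t => _) = fun _ => kdelta M); first exact: jmeas_cst.
  by apply/funext => t; rewrite /seq_comp big_ord0.
rewrite (_ : (fun t => _) = fun t => kern_comp (ipk (v t 0%N)) (seq_comp (fun k => v t k.+1) N)).
  apply: (jmeas_comp hM (K1 := fun t => ipk (v t 0%N))).
    exact: (jmeas_ikern zdense eps_gt0 hell (mv 0%N)).
  by apply: (IH (fun t k => v t k.+1)) => k i; exact: mv.
by apply/funext => t; rewrite seq_compS.
Qed.

Lemma measurable_coord2 (J : Type) j i :
  measurable_fun [set: power_space J (seq_space M I)] (fun v => v j i : borel PM).
Proof. exact: (measurableT_comp (measurable_coord i) (measurable_coord j)). Qed.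

(* [kern_comp K1 K2] need not be jointly measurable in [(K1, K2)], so the second factor
   is first replaced by its presentation [ppk K2], which changes [K1 K2 (x)] only on
   a null set because the two factors are independent. *)
Lemma seq_comp_law (h : R) N (Q : probability (power_space nat (seq_space M I)) R)
    (A : set (kern_space M)) : 0 <= h -> is_power_measure (PiI h) Q -> measurable A ->
  Q [set v | A (seq_comp v N.+1)] = nu (N.+1%:R * h) A.
Proof.
move=> h0 hQ; have mi : measurable_fun [set: seq_space M I]
    (fun mu : seq_space M I => ipk mu : kern_space M).
  apply: measurable_to_kern => x.
  apply: (jmeas_eval (K := fun mu : seq_space M I => ipk mu)).
  apply: (jmeas_ikern zdense eps_gt0 hell (T := seq_space M I) (mu := fun mu => mu)) => i.
  exact: measurable_coord.
have ilaw A' := ikern_law (A := A') h0.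
elim: N A => [|N IH] A mA.
  rewrite mul1r -ilaw// -(power_measure_coord (P := Q) 0%N hQ).
    by congr (Q _); apply/seteqP; split => v /=; rewrite seq_comp1.
  by rewrite -[X in measurable X]setTI; exact: mi.
have js N' : jmeas (fun v : power_space nat (seq_space M I) => seq_comp v N').
  by apply: jmeas_seq_comp => k i; exact: measurable_coord2.
have ms N' : measurable_fun [set: power_space nat (seq_space M I)]
    (fun v => seq_comp v N' : kern_space M).
  by apply: measurable_to_kern => x; exact: (jmeas_eval x (js N')).
rewrite (power_measure_cons hQ); last by rewrite -[X in measurable X]setTI; exact: ms.
have s0 : 0 <= N.+1%:R * h by rewrite mulr_ge0.
rewrite (_ : N.+2%:R * h = h + N.+1%:R * h); last by rewrite -[N.+2%:R]natr1; ring.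
set s1 := N.+1%:R * h in s0 IH *.
have pres t := pkern_presentation (t := t).
pose C (p : seq_space M I * power_space nat (seq_space M I)) : kern M :=
  kern_comp (ipk p.1) (seq_comp p.2 N.+1).
transitivity ((PiI h \x Q)%E [set p | A (C p)]).
  by congr ((PiI h \x Q)%E _); apply/funext => p; rewrite /= seq_compS.
have mC x : measurable_fun setT (fun p => C p x : borel PM).
  have m1 : measurable_fun [set: seq_space M I * power_space nat (seq_space M I)]
      (fun p => ipk p.1 x : borel PM).
    exact: (measurableT_comp (measurableT_comp (measurable_kern_eval x) mi) measurable_fst).
  have m2 : jmeas (fun p : seq_space M I * power_space nat (seq_space M I) => seq_comp p.2 N.+1).
    exact: (jmeas_precomp measurable_snd (js N.+1)).
  exact: (measurable_kern_comp hM m1 m2).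
have mid x : measurable_fun [set: kern_space M] (fun K : kern_space M => (K : kern M) x : borel PM).
  exact: measurable_kern_eval.
apply: (kern_law_unique hM (h2 := fun K : kern_space M => K) mC mid) => // s.
have bm : bmeas (kern_moment s : kern_space M -> R) by exact: kern_moment_bmeas.
rewrite (expect_convolution hM hnu pres h0 s0 bm).
have mco := measurable_convolution hM pres.
have bG := bmeas_comp bm mco.
have bCp : bmeas (fun p => kern_moment s (C p)) by exact: kern_moment_bmeas.
rewrite product_expectation//.
have mkc : measurable_family (fun _ : kern_space M => nu s1) by move=> U _; exact: measurable_cst.
rewrite -(expect_eq_law mi ilaw (rm_bmeas mkc bG)).
apply: eq_Rintegral => mu _.
have mm1 := pair1_measurable (T1 := kern_space M) (T2 := kern_space M) (ipk mu).
rewrite -(expect_eq_law (ms N.+1) IH (bmeas_comp bG mm1)).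
have mm2 := pair1_measurable (T1 := seq_space M I) (T2 := power_space nat (seq_space M I)) mu.
apply: expect_ae.
- exact: (bmeas_comp bCp mm2).
- exact: (bmeas_comp (bmeas_comp bG mm1) (ms N.+1)).
have jp : jmeas (fun v : power_space nat (seq_space M I) => ppk (seq_comp v N.+1)).
  apply: (jmeas_pkern zdense eps_gt0 hell) => y; exact: (jmeas_eval y (js N.+1)).
have ae1 y : \forall v \ae Q, seq_comp v N.+1 y = ppk (seq_comp v N.+1) y.
  have mE : measurable [set K : kern_space M | (K : kern M) y = ppk K y].
    apply: (measurable_pmeas_eq hM hd) => //.
    exact: (measurableT_comp (measurable_kern_eval y) measurable_pkern).
  apply: (ae_law (ms N.+1) IH mE).
  apply: (ae_imp ((pres s1 s0).2 y)) => K.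
  by move=> /= ->.
apply: (@kern_moment_ae _ _ _ _ Q (fun v => C (mu, v))
  (fun v => kern_comp (ipk mu) (ppk (seq_comp v N.+1)))) => x.
apply: (ae_imp (mixpm_modification hM hd (ipk mu x) (js N.+1) jp ae1)) => v.
by rewrite /C /= !(kern_compE hM) => ->.
Qed.

Context (Plev : nat -> probability (level_space M I) R)
  (w0 : dyadic_system z eps ell) (P : probability (omega w0) R) (hP : is_dyadic_law PiI Plev P).
Hypothesis zinj : injective z.

Lemma measurable_level n l i :
  measurable_fun [set: omega w0] (fun w : omega w0 => dyadic_val w n l i : borel PM).
Proof.
have mw : measurable_fun [set: omega w0] (fun w : omega w0 => dyadic_val w n : level_space M I).
  by move=> _ B mB; rewrite setTI; apply: sub_sigma_algebra; exists n, B.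
exact: (measurableT_comp (measurable_coord2 l i) mw).
Qed.

Lemma jmeas_DKlevel n s t : jmeas (fun w : omega w0 => DKlevel w n s t).
Proof.
apply: (jmeas_seq_comp
  (v := fun (w : omega w0) k => dyadic_val w n (Num.floor (s * 2 ^+ n) + k%:Z))) => k i.
exact: measurable_level.
Qed.

Lemma jmeas_DK s t : jmeas (fun w : omega w0 => DK w s t).
Proof.
rewrite /DK; case: eqP => _; first exact: jmeas_cst.
apply: (jmeas_pkern zdense eps_gt0 hell) => x.
exact: (jmeas_eval x (jmeas_DKlevel _ _ _)).
Qed.

Lemma pkern_DK (w : dyadic_system z eps ell) s t : ppk (DK w s t) = DK w s t.
Proof.
rewrite /DK; case: eqP => _; first exact: (pkern_kdelta hPM zdense eps_gt0 eps_cvg hell).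
exact: (pkern_pkern hPM zinj zdense eps_gt0 eps_cvg hell).
Qed.

(** With [s = a / 2 ^+ n], the factors come from the coordinates [a], [a + 1], ... of level [n].
    Reindexing the power measure over the integers along [k |-> a + k] turns them into the i.i.d.
    sequence of [seq_comp_law] with time step [2 ^- n]. *)
Lemma DKlevel_law n s t (A : set (kern_space M)) :
  dyadic n s -> dyadic n t -> s < t -> measurable A ->
  P [set w : omega w0 | A (DKlevel w n s t)] = nu (t - s) A.
Proof.
move=> [a sE] [b tE] st mA; have [hP1 hP2] := hP.
have n0 : 0 < 2 ^+ n :> R by rewrite exprn_gt0.
have ab : 0 < b - a.
  by move: st; rewrite sE tE ltr_pM2r ?invr_gt0// ltr_int subr_gt0.
have tsE : t - s = (b - a)%:~R / 2 ^+ n by rewrite sE tE -mulrBl rmorphB.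
have [N NE] : exists N, `|b - a|%N = N.+1.
  by exists `|b - a|%N.-1; rewrite prednK// absz_gt0 gt_eqF.
have sN : t - s = N.+1%:R * 2 ^- n.
  by rewrite tsE -NE natr_absz gtr0_norm.
pose e (k : nat) : int := a + k%:Z.
pose g (l : int) : nat := `|l - a|%N.
have eg : cancel e g by move=> k; rewrite /e /g addrAC subrr add0r.
have me : measurable_fun [set: level_space M I]
    (fun v : level_space M I => (fun k => v (e k)) : power_space nat (seq_space M I)).
  by apply: measurable_to_power => k; exact: measurable_coord.
have hQ := power_measure_reindex me eg (hP1 n).
have h0 : 0 <= 2 ^- n :> R by rewrite invr_ge0 ltW.
pose U := [set v : power_space nat (seq_space M I) | A (seq_comp v N.+1)].
have mU : measurable U.
  have js : jmeas (fun v : power_space nat (seq_space M I) => seq_comp v N.+1).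
    apply: (jmeas_seq_comp
      (v := fun (v : power_space nat (seq_space M I)) k => v k)) => k i.
    exact: measurable_coord2.
  have ms := measurable_to_kern (fun x => jmeas_eval x js).
  by rewrite -[X in measurable X]setTI; exact: ms.
rewrite sN -(seq_comp_law N h0 hQ mA) (lawE (Plev n) me mU).
rewrite -hP2; last by rewrite -[X in measurable X]setTI; exact: (me measurableT _ mU).
congr (P _); apply/funext => w.
by rewrite /U /= /DKlevel tsE sE !dyadic_floorE NE.
Qed.

Lemma DK_law s t (A : set (kern_space M)) :
  dyadics s -> dyadics t -> s <= t -> measurable A ->
  P [set w : omega w0 | A (DK w s t)] = nu (t - s) A.
Proof.
move=> [n1 _ s1] [n2 _ t2] st mA; rewrite /DK; case: eqP => [->|/eqP nst].
  rewrite subrr.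
  exact: (kdelta_law hM hnu (pkern_presentation)).
have {}st : s < t by rewrite lt_neqAle nst.
have [] := @leastP [set n | @dyadic R n s /\ dyadic n t].
  by exists (maxn n1 n2); split; [apply: dyadicS s1|apply: dyadicS t2]; rewrite leq_max leqnn ?orbT.
set n := least _ => -[sn tn] _.
have ts0 : 0 <= t - s by rewrite subr_ge0 ltW.
rewrite -(pkern_law ts0 mA).
rewrite -(DKlevel_law sn tn st)//.
rewrite -[X in measurable X]setTI.
exact: (measurable_pkern).
Qed.

Context (dhat : PMhat -> PMhat -> R) (hdhat : metrizes dhat).
Context (n_ : nat -> nat) (hn : is_time_modulus d dhat L P n_).
Context (ellhat : (nat -> PMhat) -> PMhat) (hellhat : limit_selection_hat ellhat) (x0 : M).

Let n_S j : (n_ j.+1 < n_ j.+2)%N. Proof. by have [_ h _] := hn; exact: h. Qed.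

(** The sequence [n_] is relevant from index [1] on, whereas sequences here start at [0]; hence
    [n_ j.+1], as in [flow]. *)
Definition DKfloor (s t : R) (w : dyadic_system z eps ell) j : kern M :=
  DK w (dyadic_floor (n_ j.+1) s) (dyadic_floor (n_ j.+1) t).

Let jDK s t j : jmeas (fun w : omega w0 => DKfloor s t w j).
Proof. exact: (jmeas_DK). Qed.

(** The time modulus at level [j.+1] is used with both measures equal to the Dirac mass at [x]; the
    floors of one time at two successive levels differ by at most [2 ^- n_ j.+1]. Its two bounds
    [2 ^- j.+1] are weakened to [2 ^- j] before Borel-Cantelli is applied. *)
Lemma DKfloor_step_ae s t x : s <= t ->
  \forall w \ae P, \forall j \near \oo,
    dhat (embed (DKfloor s t w j x)) (embed (DKfloor s t w j.+1 x)) < 2 ^- j.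
Proof.
move=> st; have [B hB] := proper_metric_base hM.
pose F j := [set w : omega w0 | 2 ^- j <=
  dhat (embed (DKfloor s t w j x)) (embed (DKfloor s t w j.+1 x))].
have mF c j : measurable [set w : omega w0 | c <=
    dhat (embed (DKfloor s t w j x)) (embed (DKfloor s t w j.+1 x))].
  apply: measurable_set_ge.
  exact: (measurable_metric (pmeas_countable_base hM hB) hdhat (@embed_continuous R M)
    (jmeas_eval x (jDK s t j)) (jmeas_eval x (jDK s t j.+1))).
have PF : \forall j \near \oo, (P (F j) <= (2 ^- j)%:E)%E.
  near=> j.
  have Lx : L j.+1 x by near: j; exact: (exhaustion_near hL).
  have sj : `|s| <= j%:R by near: j; exact: nbhs_infty_ger.
  have tj : `|t| <= j%:R by near: j; exact: nbhs_infty_ger.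
  have h2 : 2 ^- j.+1 <= 2 ^- j :> R.
    by rewrite lef_pV2 ?posrE ?exprn_gt0// ler_eXn2l// ltr1n.
  (* Taking a floor moves a time by at most [1], so times bounded by [j] satisfy the bound [j.+1] of
     the modulus. *)
  have floor_abs n (r : R) : `|r| <= j%:R -> `|dyadic_floor n r| <= j.+1%:R.
    move=> rj; rewrite -(subrK r (dyadic_floor n r)) (le_trans (ler_normD _ _))//.
    rewrite distrC -natr1 addrC lerD// (le_trans (dyadic_floor_dist _ _))//.
    by rewrite invf_le1 ?exprn_gt0// exprn_ege1// ler1n.
  have step r : `|dyadic_floor (n_ j.+1) r - dyadic_floor (n_ j.+2) r| <= 2 ^- n_ j.+1.
    have h3 := dyadic_floor_refine r (ltnW (n_S j)).
    have [_ h4 _] := dyadic_floorP (n_ j.+2) r.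
    have h5 := dyadic_floor_lt (n_ j.+1) r.
    by rewrite distrC ger0_norm ?subr_ge0//; lra.
  have pL : (pdirac x : PM) (L j.+1) = 1%E.
    have mL : measurable (L j.+1 : set (borel M)).
      apply: closed_borel; apply: compact_closed; first exact: metric_hausdorff.
      by have [cL _ _] := hL; exact: cL.
    rewrite (_ : (pdirac x : PM) (L j.+1) = \d_(x : borel M) (L j.+1)); last exact: trimE.
    by rewrite diracE mem_set.
  have [_ _ hmod] := hn.
  have := hmod j.+1 (dyadic_floor (n_ j.+1) s) (dyadic_floor (n_ j.+1) t)
    (dyadic_floor (n_ j.+2) s) (dyadic_floor (n_ j.+2) t) (pdirac x) (pdirac x) (ltn0Sn j).
  have d0 : d (pdirac x) (pdirac x) = 0 by apply/(metrizes_eq0 hd).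
  rewrite d0 => h.
  apply: (@le_trans _ _ (P [set w : omega w0 | (2 ^- j.+1 <=
    dhat (embed (DKfloor s t w j x)) (embed (DKfloor s t w j.+1 x)))%R])).
    apply: le_measure; rewrite ?inE//; first exact: mF.
    by move=> w /= /(le_trans h2).
  have h' : ((2 ^- j.+1)%:E <= (2 ^- j)%:E :> \bar R)%E by rewrite lee_fin.
  apply: le_trans h'.
  rewrite (_ : [set w : omega w0 | _] = [set w : omega w0 | (2 ^- j.+1 <=
      dhat (embed (kact (pdirac x) (DKfloor s t w j)))
        (embed (kact (pdirac x) (DKfloor s t w j.+1))))%R]); last first.
    by apply/funext => w; rewrite /mkset !(kact_pdirac hM).
  apply: h => //.
  - by split; exact: dyadics_floor.
  - by split; exact: floor_abs.
  - exact: dyadic_floor_mono.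
  - exact: dyadic_floor_mono.
apply: (ae_imp (borel_cantelli_half (fun j => mF (2 ^- j) j : measurable (F j)) PF)) => w [N _ hN].
by exists N => // j /= Nj; rewrite ltNge; apply/negP; exact: hN.
Unshelve. all: by end_near. Qed.

Definition DKlimit (s t : R) (w : dyadic_system z eps ell) x : PMhat :=
  ellhat (fun j => embed (DKfloor s t w j x)).

Lemma DKlimit_ae s t x : s <= t ->
  \forall w \ae P, embed (DKfloor s t w j x) @[j --> \oo] --> DKlimit s t w x.
Proof.
move=> st; apply: (ae_imp (DKfloor_step_ae x st)) => w [N _ hN].
apply: (cauchy_cluster_cvg (N := N) hdhat); first by move=> j Nj; exact: hN.
exact: hellhat.2.
Qed.

Lemma measurable_DKlimit s t : measurable_fun [set: omega w0 * borel M]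
  (fun p => DKlimit s t p.1 p.2 : borel PMhat).
Proof.
have m1 : measurable_fun [set: omega w0 * borel M]
    (fun p => (fun j => embed (DKfloor s t p.1 j p.2)) : power_space nat (borel PMhat)).
  apply: measurable_to_power => j.
  exact: (measurableT_comp (measurable_from_borel (@embed_continuous R M)) (jDK s t j)).
exact: (measurableT_comp hellhat.1 m1).
Qed.

Lemma measurable_DKlimit_eval s t x :
  measurable_fun [set: omega w0] (fun w => DKlimit s t w x : borel PMhat).
Proof. exact: (measurableT_comp (measurable_DKlimit s t) (pair2_measurable (x : borel M))). Qed.

Let floor_diff (s t : R) : dyadic_floor (n_ j.+1) t - dyadic_floor (n_ j.+1) s
  @[j --> \oo] --> t - s.
Proof. by apply: cvgB; exact: dyadic_floor_cvg. Qed.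

Lemma DKfloor_moment s t j r : s <= t ->
  \int[P]_w kern_moment r (DKfloor s t w j) =
  \int[nu (dyadic_floor (n_ j.+1) t - dyadic_floor (n_ j.+1) s)]_K kern_moment r K.
Proof.
move=> st; apply: (law_moment hM); first by move=> x; exact: (jmeas_eval x (jDK s t j)).
move=> A mA; apply: (DK_law) => //.
- exact: dyadics_floor.
- exact: dyadics_floor.
- exact: dyadic_floor_mono.
Qed.

Lemma DKfloor_moment_cvg s t r : s <= t ->
  \int[P]_w kern_moment r (DKfloor s t w j) @[j --> \oo] -->
  \int[nu (t - s)]_K kern_moment r K.
Proof.
move=> st; rewrite [X in X @ _](_ : _ = fun j => \int[nu (dyadic_floor (n_ j.+1) t -
    dyadic_floor (n_ j.+1) s)]_K kern_moment r K); last first.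
  by apply/funext => j; exact: DKfloor_moment.
apply: (moment_continuous hM hnu (pkern_presentation)).
- by move=> j; rewrite subr_ge0 dyadic_floor_mono.
- by rewrite subr_ge0.
- exact: floor_diff.
Qed.

(** For fixed [i], dominated convergence and convergence of moments identify the expected integral
    of [bump setT i] under the limit with its value under [nu (t - s)]. Only afterwards does [i]
    tend to infinity, where these values tend to [1]. *)
Lemma DKlimit_carried s t x : s <= t ->
  \forall w \ae P, DKlimit s t w x (range Some) = 1%E.
Proof.
move=> st; apply: (carried_ae hM); first exact: measurable_DKlimit_eval.
rewrite [X in X @ _](_ : _ = fun i => \int[nu (t - s)]_K \int[(K : kern M) x]_y bump setT i y).
  exact: (expect_bump_family_cvg hM _ (measurable_kern_eval x)).
apply/funext => i; have tb := bump_test hM setT i.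
have h1 := @DKfloor_moment_cvg s t [:: (x, exist _ _ tb)] st.
apply: (cvg_unique (@Rhausdorff R) _ (_ : \int[P]_w \int[DKfloor s t w j x]_y bump setT i y @[j --> \oo] --> _)).
  apply: (expect_cvg (B := 1)).
  - move=> j; have [] // := expect_kern_bmeas hM (jmeas_eval x (jDK s t j)) (test_bmeas tb).
  - have [] // := hat_expect_bmeas (measurable_DKlimit_eval s t x) tb.
  - move=> j w; have /andP[? ?] := test_expect_itv (DKfloor s t w j x) tb.
    by rewrite ger0_norm.
  - apply: (ae_imp (DKlimit_ae x st)) => w hw.
    rewrite [X in X @ _](_ : _ = fun j => \int[embed (DKfloor s t w j x)]_y hat (bump setT i) y).
      exact: (expect_weak_cvg (hat_bcontinuous tb)).
    by apply/funext => j; rewrite expect_embed_hat.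
move: h1; rewrite /kern_moment; under eq_Rintegral do rewrite big_seq1/=.
apply: cvg_trans; apply: near_eq_cvg; apply: nearW => j.
by apply: eq_Rintegral => w _; rewrite big_seq1.
Qed.

Definition DKphi (s t : R) (w : dyadic_system z eps ell) : kern M :=
  Phi z eps ell ellhat x0 (DKfloor s t w).

Lemma jmeas_unembed s t : measurable_fun [set: omega w0 * borel M]
  (fun p => unembed x0 (DKlimit s t p.1 p.2) : borel PM).
Proof.
have m1 := measurable_DKlimit s t.
exact: (measurableT_comp (measurable_unembed hM x0) m1).
Qed.

(** [Phi] applies [pkern] to each term, which changes nothing here: [pkern] is idempotent and fixes
    [kdelta]. Joint measurability of the limit ensures that [kern_of] returns the intended
    kernel. *)
Lemma DKphiE s t (w : omega w0) x : DKphi s t w x = unembed x0 (DKlimit s t w x).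
Proof.
rewrite /DKphi /Phi (_ : (fun x => _) = (fun x => unembed x0 (DKlimit s t w x))); last first.
  apply/funext => y; rewrite /DKlimit; congr (unembed x0 (ellhat _)).
  by apply/funext => j; rewrite (pkern_DK).
rewrite kern_ofE//.
exact: (measurableT_comp (jmeas_unembed s t) (pair1_measurable w)).
Qed.

Lemma jmeas_DKphi s t : jmeas (fun w : omega w0 => DKphi s t w).
Proof. by have := jmeas_unembed s t; apply: eq_measurable_fun => -[w x] _ /=; rewrite DKphiE. Qed.

Lemma DKphi_cvg_ae s t x : s <= t ->
  \forall w \ae P, (DKfloor s t w j : kern M) x @[j --> \oo] --> (DKphi s t w : kern M) x.
Proof.
move=> st.
have h1 := DKlimit_ae x st.
have h2 := DKlimit_carried x st.
apply: (@filterS2 _ (almost_everywhere P) _ _ _ _ _ h1 h2) => w w1 w2.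
rewrite DKphiE; apply: (embed_cvg hM).
by rewrite unembedK.
Qed.

Let mphi s t x : measurable_fun [set: omega w0] (fun w : omega w0 => DKphi s t w x : borel PM).
Proof. exact: (jmeas_eval x (jmeas_DKphi s t)). Qed.

(** The moments of [DKfloor] converge to those of [nu (t - s)] by continuity in time, and to those
    of [DKphi] by almost sure convergence at the finitely many points involved. *)
Lemma DKphi_law s t (A : set (kern_space M)) : s <= t -> measurable A ->
  P [set w : omega w0 | A (DKphi s t w)] = nu (t - s) A.
Proof.
move=> st mA.
apply: (kern_law_unique hM (h2 := fun K : kern_space M => K) (mphi s t) _ _ mA).
  by move=> x; exact: measurable_kern_eval.
move=> r.
have h1 := DKfloor_moment_cvg (r := r) st.
apply: (cvg_unique (@Rhausdorff R) _ h1).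
have km01 (K : kern M) : `|kern_moment r K| <= 1.
  have h01 (a : M * test_type M) : 0 <= \int[K a.1]_y sval a.2 y <= 1.
    by apply: test_expect_itv; exact: svalP.
  rewrite ger0_norm; first by apply: prodr_ile1.
  by apply: prodr_ge0 => a _; have /andP[] := h01 a.
apply: (expect_cvg (B := 1)) => //.
- by move=> j; have [] := kern_moment_bmeas hM r (fun x => jmeas_eval x (jDK s t j)).
- by have [] := kern_moment_bmeas hM r (mphi s t).
elim: r {h1 km01} => [|a r IH].
  by apply: aeW => w; rewrite /kern_moment big_nil; under eq_fun do rewrite big_nil; exact: cvg_cst.
apply: (@filterS2 _ (almost_everywhere P) _ _ _ _ _ (DKphi_cvg_ae a.1 st) IH) => w w1 w2.
rewrite /kern_moment big_cons; under eq_fun do rewrite big_cons.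
apply: cvgM => //; apply: expect_weak_cvg => //.
by apply: test_bcontinuous; exact: svalP.
Qed.

(** [DKphi] has law [nu (t - s)], and almost every kernel under this law agrees at [x] with its
    interpolation. *)
Lemma flow_eq_ae s t x : s <= t ->
  \forall w \ae P, flow n_ ellhat x0 w s t x = (DKphi s t w : kern M) x.
Proof.
move=> st; have ts : 0 <= t - s by rewrite subr_ge0.
have mp := measurable_to_kern (mphi s t).
have mE : measurable [set K : kern_space M | ppk K x = (K : kern M) x].
  apply: (measurable_pmeas_eq hM hd).
    exact: (measurableT_comp (measurable_kern_eval x) (measurable_pkern)).
  exact: measurable_kern_eval.
apply: (ae_law mp (fun A mA => DKphi_law st mA) mE).
exact: (pkern_ae x ts).
Qed.

Lemma jmeas_flow s t : jmeas (fun w : omega w0 => flow n_ ellhat x0 w s t).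
Proof.
apply: (jmeas_pkern zdense eps_gt0 hell (K := fun w : omega w0 => DKphi s t w)) => x.
exact: mphi.
Qed.

Lemma measurable_flow s t :
  measurable_fun [set: omega w0] (fun w : omega w0 => flow n_ ellhat x0 w s t : kern_space M).
Proof. by apply: measurable_to_kern => x; exact: (jmeas_eval x (jmeas_flow s t)). Qed.

Lemma flow_law s t (A : set (kern_space M)) : s <= t -> measurable A ->
  P [set w : omega w0 | A (flow n_ ellhat x0 w s t)] = nu (t - s) A.
Proof.
move=> st mA; rewrite -(DKphi_law st mA).
apply: (kern_law_ae hM (h1 := fun w : omega w0 => flow n_ ellhat x0 w s t)) => //.
  by move=> x; exact: (jmeas_eval x (jmeas_flow s t)).
by move=> x; exact: flow_eq_ae.
Qed.

(** Floors of dyadic times are eventually exact, so the sequence given to [ellhat] is eventually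
    constant and has a single cluster point. The identity holds for every [w], without an
    exceptional set. *)
Lemma flow_dyadic (w : omega w0) s t : dyadics s -> dyadics t -> flow n_ ellhat x0 w s t = DK w s t.
Proof.
move=> [n1 _ s1] [n2 _ t2].
rewrite -[RHS](pkern_DK) /flow; congr ppk.
apply: kern_ext => x; rewrite -[Phi _ _ _ _ _ _]/(DKphi s t w) DKphiE.
rewrite -[RHS](embedK x0); congr unembed.
apply: (cvg_cluster_unique (metrizes_hausdorff hdhat)); last exact: hellhat.2.
apply: cvg_near_cst; exists (maxn n1 n2) => // j /= nj.
have nn m : (m <= maxn n1 n2)%N -> (m <= n_ j.+1)%N.
  by move=> h; rewrite (leq_trans h)// (leq_trans nj)// (level_ge n_S).
rewrite /DKfloor !dyadic_floor_id//.
  by apply: dyadicS t2; rewrite nn// leq_maxr.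
by apply: dyadicS s1; rewrite nn// leq_maxl.
Qed.

Lemma flow_cvg_ae s t (kappa : PM) : s <= t ->
  \forall w \ae P, kact kappa (DKfloor s t w j) @[j --> \oo] -->
    kact kappa (flow n_ ellhat x0 w s t).
Proof.
move=> st; pose D j (p : omega w0 * borel M) := d (flow n_ ellhat x0 p.1 s t p.2) (DKfloor s t p.1 j p.2).
have mD j : measurable_fun setT (D j).
  exact: (measurable_pmeas_dist hM hd (jmeas_flow s t) (jDK s t j)).
(* Convergence is expressed through real distances: the good pairs then form a set built from
   countably many measurable conditions, as Fubini requires. *)
pose E := [set p | D j p @[j --> \oo] --> (0 : R)].
have d0 x y : 0 <= d x y by exact: metrizes_ge0.
have mE : measurable E.
  rewrite (_ : E = \bigcap_k \bigcup_N \bigcap_(j in [set j | (N <= j)%N])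
      [set p | D j p < 2 ^- k]).
    apply: bigcapT_measurable => k; apply: bigcupT_measurable => N.
    by apply: bigcap_measurableType => j _; apply: measurable_set_lt.
  apply/seteqP; split => p.
    move=> hp k _; have e0 : 0 < 2 ^- k :> R by rewrite invr_gt0 exprn_gt0.
    by have [N _ hN] := cvgr_lt _ hp _ e0; exists N.
  move=> hp; apply/cvgrPdist_lt => e /half_pow_lt[k hk].
  have [N _ hN] := hp k Logic.I; exists N => // j Nj.
  by rewrite sub0r normrN ger0_norm ?d0// (lt_trans (hN j Nj))// hk.
have EP p : E p -> DKfloor s t p.1 j p.2 @[j --> \oo] --> flow n_ ellhat x0 p.1 s t p.2.
  move=> hp; apply: (metrizes_cvg hd) => e e0.
  exact: (cvgr_lt _ hp _ e0).
have hE x : \forall w \ae P, E (w, x).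
  apply: (@filterS2 _ (almost_everywhere P) _ _ _ _ _ (DKphi_cvg_ae x st) (flow_eq_ae x st)).
  move=> w w1 w2; rewrite /E/= /D /= w2; apply/cvgrPdist_lt => e e0.
  have /w1 h : nbhs ((DKphi s t w : kern M) x) [set y | d (DKphi s t w x) y < e].
    by apply/(metrizes_nbhs hd); exists e.
  by apply: (@filterS _ \oo _ _ _ _ h) => j /= hj; rewrite sub0r normrN ger0_norm.
apply: (ae_imp (ae_swap kappa mE hE)) => w hw.
apply: pmeas_cvg => f bf; have bmf := bcontinuous_bmeas bf.
suff h : \int[mixpm kappa (DKfloor s t w j)]_x f x @[j --> \oo] -->
    \int[mixpm kappa (flow n_ ellhat x0 w s t)]_x f x by exact: h.
rewrite (expect_mixpm hM) //; last exact: kern_meas.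
rewrite [X in X @ _](_ : _ = fun j => \int[kappa]_y \int[DKfloor s t w j y]_x f x); last first.
  by apply/funext => j; rewrite (expect_mixpm hM) //; exact: kern_meas.
have [_ [C fC]] := bf.
apply: (expect_cvg (B := C)).
- by move=> j; have [] := expect_kern_bmeas hM (kern_meas (DKfloor s t w j)) bmf.
- by have [] := expect_kern_bmeas hM (kern_meas (flow n_ ellhat x0 w s t)) bmf.
- by move=> j x; exact: expect_bound.
apply: (ae_imp hw) => x /EP/= h.
exact: expect_weak_cvg.
Qed.

End feller.

Theorem proposition4p4 (R : realType) (M : pmetricType R)
    (hM : proper_metric M)
    (d : pmeas M R -> pmeas M R -> R)
    (hd : metrizes d) (hdc : complete_metric d)
    (dhat : pmeas (compactify M) R -> pmeas (compactify M) R -> R)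
    (hdhat : metrizes dhat)
    (nu : R -> probability (kern_space M) R)
    (hnu : feller_convolution_semigroup nu)
    (Pi : forall n, R -> ('I_n -> M) -> probability (npoint_space M n) R)
    (hPi : is_spatial_law nu Pi)
    (L : nat -> set M) (hL : is_exhaustion L)
    (eps : nat -> R) (heps : is_modulus d L Pi eps)
    (I : set nat) (z : I -> M) (hzinj : injective z) (hz : dense (range z))
    (ell : (nat -> pmeas M R) -> pmeas M R) (hell : limit_selection ell)
    (PiI : R -> probability (seq_space M I) R) (hPiI : is_seq_law z Pi PiI)
    (Plev : nat -> probability (level_space M I) R)
    (w0 : dyadic_system z eps ell) (P : probability (omega w0) R)
    (hP : is_dyadic_law PiI Plev P)
    (n_ : nat -> nat) (hn : is_time_modulus d dhat L P n_)
    (ellhat : (nat -> pmeas (compactify M) R) -> pmeas (compactify M) R)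
    (hellhat : limit_selection_hat ellhat) (x0 : M) :
  (forall (s t : R) (kappa : pmeas M R), s <= t ->
    \forall w \ae P,
      (fun j => kact kappa
         (flow n_ ellhat x0 w (dyadic_floor (n_ j) s) (dyadic_floor (n_ j) t)))
        @ \oo --> kact kappa (flow n_ ellhat x0 w s t)) /\
  (forall s t : R, s <= t ->
    measurable_fun [set: omega w0]
      (fun w : omega w0 => flow n_ ellhat x0 w s t : kern_space M) /\
    forall A : set (kern_space M), measurable A ->
      P [set w : omega w0 | A (flow n_ ellhat x0 w s t)] = nu (t - s) A).
Proof.
split=> [s t kappa st|s t st]; last first.
  split; first exact: (measurable_flow hM hd heps hz hell hzinj n_ hellhat).
  move=> A mA.
  exact: (flow_law hM hd hnu hPi hL heps hz hell hPiI hP hzinj hdhat hn hellhat).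
have h := flow_cvg_ae hM hd hnu hPi hL heps hz hell hPiI hP hzinj hdhat hn hellhat x0 kappa st.
apply: (ae_imp h) => w hw.
(* Shifting the index by one matches [DKfloor], and at the dyadic floors the flow is [DK] itself by
   [flow_dyadic]. *)
rewrite -(cvg_shiftS (fun j => kact kappa
  (flow n_ ellhat x0 w (dyadic_floor (n_ j) s) (dyadic_floor (n_ j) t)))).
rewrite [X in X @ _](_ : _ = fun j => kact kappa (DKfloor n_ s t w j)); first exact: hw.
apply/funext => j; rewrite /DKfloor; congr kact.
by apply: (flow_dyadic hM hd heps hz hell hzinj hdhat hn hellhat); exact: dyadics_floor.
Qed.
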